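(* Let $(N,J,\nabla)$ be a special complex manifold and let $M=TN$ be its tangent bundle. Then the triple $(I_1,I_2,I_3)$ of endomorphism fields on $M$ defined by $$I_1(X^{h_\nabla}+Y^v)=(JX)^{h_\nabla}-(JY)^v,\quad I_2(X^{h_\nabla}+Y^v)=Y^{h_\nabla}-X^v,\quad I_3(X^{h_\nabla}+Y^v)=(JY)^{h_\nabla}+(JX)^v$$ is a hypercomplex structure on $M$, and the Obata connection of the hypercomplex manifold $(M,(I_1,I_2,I_3))$ is Ricci flat.
   Context: A special complex manifold $(N,J,\nabla)$ is a complex manifold $(N,J)$ with a torsion-free flat connection $\nabla$ on $TN$ such that $\nabla J$ is symmetric, i.e. $(\nabla_XJ)Y=(\nabla_YJ)X$. For $X\in TN$, $X^{h_\nabla}$ and $X^v$ denote the $\nabla$-horizontal lift and the vertical lift to $TN$. A hypercomplex structure is a triple of integrable almost complex structures with $I_1I_2=-I_2I_1=I_3$; its Obata connection is the unique torsion-free connection for which $I_1,I_2,I_3$ are parallel. Ricci flat means that $Ric(Y,Z)=\mathrm{Tr}(X\mapsto R_{X,Y}Z)$ vanishes. *)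

(* Defs.v *)
From HB Require Import structures.
From mathcomp Require Import all_boot all_order all_algebra.
From mathcomp Require Import all_classical all_reals all_analysis.
Import Order.TTheory GRing.Theory Num.Theory.
Import numFieldNormedType.Exports.

Set Implicit Arguments.
Unset Strict Implicit.
Unset Printing Implicit Defensive.

Local Open Scope classical_set_scope.
Local Open Scope ring_scope.

(* C^oo on the (open) set U: all iterated directional derivatives are Frechet
   differentiable, hence also continuous, at every point of U. *)
Definition smooth_on (R : realType) (n : nat) (W : normedModType R)
    (U : set 'rV[R]_n) (f : 'rV[R]_n -> W) : Prop :=
  forall (vs : seq 'rV[R]_n) (x : 'rV[R]_n), U x ->
    differentiable (foldr (fun v g => fun y => 'D_v g y) f vs) x.

(* The data of an atlas. [param a] is the inverse of [coord a] on its image.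
   Each point p has a preferred chart [chart_at p] around it; the tangent space
   T_pN is represented by 'rV[R]_n, a vector being given by its components in
   the chart [chart_at p]. No axiom is imposed here: see [manifold]. *)
Record atlas (R : realType) (n : nat) := Atlas {
  point :> Type;
  chart : Type;
  dom : chart -> set point;
  coord : chart -> point -> 'rV[R]_n;
  param : chart -> 'rV[R]_n -> point;
  chart_at : point -> chart }.

Arguments dom {R n} a _ : rename.
Arguments coord {R n} a _ _ : rename.
Arguments param {R n} a _ _ : rename.
Arguments chart_at {R n} a _ : rename.

Section Manifold.
Context {R : realType} {n : nat}.

Section Fields.
Variable N : atlas R n.

(* the topology induced by the atlas *)
Definition mopen (V : set N) : Prop :=
  forall a : chart N, open (coord N a @` (dom N a `&` V)).

(* A smooth manifold: Hausdorff, with countably many charts covering it (for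
   an atlas modelled on R^n this amounts to second countability). *)
Record manifold : Prop := Manifold {
  mem_chart_at : forall p, dom N (chart_at N p) p;
  coordK : forall a p, dom N a p -> param N a (coord N a p) = p;
  open_overlap : forall a b, open (coord N a @` (dom N a `&` dom N b));
  smooth_transition : forall a b,
    smooth_on (coord N a @` (dom N a `&` dom N b)) (coord N b \o param N a);
  hausdorff : forall p q : N, p <> q -> exists U V : set N,
    [/\ mopen U, mopen V, U p, V q & U `&` V = set0];
  countable_cover : exists A : set (chart N),
    countable A /\ forall p, exists2 a, A a & dom N a p }.

(* components in the chart b of the tangent vector at p whose components in
   the chart a are v *)
Definition change_chart (a b : chart N) (p : N) (v : 'rV[R]_n) : 'rV[R]_n :=
  'D_v (coord N b \o param N a) (coord N a p).

(* A vector field is a map N -> 'rV[R]_n, its value at p being read in T_pN. *)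
Definition components (a : chart N) (X : N -> 'rV[R]_n) (x : 'rV[R]_n) :
    'rV[R]_n :=
  let p := param N a x in change_chart (chart_at N p) a p (X p).

Definition smooth_fun (V : set N) (f : N -> R) : Prop :=
  forall a, smooth_on (coord N a @` (dom N a `&` V)) (f \o param N a).

Definition smooth_field (V : set N) (X : N -> 'rV[R]_n) : Prop :=
  forall a, smooth_on (coord N a @` (dom N a `&` V)) (components a X).

Definition smooth_fun_near (p : N) (f : N -> R) : Prop :=
  exists V, [/\ mopen V, V p & smooth_fun V f].

Definition smooth_field_near (p : N) (X : N -> 'rV[R]_n) : Prop :=
  exists V, [/\ mopen V, V p & smooth_field V X].

(* df_p(v) *)
Definition dfun (f : N -> R) (p : N) (v : 'rV[R]_n) : R :=
  'D_v (f \o param N (chart_at N p)) (coord N (chart_at N p) p).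

(* [X, Y]^i = X^j d_j Y^i - Y^j d_j X^i *)
Definition bracket (X Y : N -> 'rV[R]_n) (p : N) : 'rV[R]_n :=
  let a := chart_at N p in
  'D_(X p) (components a Y) (coord N a p)
  - 'D_(Y p) (components a X) (coord N a p).

(* the vector field on the domain of the chart a with constant components v
   in this chart *)
Definition coord_field (a : chart N) (v : 'rV[R]_n) (q : N) : 'rV[R]_n :=
  change_chart a (chart_at N q) q v.

Record smooth_endo (J : N -> 'rV[R]_n -> 'rV[R]_n) : Prop := SmoothEndo {
  endo_linear : forall p, linear (J p);
  endo_smooth : forall V X, mopen V -> smooth_field V X ->
    smooth_field V (fun p => J p (X p)) }.

Definition nijenhuis (J : N -> 'rV[R]_n -> 'rV[R]_n) (X Y : N -> 'rV[R]_n)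
    (p : N) : 'rV[R]_n :=
  bracket (fun q => J q (X q)) (fun q => J q (Y q)) p
  - J p (bracket (fun q => J q (X q)) Y p)
  - J p (bracket X (fun q => J q (Y q)) p)
  - bracket X Y p.

(* Integrability of an almost complex structure is the vanishing of its
   Nijenhuis tensor. *)
Record integrable_complex_structure (J : N -> 'rV[R]_n -> 'rV[R]_n) : Prop :=
  IntegrableComplexStructure {
  complex_endo : smooth_endo J;
  complex_sq : forall p v, J p (J p v) = - v;
  complex_nijenhuis : forall p X Y, smooth_field_near p X ->
    smooth_field_near p Y -> nijenhuis J X Y p = 0 }.

(* [D p v Y] is the covariant derivative of the local vector field Y, defined
   and smooth near p, in the direction v of T_pN; the value of [D p v Y] for Y
   not smooth near p is irrelevant. *)
Record connection (D : N -> 'rV[R]_n -> (N -> 'rV[R]_n) -> 'rV[R]_n) : Prop :=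
  Connection {
  conn_linear : forall p Y, smooth_field_near p Y ->
    linear (fun v => D p v Y);
  conn_add : forall p v Y Z, smooth_field_near p Y -> smooth_field_near p Z ->
    D p v (fun q => Y q + Z q) = D p v Y + D p v Z;
  conn_leibniz : forall p v f Y, smooth_fun_near p f -> smooth_field_near p Y ->
    D p v (fun q => f q *: Y q) = dfun f p v *: Y p + f p *: D p v Y;
  conn_local : forall p v Y Z (V : set N), mopen V -> V p -> smooth_field V Y ->
    (forall q, V q -> Y q = Z q) -> D p v Y = D p v Z;
  conn_smooth : forall V X Y, mopen V -> smooth_field V X ->
    smooth_field V Y -> smooth_field V (fun p => D p (X p) Y) }.

Section Connection.
Variable D : N -> 'rV[R]_n -> (N -> 'rV[R]_n) -> 'rV[R]_n.

Definition torsion_free : Prop :=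
  forall p X Y, smooth_field_near p X -> smooth_field_near p Y ->
    D p (X p) Y - D p (Y p) X = bracket X Y p.

Definition curvature (X Y Z : N -> 'rV[R]_n) (p : N) : 'rV[R]_n :=
  D p (X p) (fun q => D q (Y q) Z) - D p (Y p) (fun q => D q (X q) Z)
  - D p (bracket X Y p) Z.

Definition flat : Prop :=
  forall p X Y Z, smooth_field_near p X -> smooth_field_near p Y ->
    smooth_field_near p Z -> curvature X Y Z p = 0.

(* Ric(Y, Z)_p = Tr (x |-> R_{x,Y} Z) over x in T_pN; since R is tensorial, x
   may be extended to a vector field arbitrarily. *)
Definition ricci (Y Z : N -> 'rV[R]_n) (p : N) : R :=
  \tr (lin1_mx (fun x => curvature (coord_field (chart_at N p) x) Y Z p)).

Definition ricci_flat : Prop :=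
  forall p Y Z, smooth_field_near p Y -> smooth_field_near p Z ->
    ricci Y Z p = 0.

(* (nabla_v J) Y *)
Definition nabla_endo (J : N -> 'rV[R]_n -> 'rV[R]_n) (p : N) (v : 'rV[R]_n)
    (Y : N -> 'rV[R]_n) : 'rV[R]_n :=
  D p v (fun q => J q (Y q)) - J p (D p v Y).

Definition parallel_endo (J : N -> 'rV[R]_n -> 'rV[R]_n) : Prop :=
  forall p v Y, smooth_field_near p Y -> nabla_endo J p v Y = 0.

End Connection.

Record special_complex_manifold (J : N -> 'rV[R]_n -> 'rV[R]_n)
    (D : N -> 'rV[R]_n -> (N -> 'rV[R]_n) -> 'rV[R]_n) : Prop :=
  SpecialComplexManifold {
  special_manifold : manifold;
  special_complex : integrable_complex_structure J;
  special_connection : connection D;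
  special_torsion_free : torsion_free D;
  special_flat : flat D;
  special_symmetric : forall p X Y, smooth_field_near p X ->
    smooth_field_near p Y -> nabla_endo D J p (X p) Y = nabla_endo D J p (Y p) X
  }.

Record hypercomplex_manifold (I1 I2 I3 : N -> 'rV[R]_n -> 'rV[R]_n) : Prop :=
  HypercomplexManifold {
  hyper_manifold : manifold;
  hyper_I1 : integrable_complex_structure I1;
  hyper_I2 : integrable_complex_structure I2;
  hyper_I3 : integrable_complex_structure I3;
  hyper_I12 : forall p v, I1 p (I2 p v) = I3 p v;
  hyper_I21 : forall p v, - I2 p (I1 p v) = I3 p v }.

Definition hypercomplex_connection (I1 I2 I3 : N -> 'rV[R]_n -> 'rV[R]_n)
    (D : N -> 'rV[R]_n -> (N -> 'rV[R]_n) -> 'rV[R]_n) : Prop :=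
  connection D /\ torsion_free D /\
  [/\ parallel_endo D I1, parallel_endo D I2 & parallel_endo D I3].

(* Uniqueness is on local smooth fields, where connections are meaningful. *)
Definition obata_connection (I1 I2 I3 : N -> 'rV[R]_n -> 'rV[R]_n)
    (D : N -> 'rV[R]_n -> (N -> 'rV[R]_n) -> 'rV[R]_n) : Prop :=
  hypercomplex_connection I1 I2 I3 D /\
  forall D', hypercomplex_connection I1 I2 I3 D' ->
    forall p v Y, smooth_field_near p Y -> D' p v Y = D p v Y.

End Fields.

(* The total space of TN, with the charts (p, v) |-> (x, y) induced by the
   charts of N, where y is the row of components of v in the chart x. *)
Definition tangent_bundle (N : atlas R n) : atlas R (n + n) :=
  @Atlas R (n + n) (N * 'rV[R]_n)%type (chart N)
    (fun a => [set q | dom N a q.1])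
    (fun a q => row_mx (coord N a q.1)
       (change_chart (chart_at N q.1) a q.1 q.2))
    (fun a z => let p := param N a (lsubmx z) in
       (p, change_chart a (chart_at N p) p (rsubmx z)))
    (fun q => chart_at N q.1).

Section Lifts.
Variables (N : atlas R n) (J : N -> 'rV[R]_n -> 'rV[R]_n).
Variable D : N -> 'rV[R]_n -> (N -> 'rV[R]_n) -> 'rV[R]_n.
Implicit Types (q : tangent_bundle N) (X Y : 'rV[R]_n) (W : 'rV[R]_(n + n)).

(* Gamma^k_{ij} X^i v^j at q = (p, v), in the preferred chart of p *)
Definition christoffel q X : 'rV[R]_n :=
  D q.1 X (coord_field (chart_at N q.1) q.2).

(* X^v = X^k d/dy^k *)
Definition vlift q X : 'rV[R]_(n + n) := row_mx 0 X.

(* X^h = X^k d/dx^k - Gamma^k_{ij} X^i y^j d/dy^k *)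
Definition hlift q X : 'rV[R]_(n + n) := row_mx X (- christoffel q X).

(* the X and the Y of the decomposition W = X^h + Y^v: see lift_decomposition *)
Definition hpart q W : 'rV[R]_n := lsubmx W.
Definition vpart q W : 'rV[R]_n := rsubmx W + christoffel q (lsubmx W).

Lemma lift_decomposition q W : hlift q (hpart q W) + vlift q (vpart q W) = W.
Proof.
rewrite /hlift /vlift /hpart /vpart add_row_mx addr0 [- _ + _]addrC addrK.
exact: hsubmxK.
Qed.

Lemma hpart_lift q X Y : hpart q (hlift q X + vlift q Y) = X.
Proof. by rewrite /hpart add_row_mx row_mxKl addr0. Qed.

Lemma vpart_lift q X Y : vpart q (hlift q X + vlift q Y) = Y.
Proof.
by rewrite /vpart add_row_mx row_mxKl row_mxKr addr0 addrAC addNr add0r.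
Qed.

Definition I1 q W : 'rV[R]_(n + n) :=
  hlift q (J q.1 (hpart q W)) - vlift q (J q.1 (vpart q W)).

Definition I2 q W : 'rV[R]_(n + n) :=
  hlift q (vpart q W) - vlift q (hpart q W).

Definition I3 q W : 'rV[R]_(n + n) :=
  hlift q (J q.1 (vpart q W)) + vlift q (J q.1 (hpart q W)).

Lemma I1_lift q X Y :
  I1 q (hlift q X + vlift q Y) = hlift q (J q.1 X) - vlift q (J q.1 Y).
Proof. by rewrite /I1 hpart_lift vpart_lift. Qed.

Lemma I2_lift q X Y : I2 q (hlift q X + vlift q Y) = hlift q Y - vlift q X.
Proof. by rewrite /I2 hpart_lift vpart_lift. Qed.

Lemma I3_lift q X Y :
  I3 q (hlift q X + vlift q Y) = hlift q (J q.1 Y) + vlift q (J q.1 X).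
Proof. by rewrite /I3 hpart_lift vpart_lift. Qed.

End Lifts.

End Manifold.

(* Main.v *)
(* On M = TN, the horizontal and vertical lifts identify TM with two copies of
   the pullback of TN, that is, with its complexification
   X^h + Y^v |-> X + i Y. On TN there are two flat torsion-free connections, D
   and D' := J^-1 D J (torsion-freeness of D' is the symmetry of DJ). Their mean
   D + C, where C := (D' - D) / 2 is a symmetric tensor, satisfies (D + C)J = 0,
   and J C_X = - C_X J. The connection W |-> D_W + C_X + i C_Y for W = X^h + Y^v
   on the complexification is torsion-free on M and preserves I1, I2 and I3.
   Hence the three structures are integrable and this is the Obata connection.
   Flatness of D and D' = D + 2C gives (D_X C)_Y - (D_Y C)_X = - 2 [C_X, C_Y],
   which reduces the Ricci tensor to traces of endomorphisms (D_Y C)_Z; these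
   vanish since C_Z anticommutes with J and therefore has trace 0.
   As no parallel coordinates are at hand, everything is computed in arbitrary
   charts with the Christoffel symbols of D and D'. *)
From Pilot Require Import Defs.
From HB Require Import structures.
From mathcomp Require Import all_boot all_order all_algebra.
From mathcomp Require Import all_classical all_reals all_analysis.
From mathcomp Require Import ring lra.
Import Order.TTheory GRing.Theory Num.Theory.
Import numFieldNormedType.Exports.
(* [mathcomp.algebra.vector] has another [coord]. *)
Import Pilot.Defs.

Set Implicit Arguments.
Unset Strict Implicit.
Unset Printing Implicit Defensive.

Local Open Scope classical_set_scope.
Local Open Scope ring_scope.

(** * Directional derivatives *)

(** With X^h + Y^v read as X + i Y, I2 is multiplication by -i and I1 is J composed with complex
    conjugation. This explains the term i C_Y. The operator D_W + C_X already commutes with I1 and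
    I2, but it has torsion: C_X only sees the horizontal part of W. Adding i C_Y turns C into its
    complex bilinear extension, which is symmetric and so drops out of the torsion; I1 stays
    parallel because i anticommutes with conjugation and C_Y with J. Flatness of D is needed for the
    torsion too: it makes the horizontal distribution integrable. The price of arbitrary charts is
    that every object picks up Hessians of the transition maps. That the connection is well defined
    on M is the cancellation of these Hessians between the horizontal lift, the Christoffel symbols
    and the derivative of the transition. In the Ricci trace over u, the direction u first occurs as
    a direction of differentiation of C, where tracelessness of C says nothing. The flatness
    relation exchanges u with the fixed direction; after that the trace can be taken under the
    derivative. *)

Section LinearFun.
Context {K : nzRingType} {V W : lmodType K}.
Variable f : V -> W.
Hypothesis fl : linear f.

Lemma linD u v : f (u + v) = f u + f v.
Proof. by have := fl 1 u v; rewrite !scale1r. Qed.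

Lemma lin0 : f 0 = 0.
Proof. by apply: (addrI (f 0)); rewrite -linD !addr0. Qed.

Lemma linZ a u : f (a *: u) = a *: f u.
Proof. by have := fl a u 0; rewrite lin0 !addr0. Qed.

Lemma linN u : f (- u) = - f u.
Proof. by rewrite -scaleN1r linZ scaleN1r. Qed.

Lemma linB u v : f (u - v) = f u - f v.
Proof. by rewrite linD linN. Qed.

Lemma lin_sum (I : Type) (r : seq I) (P : pred I) (F : I -> V) :
  f (\sum_(i <- r | P i) F i) = \sum_(i <- r | P i) f (F i).
Proof.
by elim/big_rec2: _ => [|i y x _ <-]; [exact: lin0 | rewrite linD].
Qed.

End LinearFun.

Lemma lin_rV_sum {K : nzRingType} {W : lmodType K} m (f : 'rV[K]_m -> W) :
  linear f -> forall u, f u = \sum_i u 0 i *: f (delta_mx 0 i).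
Proof.
by move=> fl u; rewrite {1}(row_sum_delta u) (lin_sum fl); apply: eq_bigr => i _;
  rewrite (linZ fl).
Qed.

Section Differentiation.
Context {R : realType}.
Implicit Types V W : normedModType R.

(** Both maps have the same first-order expansion at [x]; uniqueness of the differential then
    identifies ['d g x] with ['d f x]. *)
Lemma near_eq_differentiable V W (f g : V -> W) (x : V) :
  (\forall z \near x, f z = g z) -> differentiable f x -> differentiable g x.
Proof.
move=> fg df.
have e : g \o shift x = cst (g x) + 'd f x +o_ 0 id.
  apply/eqaddoP => _/posnumP[e].
  have /eqaddoP /(_ e%:num) /(_ [gt0 of e%:num]) := diff_locally df.
  rewrite -(nbhs_singleton fg); apply: filter_app.
  have : \forall h \near (0 : V), f (h + x) = g (h + x).
    rewrite (near_shift x) /=; apply: filterS fg => z.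
    by rewrite sub0r /= subrK.
  apply: filterS => h /= fgh.
  by rewrite !fctE /= fgh.
have d := diff_unique (diff_continuous df) e.
by apply/diff_locallyP; rewrite d; split => //; exact: diff_continuous.
Qed.

Lemma derive_comp (U V W : normedModType R) (f : U -> V) (g : V -> W) x v :
  differentiable f x -> differentiable g (f x) ->
  'D_v (fun z => g (f z)) x = 'D_('D_v f x) g (f x).
Proof.
move=> df dg; have := differentiable_comp df dg => dgf.
by rewrite (deriveE _ dgf) (diff_comp df dg) !deriveE.
Qed.

(** The base point [y] is kept free because [trans a b (coord N a p)] equals [coord N b p] only
    propositionally. *)
Lemma derive_comp_eq (U V W : normedModType R) (f : U -> V) (g : V -> W) x y v :
  f x = y -> differentiable f x -> differentiable g y ->
  'D_v (fun z => g (f z)) x = 'D_('D_v f x) g y.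
Proof. by move=> <-; exact: derive_comp. Qed.

Lemma linear_derive V W (f : V -> W) x :
  differentiable f x -> linear (fun v => 'D_v f x).
Proof. by move=> df a u v; rewrite !deriveE // linearP. Qed.

Lemma differentiable_add V W (f g : V -> W) x : differentiable f x ->
  differentiable g x -> differentiable (fun z => f z + g z) x.
Proof. exact: differentiableD. Qed.

Lemma derive_add V W (f g : V -> W) x v : differentiable f x ->
  differentiable g x -> 'D_v (fun z => f z + g z) x = 'D_v f x + 'D_v g x.
Proof.
by move=> df dg; apply: (@deriveD _ _ _ f g); apply: diff_derivable.
Qed.

Lemma derive_opp V W (f : V -> W) x v : differentiable f x ->
  'D_v (fun z => - f z) x = - 'D_v f x.
Proof. by move=> df; apply: (@deriveN _ _ _ f); apply: diff_derivable. Qed.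

Lemma differentiable_sub V W (f g : V -> W) x : differentiable f x ->
  differentiable g x -> differentiable (fun z => f z - g z) x.
Proof. exact: differentiableB. Qed.

Lemma derive_sub V W (f g : V -> W) x v : differentiable f x ->
  differentiable g x -> 'D_v (fun z => f z - g z) x = 'D_v f x - 'D_v g x.
Proof.
by move=> df dg; apply: (@deriveB _ _ _ f g); apply: diff_derivable.
Qed.

Lemma derive_scale V W (f : V -> W) k x v : differentiable f x ->
  'D_v (fun z => k *: f z) x = k *: 'D_v f x.
Proof. by move=> df; apply: (@deriveZ _ _ _ f); apply: diff_derivable. Qed.

Lemma differentiable_bigsum V W m (f : 'I_m -> V -> W) x :
  (forall i, differentiable (f i) x) ->
  differentiable (fun z => \sum_i f i z) x.
Proof.
move=> df; rewrite (_ : (fun z => _) = \sum_i f i); last first.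
  by apply/funext => z; rewrite fct_sumE.
exact: differentiable_sum.
Qed.

Lemma derive_bigsum V W m (f : 'I_m -> V -> W) x v :
  (forall i, differentiable (f i) x) ->
  'D_v (fun z => \sum_i f i z) x = \sum_i 'D_v (f i) x.
Proof.
move=> df; rewrite (_ : (fun z => _) = \sum_i f i); last first.
  by apply/funext => z; rewrite fct_sumE.
by rewrite derive_sum // => i; apply: diff_derivable.
Qed.

(** Declared as an instance below, so that the product rule for a scalar times a vector becomes the
    differential of a bilinear map. *)
Lemma scaler_is_bilinear W :
  bilinear_for
    (GRing.Scale.Law.clone _ _ *:%R _) (GRing.Scale.Law.clone _ _ *:%R _)
    (@GRing.scale R W).
Proof.
split=> [u'|u] a x y /=.
- by rewrite scalerDl scalerA.
- by rewrite scalerDr !scalerA mulrC.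
Qed.

HB.instance Definition _ W := bilinear_isBilinear.Build R R W W _ _
  (@GRing.scale R W) (scaler_is_bilinear W).

Lemma differentiable_scaler V W (f : V -> R) (g : V -> W) x :
  differentiable f x -> differentiable g x ->
  differentiable (fun z => f z *: g z) x.
Proof.
move=> df dg.
apply: (@differentiable_comp _ V (R * W)%type W (fun z => (f z, g z)) (fun p =>
  p.1 *: p.2)).
  exact: differentiable_pair.
by apply: (@differentiable_bilin _ _ _ _ (@GRing.scale R W)) => p;
  apply: scale_continuous.
Qed.

Lemma derive_scaler V W (f : V -> R) (g : V -> W) x v :
  differentiable f x -> differentiable g x ->
  'D_v (fun z => f z *: g z) x = 'D_v f x *: g x + f x *: 'D_v g x.
Proof.
move=> df dg.
have dp := differentiable_pair df dg.
have ds : differentiable (fun p : R * W => p.1 *: p.2) (f x, g x).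
  by apply: (@differentiable_bilin _ _ _ _ (@GRing.scale R W)) => p;
    apply: scale_continuous.
rewrite (derive_comp (f := fun z => (f z, g z)) (g := fun p => p.1 *: p.2)) //.
rewrite !deriveE // (@diff_bilin _ _ _ _ (@GRing.scale R W)) /=; last first.
  by move=> p; apply: scale_continuous.
by rewrite diff_pair //= addrC.
Qed.

Lemma differentiable_linear W m (f : 'rV[R]_m -> W) x :
  linear f -> differentiable f x.
Proof.
move=> fl; rewrite (_ : f = fun u => \sum_i u 0 i *: f (delta_mx 0 i)).
  apply: differentiable_bigsum => i; apply: differentiableZl.
  exact: differentiable_coord.
by apply/funext => u; exact: lin_rV_sum.
Qed.

Lemma derive_linear W m (f : 'rV[R]_m -> W) x v :
  linear f -> 'D_v f x = f v.
Proof.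
(* The difference quotient is constantly [f v] away from [h = 0]. *)
move=> fl; apply: cvg_lim => //.
apply: (@cvg_near_cst _ _ (f v)) => /=.
have : \forall h \near (0 : R)^', h != 0 by exact: nbhs_dnbhs_neq.
apply: filterS => h h0.
by rewrite (linD fl) addrK (linZ fl) scalerA mulVf // scale1r.
Qed.

Lemma differentiable_coef V m (f : V -> 'rV[R]_m) x i :
  differentiable f x -> differentiable (fun z => f z 0 i) x.
Proof.
move=> df; apply: (differentiable_comp df (g := fun z : 'rV_m => z 0 i)).
exact: differentiable_coord.
Qed.

Lemma derive_coef V m (f : V -> 'rV[R]_m) x v i :
  differentiable f x -> 'D_v (fun z => f z 0 i) x = 'D_v f x 0 i.
Proof.
move=> df; rewrite (derive_comp (g := fun z : 'rV_m => z 0 i)) //;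
  last exact: differentiable_coord.
by rewrite derive_linear // => a s t; rewrite !mxE.
Qed.

(** Expanding [s z] in the standard basis separates the two ways in which [F z (s z)] depends on
    [z]. It is then enough to know [F] for each fixed vector, which is how tensors and Christoffel
    symbols are given below. *)
Lemma near_family V W m (F : V -> 'rV[R]_m -> W) (s : V -> 'rV[R]_m) (x : V) :
  (\forall z \near x, linear (F z)) ->
  \forall z \near x, \sum_i s z 0 i *: F z (delta_mx 0 i) = F z (s z).
Proof. by apply: filterS => z Fl; rewrite -lin_rV_sum. Qed.

Lemma differentiable_family V W m (F : V -> 'rV[R]_m -> W) (s : V -> 'rV[R]_m) (x : V) :
  (\forall z \near x, linear (F z)) ->
  (forall u, differentiable (fun z => F z u) x) -> differentiable s x ->
  differentiable (fun z => F z (s z)) x.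
Proof.
move=> Fl dF ds; apply: near_eq_differentiable (near_family s Fl) _.
apply: differentiable_bigsum => i; apply: differentiable_scaler => //.
exact: differentiable_coef.
Qed.

Lemma derive_family V W m (F : V -> 'rV[R]_m -> W) (s : V -> 'rV[R]_m) (x v : V) :
  (\forall z \near x, linear (F z)) ->
  (forall u, differentiable (fun z => F z u) x) -> differentiable s x ->
  'D_v (fun z => F z (s z)) x = 'D_v (fun z => F z (s x)) x + F x ('D_v s x).
Proof.
move=> Fl dF ds.
rewrite -(near_eq_derive v (near_family s Fl)).
rewrite -(near_eq_derive v (near_family (cst (s x)) Fl)).
have dsi i := differentiable_coef i ds.
have dci i : differentiable (fun z : V => cst (s x) z 0 i) x.
  exact: (differentiable_cst (s x 0 i)).
rewrite !derive_bigsum; last 2 first.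
- by move=> i; apply: differentiable_scaler.
- by move=> i; apply: differentiable_scaler.
rewrite (lin_rV_sum (nbhs_singleton Fl) ('D_v s x)) -big_split /=.
apply: eq_bigr => i _.
rewrite !derive_scaler // (derive_cst (s x 0 i)) scale0r add0r addrC.
by rewrite derive_coef.
Qed.

End Differentiation.

(** * Closure properties of C^k and smooth maps *)

Section Smooth.
Context {R : realType} {n : nat}.
Implicit Types (W : normedModType R) (U : set 'rV[R]_n).

(** Finite orders make induction possible: a derivative of a product or of a composite again
    contains the original maps, now needed at one order less. *)
Fixpoint Ck W (k : nat) U (f : 'rV[R]_n -> W) : Prop :=
  (forall x, U x -> differentiable f x) /\
  if k is k'.+1 then forall v, Ck k' U ('D_v f) else True.

Lemma smooth_onP W U (f : 'rV[R]_n -> W) :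
  smooth_on U f <-> forall k, Ck k U f.
Proof.
split=> [fs k|fk vs x Ux].
  elim: k f fs => [|k IH] f fs; split=> //; try exact: (fs [::]).
  (* In [foldr] the innermost derivative is the last entry of the sequence, so directions are peeled
     off on the right. *)
  by move=> v; apply: IH => vs x Ux; rewrite -(foldr_rcons _ _ vs v); exact: fs.
elim/last_ind: vs f fk => [|vs v IH] f fk /=; first by case: (fk 0%N) => fd _;
  exact: fd.
by rewrite foldr_rcons; apply: IH => k; case: (fk k.+1) => _; exact.
Qed.

Lemma Ck_diff W k U (f : 'rV[R]_n -> W) x : Ck k U f -> U x -> differentiable f x.
Proof. by case: k => [|k] [fd _]; exact: fd. Qed.

Lemma Ck_pred W k U (f : 'rV[R]_n -> W) : Ck k.+1 U f -> Ck k U f.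
Proof.
by elim: k f => [|k IH] f [fd fD]; split=> // v; apply: IH; exact: fD.
Qed.

Lemma Ck_ext W k U (f g : 'rV[R]_n -> W) : open U ->
  (forall x, U x -> f x = g x) -> Ck k U f -> Ck k U g.
Proof.
move=> Uo; elim: k f g => [|k IH] f g fg [fd fD].
  split=> // x Ux; apply: near_eq_differentiable (fd x Ux).
  by apply: filterS (open_nbhs_nbhs (conj Uo Ux)).
split=> [x Ux|v].
  apply: near_eq_differentiable (fd x Ux).
  by apply: filterS (open_nbhs_nbhs (conj Uo Ux)).
apply: IH (fD v) => x Ux; apply: near_eq_derive.
by apply: filterS (open_nbhs_nbhs (conj Uo Ux)).
Qed.

Lemma Ck_cst W k U (w : W) : Ck k U (fun _ => w).
Proof.
elim: k w => [|k IH] w; split=> //; try by move=> x _; exact: differentiable_cst.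
move=> v; rewrite (_ : 'D_v _ = fun _ => 0) //.
by apply/funext => x; exact: derive_cst.
Qed.

Lemma Ck_add W k U (f g : 'rV[R]_n -> W) : open U ->
  Ck k U f -> Ck k U g -> Ck k U (fun x => f x + g x).
Proof.
move=> Uo; elim: k f g => [|k IH] f g [fd fD] [gd gD].
  by split=> // x Ux; apply: differentiable_add; [exact: fd | exact: gd].
split=> [x Ux|v].
  by apply: differentiable_add; [exact: fd | exact: gd].
apply: Ck_ext (IH _ _ (fD v) (gD v)) => // x Ux /=.
by rewrite derive_add //; [exact: fd | exact: gd].
Qed.

Lemma Ck_sum W k U m (f : 'I_m -> 'rV[R]_n -> W) : open U ->
  (forall i, Ck k U (f i)) -> Ck k U (fun x => \sum_i f i x).
Proof.
move=> Uo; elim: m f => [|m IH] f fk.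
  by under eq_fun do rewrite big_ord0; exact: Ck_cst.
under eq_fun do rewrite big_ord_recl; apply: Ck_add => //; exact: IH.
Qed.

Lemma Ck_scaler W k U (f : 'rV[R]_n -> R) (g : 'rV[R]_n -> W) : open U ->
  Ck k U f -> Ck k U g -> Ck k U (fun x => f x *: g x).
Proof.
move=> Uo; elim: k f g => [|k IH] f g fk gk.
  split=> // x Ux.
  by apply: differentiable_scaler; [exact: Ck_diff fk Ux | exact: Ck_diff gk Ux].
split=> [x Ux|v].
  by apply: differentiable_scaler; [exact: Ck_diff fk Ux | exact: Ck_diff gk Ux].
have fk' := Ck_pred fk; have gk' := Ck_pred gk.
have [fd fD] := fk; have [gd gD] := gk.
apply: Ck_ext (Ck_add Uo (IH _ _ (fD v) gk') (IH _ _ fk' (gD v))) => // x Ux /=.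
by rewrite derive_scaler //; [exact: fd | exact: gd].
Qed.

Lemma Ck_coef k U m (f : 'rV[R]_n -> 'rV[R]_m) i : open U ->
  Ck k U f -> Ck k U (fun x => f x 0 i).
Proof.
move=> Uo; elim: k f => [|k IH] f [fd fD].
  by split=> // x Ux; apply: differentiable_coef; exact: fd.
split=> [x Ux|v]; first by apply: differentiable_coef; exact: fd.
by apply: Ck_ext (IH _ (fD v)) => // x Ux; rewrite derive_coef //; exact: fd.
Qed.

Lemma Ck_family W k U m (F : 'rV[R]_n -> 'rV[R]_m -> W) (s : 'rV[R]_n -> 'rV[R]_m) :
  open U -> (forall x, U x -> linear (F x)) ->
  (forall u, Ck k U (F ^~ u)) -> Ck k U s -> Ck k U (fun x => F x (s x)).
Proof.
move=> Uo Fl Fk sk.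
apply: (@Ck_ext _ _ _ (fun x => \sum_i s x 0 i *: F x (delta_mx 0 i))) => //.
  by move=> x Ux; rewrite -lin_rV_sum //; exact: Fl.
apply: Ck_sum => // i; apply: Ck_scaler => //; exact: Ck_coef.
Qed.

Lemma Ck_linear W k U m (L : 'rV[R]_m -> W) (f : 'rV[R]_n -> 'rV[R]_m) :
  open U -> linear L -> Ck k U f -> Ck k U (fun x => L (f x)).
Proof.
move=> Uo Ll fk; apply: (@Ck_family _ _ _ _ (fun _ => L)) => // u; exact: Ck_cst.
Qed.

End Smooth.

Section SmoothComposition.
Context {R : realType} {n m : nat}.

(** By the chain rule a derivative of the composite is a sum of coefficients of ['D_v f] times
    partial derivatives of [g] composed with [f]; to these the induction hypothesis applies, with
    [f] at one order less. *)
Lemma Ck_comp (W : normedModType R) k (U : set 'rV[R]_n) (V : set 'rV[R]_m)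
    (f : 'rV[R]_n -> 'rV[R]_m) (g : 'rV[R]_m -> W) : open U ->
  (forall x, U x -> V (f x)) -> Ck k U f -> Ck k V g ->
  Ck k U (fun x => g (f x)).
Proof.
move=> Uo UV; have fgd k' g' : Ck k' U f -> Ck k' V g' ->
    forall x, U x -> differentiable (fun x => g' (f x) : W) x.
  move=> fk gk x Ux; apply: (differentiable_comp (Ck_diff fk Ux)).
  exact: Ck_diff gk (UV _ Ux).
elim: k g => [|k IH] g fk gk; split=> //; try exact: fgd fk gk.
move=> v; have [fd fD] := fk; have [gd gD] := gk.
apply: (@Ck_ext _ _ _ _ _ (fun x => \sum_i ('D_v f x) 0 i *: 'D_(delta_mx 0 i) g
  (f x))) => //.
  move=> x Ux; rewrite (derive_comp _ (fd _ Ux) (gd _ (UV _ Ux))).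
  by rewrite -(lin_rV_sum (linear_derive (gd _ (UV _ Ux)))).
apply: Ck_sum => // i; apply: Ck_scaler => //; first by apply: Ck_coef => //; exact: fD.
by apply: (IH ('D_(delta_mx 0 i) g)); [exact: Ck_pred fk | exact: gD].
Qed.

End SmoothComposition.

Section SmoothOn.
Context {R : realType} {n : nat}.
Implicit Types (W : normedModType R) (U : set 'rV[R]_n).

Lemma smooth_diff W U (f : 'rV[R]_n -> W) x :
  smooth_on U f -> U x -> differentiable f x.
Proof. by move=> fs; exact: (fs [::]). Qed.

Lemma smooth_derive W U (f : 'rV[R]_n -> W) v :
  smooth_on U f -> smooth_on U ('D_v f).
Proof. by move=> /smooth_onP fs; apply/smooth_onP => k; case: (fs k.+1) => _;
  exact. Qed.

Lemma smooth_sub W U U' (f : 'rV[R]_n -> W) :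
  U' `<=` U -> smooth_on U f -> smooth_on U' f.
Proof. by move=> UU fs vs x /UU; exact: fs. Qed.

Lemma smooth_ext W U (f g : 'rV[R]_n -> W) : open U ->
  (forall x, U x -> f x = g x) -> smooth_on U f -> smooth_on U g.
Proof.
by move=> Uo fg /smooth_onP fs; apply/smooth_onP => k; exact: Ck_ext (fs k).
Qed.

Lemma smooth_cst W U (w : W) : smooth_on U (fun _ => w).
Proof. by apply/smooth_onP => k; exact: Ck_cst. Qed.

Lemma smooth_add W U (f g : 'rV[R]_n -> W) : open U ->
  smooth_on U f -> smooth_on U g -> smooth_on U (fun x => f x + g x).
Proof.
move=> Uo /smooth_onP fs /smooth_onP gs; apply/smooth_onP => k; exact: Ck_add.
Qed.

Lemma smooth_scaler W U (f : 'rV[R]_n -> R) (g : 'rV[R]_n -> W) : open U ->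
  smooth_on U f -> smooth_on U g -> smooth_on U (fun x => f x *: g x).
Proof.
move=> Uo /smooth_onP fs /smooth_onP gs; apply/smooth_onP => k; exact: Ck_scaler.
Qed.

Lemma smooth_opp W U (f : 'rV[R]_n -> W) : open U ->
  smooth_on U f -> smooth_on U (fun x => - f x).
Proof.
move=> Uo fs; under eq_fun do rewrite -scaleN1r.
by apply: smooth_scaler => //; exact: smooth_cst.
Qed.

Lemma smooth_coef U m (f : 'rV[R]_n -> 'rV[R]_m) i : open U ->
  smooth_on U f -> smooth_on U (fun x => f x 0 i).
Proof. by move=> Uo /smooth_onP fs; apply/smooth_onP => k; exact: Ck_coef. Qed.

Lemma smooth_family W U m (F : 'rV[R]_n -> 'rV[R]_m -> W) (s : 'rV[R]_n -> 'rV[R]_m) :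
  open U -> (forall x, U x -> linear (F x)) ->
  (forall u, smooth_on U (F ^~ u)) -> smooth_on U s ->
  smooth_on U (fun x => F x (s x)).
Proof.
move=> Uo Fl Fs /smooth_onP ss; apply/smooth_onP => k.
by apply: Ck_family => // u; exact: (smooth_onP _ _).1.
Qed.

Lemma smooth_linear W U m (L : 'rV[R]_m -> W) (f : 'rV[R]_n -> 'rV[R]_m) :
  open U -> linear L -> smooth_on U f -> smooth_on U (fun x => L (f x)).
Proof.
by move=> Uo Ll /smooth_onP fs; apply/smooth_onP => k; exact: Ck_linear.
Qed.

Lemma smooth_comp W m U (V : set 'rV[R]_m)
    (f : 'rV[R]_n -> 'rV[R]_m) (g : 'rV[R]_m -> W) : open U ->
  (forall x, U x -> V (f x)) -> smooth_on U f -> smooth_on V g ->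
  smooth_on U (fun x => g (f x)).
Proof.
move=> Uo UV /smooth_onP fs /smooth_onP gs; apply/smooth_onP => k.
exact: Ck_comp (fs k) (gs k).
Qed.

Lemma smooth_id U : smooth_on U (fun x : 'rV[R]_n => x).
Proof.
apply/smooth_onP; elim=> [|k IH]; split=> // v.
rewrite (_ : 'D_v _ = fun _ => v); first exact: Ck_cst.
by apply/funext => x; exact: derive_id.
Qed.

End SmoothOn.

(** * Symmetry of second derivatives *)

Section Schwarz.
Context {R : realType} {n : nat}.
Implicit Types (U : set 'rV[R]_n) (x y u v : 'rV[R]_n).

Lemma differentiable_line y u (t : R) : differentiable (fun s : R => y + s *: u) t.
Proof.
apply: differentiable_add; first exact: differentiable_cst.
by apply: differentiableZl.
Qed.

Lemma derive_line y u (t : R) : 'D_1 (fun s : R => y + s *: u) t = u.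
Proof.
rewrite derive_add; [|exact: differentiable_cst|exact: differentiableZl].
rewrite derive_cst add0r derive_scaler;
  [|exact: (@ex_diff _ _ _ _ _ id)|exact: differentiable_cst].
by rewrite derive_id derive_cst scale1r scaler0 addr0.
Qed.

Lemma derive_shift_arg (W : normedModType R) (f : 'rV[R]_n -> W) y w u :
  differentiable f (y + w) ->
  differentiable (fun z => f (z + w)) y /\ 'D_u (fun z => f (z + w)) y = 'D_u f (y + w).
Proof.
move=> df; have ds : differentiable (fun z : 'rV[R]_n => z + w) y.
  by apply: differentiable_add => //; exact: differentiable_cst.
split; first exact: (differentiable_comp ds).
rewrite (derive_comp u ds df) derive_add;
  [|exact: (@ex_diff _ _ _ _ _ id)|exact: differentiable_cst].
by rewrite derive_id derive_cst addr0.
Qed.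

Lemma MVT_line (f : 'rV[R]_n -> R) y u (h : R) : 0 < h ->
  (forall t, 0 <= t <= h -> differentiable f (y + t *: u)) ->
  exists2 c, 0 <= c <= h & f (y + h *: u) - f y = 'D_u f (y + c *: u) * h.
Proof.
move=> h0 df.
have dl t : 0 <= t <= h -> differentiable (fun s : R => f (y + s *: u)) t.
  by move=> th; apply: (differentiable_comp (differentiable_line y u t)); exact: df.
have [||c cab] := @MVT R (fun t => f (y + t *: u)) (fun t => 'D_u f (y + t *: u))
  0 h h0.
- move=> t; rewrite in_itv /= => /andP[t0 th].
  have t0h : 0 <= t <= h by rewrite !ltW.
  split; first exact/diff_derivable/dl.
  by rewrite (derive_comp _ (differentiable_line y u t) (df _ t0h)) derive_line.
- apply: derivable_within_continuous => t; rewrite in_itv /= => th.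
  exact/diff_derivable/dl.
rewrite scale0r addr0 subr0 => E; exists c => //.
by move: cab; rewrite in_itv /= => /andP[c0 ch]; rewrite !ltW.
Qed.

(** Two applications of the mean value theorem: along [u] to the difference
    [F y = f (y + h *: v) - f y], then along [v] to ['D_u f]. *)
Lemma second_difference (f : 'rV[R]_n -> R) x u v (h : R) U : 0 < h ->
  (forall s t, 0 <= s <= h -> 0 <= t <= h -> U (x + s *: u + t *: v)) ->
  (forall y, U y -> differentiable f y) ->
  (forall y, U y -> differentiable ('D_u f) y) ->
  exists c d, [/\ 0 <= c <= h, 0 <= d <= h &
    f (x + h *: u + h *: v) - f (x + h *: u) - (f (x + h *: v) - f x)
    = 'D_v ('D_u f) (x + c *: u + d *: v) * h * h].
Proof.
move=> h0 Uh df dDf.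
have hh : 0 <= h <= h by apply/andP; split=> //; exact: ltW.
have h00 : (0 : R) <= 0 <= h by apply/andP; split=> //; exact: ltW.
have Uh0 s : 0 <= s <= h -> U (x + s *: u).
  by move=> sh; have := Uh s 0 sh h00; rewrite scale0r addr0.
pose F y := f (y + h *: v) - f y.
have dF s : 0 <= s <= h -> differentiable F (x + s *: u) /\
    'D_u F (x + s *: u) = 'D_u f (x + s *: u + h *: v) - 'D_u f (x + s *: u).
  move=> sh; have [d1 e1] := derive_shift_arg u (df _ (Uh _ _ sh hh)).
  have d2 := df _ (Uh0 _ sh).
  by split; [exact: differentiable_sub d1 d2 | rewrite /F (derive_sub _ d1 d2) e1].
have [c ch E] := MVT_line h0 (fun t th => (dF t th).1).
have [d dh E'] := MVT_line h0 (fun t th => dDf _ (Uh _ _ ch th)).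
exists c, d; split=> //.
rewrite -[LHS]/(F (x + h *: u) - F x) E (dF _ ch).2 E'.
by [].
Qed.

(** The second difference over a parallelogram is symmetric in [u] and [v], so each mixed derivative
    takes the same value somewhere in a small parallelogram at [x]; continuity of both brings their
    values at [x] within any [e]. *)
Lemma schwarz_scalar U (f : 'rV[R]_n -> R) x u v : open U -> smooth_on U f ->
  U x -> 'D_u ('D_v f) x = 'D_v ('D_u f) x.
Proof.
move=> Uo fs Ux; apply/eqP; rewrite -subr_eq0 -normr_le0; apply/ler_addgt0Pl => e e0.
rewrite addr0.
pose A := 'D_u ('D_v f); pose B := 'D_v ('D_u f).
have e2 : 0 < e / 2 by rewrite divr_gt0.
have cA : {for x, continuous A}.
  apply: differentiable_continuous; apply: smooth_diff Ux.
  by apply: smooth_derive; exact: smooth_derive.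
have cB : {for x, continuous B}.
  apply: differentiable_continuous; apply: smooth_diff Ux.
  by apply: smooth_derive; exact: smooth_derive.
have nA : \forall y \near x, `|A x - A y| < e / 2 by move/cvgrPdist_lt: cA; apply.
have nB : \forall y \near x, `|B x - B y| < e / 2 by move/cvgrPdist_lt: cB; apply.
have nU : \forall y \near x, U y by exact: (open_nbhs_nbhs (conj Uo Ux)).
have nall : \forall y \near x, [/\ U y, `|A x - A y| < e / 2 & `|B x - B y| < e / 2].
  by apply: filterS3 nU nA nB => y ? ? ?; split.
have [r /= r0 rP] := (nbhs_ballP _ _).1 nall.
(* The summand 1 keeps [k] positive when [u] and [v] vanish; with side [r / k] the parallelogram
   stays inside the ball of radius [r]. *)
pose k := `|u| + `|v| + 1.
have k0 : 0 < k by rewrite ltr_wpDl // addr_ge0.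
pose h := r / k.
have h0 : 0 < h by rewrite divr_gt0.
have inb s t : 0 <= s <= h -> 0 <= t <= h -> ball x r (x + s *: u + t *: v).
  move=> /andP[s0 sh] /andP[t0 th];
    rewrite -ball_normE /= -addrA opprD addrA subrr add0r normrN.
  apply: (le_lt_trans (ler_normD _ _)); rewrite !normrZ !ger0_norm //.
  apply: (@le_lt_trans _ _ (h * (`|u| + `|v|))).
    by rewrite mulrDr lerD // ler_wpM2r.
  by rewrite /h -mulrA gtr_pMr // ltr_pdivrMl // mulr1 /k ltrDl.
have inb' s t : 0 <= s <= h -> 0 <= t <= h -> ball x r (x + s *: v + t *: u).
  by move=> sh th; rewrite addrAC; exact: inb.
have bU y : ball x r y -> U y by move=> /rP[].
have df y : ball x r y -> differentiable f y by move=> /bU; exact: smooth_diff fs.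
have dDf w y : ball x r y -> differentiable ('D_w f) y.
  by move=> /bU; apply: smooth_diff; exact: smooth_derive.
have [c [d [ch dh E]]] := second_difference h0 inb df (dDf u).
have [c' [d' [ch' dh' E']]] := second_difference h0 inb' df (dDf v).
rewrite -[X in X * h * h]/(B (x + c *: u + d *: v)) in E.
rewrite -[X in X * h * h]/(A (x + c' *: v + d' *: u)) in E'.
rewrite -[X in X - _]/(A x) -[X in _ - X]/(B x).
clearbody A B.
(* The two second differences are the same number; divide by [h * h]. *)
have EE : B (x + c *: u + d *: v) = A (x + c' *: v + d' *: u).
  have hn : h != 0 by rewrite gt_eqF.
  apply: (mulIf hn); apply: (mulIf hn); rewrite -E -E'.
  by rewrite [x + h *: v + _]addrAC !opprD !opprK; ring.
have [_ _ Bc] := rP _ (inb _ _ ch dh).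
have [_ [/= Ac _]] := rP _ (inb' _ _ ch' dh').
rewrite (_ : A x - B x = (A x - A (x + c' *: v + d' *: u)) - (B x - B (x + c *: u
  + d *: v))); last by rewrite EE; ring.
by rewrite (le_trans (ler_normB _ _)) // (splitr e) lerD // ltW.
Qed.

Lemma schwarz m U (f : 'rV[R]_n -> 'rV[R]_m) x u v : open U -> smooth_on U f ->
  U x -> 'D_u ('D_v f) x = 'D_v ('D_u f) x.
Proof.
move=> Uo fs Ux; apply/rowP => i.
have dE w z : U z -> 'D_w (fun y => f y 0 i) z = 'D_w f z 0 i.
  by move=> Uz; rewrite derive_coef //; exact: smooth_diff fs Uz.
have dE2 w w' : 'D_w' ('D_w (fun y => f y 0 i)) x = 'D_w' ('D_w f) x 0 i.
  rewrite -derive_coef; last by apply: smooth_diff Ux; exact: smooth_derive.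
  apply: near_eq_derive; apply: filterS (open_nbhs_nbhs (conj Uo Ux)) => z.
  exact: dE.
have := schwarz_scalar u v Uo (smooth_coef i Uo fs) Ux.
by move=> E; exact: etrans (esym (dE2 v u)) (etrans E (dE2 u v)).
Qed.

End Schwarz.

(** * Vector fields in charts *)

Section ManifoldTheory.
Context {R : realType} {n : nat} {N : atlas R n}.
Hypothesis mN : manifold N.
Implicit Types (a b c : chart N) (p q : N) (V : set N) (X Y Z : N -> 'rV[R]_n).

Definition cdom a V : set 'rV[R]_n := coord N a @` (dom N a `&` V).
Definition trans a b : 'rV[R]_n -> 'rV[R]_n := fun x => coord N b (param N a x).

Lemma cdom_coord a V p : dom N a p -> V p -> cdom a V (coord N a p).
Proof. by move=> ap Vp; exists p. Qed.

Lemma cdomP a V x : cdom a V x ->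
  [/\ dom N a (param N a x), V (param N a x) & coord N a (param N a x) = x].
Proof. by case=> p [ap Vp <-]; rewrite !coordK. Qed.

Lemma cdom_sub a V V' : V `<=` V' -> cdom a V `<=` cdom a V'.
Proof. by move=> VV' x [p [ap /VV' Vp] <-]; exists p. Qed.

Lemma mopen_dom a : mopen (dom N a).
Proof. by move=> b; exact: open_overlap. Qed.

Lemma mopenT : mopen (setT : set N).
Proof. by move=> a; rewrite setIT -[dom N a]setIid; exact: open_overlap. Qed.

Lemma mopenI V V' : mopen V -> mopen V' -> mopen (V `&` V').
Proof.
move=> oV oV' a; rewrite (_ : _ @` _ = cdom a V `&` cdom a V').
  exact: openI (oV a) (oV' a).
apply/seteqP; split=> [x [p [ap [Vp V'p]] <-]|x [Vx V'x]].
  by split; exact: cdom_coord.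
have [ax Vx' E] := cdomP Vx; have [_ V'x' _] := cdomP V'x.
by exists (param N a x).
Qed.

Lemma cdom_near a V p : mopen V -> dom N a p -> V p ->
  \forall x \near coord N a p, cdom a V x.
Proof.
by move=> oV ap Vp; apply: open_nbhs_nbhs; split; [exact: oV | exact: cdom_coord].
Qed.

Lemma trans_coord a b p : dom N a p -> trans a b (coord N a p) = coord N b p.
Proof. by move=> ap; rewrite /trans coordK. Qed.

Lemma trans_smooth a b : smooth_on (cdom a (dom N b)) (trans a b).
Proof. exact: smooth_transition. Qed.

Lemma trans_diff a b p : dom N a p -> dom N b p ->
  differentiable (trans a b) (coord N a p).
Proof. by move=> ap bp; apply: smooth_diff (@trans_smooth a b) _;
  exact: cdom_coord. Qed.

Lemma change_linear a b p : dom N a p -> dom N b p -> linear (change_chart a b p).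
Proof. by move=> ap bp; apply: linear_derive; exact: trans_diff. Qed.

Lemma change_id a p v : dom N a p -> change_chart a a p v = v.
Proof.
move=> ap; rewrite /change_chart -[RHS](derive_id (coord N a p)).
apply: near_eq_derive; apply: filterS (cdom_near mopenT ap I) => x.
by case/cdomP.
Qed.

Lemma change_comp a b c p v : dom N a p -> dom N b p -> dom N c p ->
  change_chart b c p (change_chart a b p v) = change_chart a c p v.
Proof.
move=> ap bp cp; rewrite /change_chart -(trans_coord b ap).
rewrite -(derive_comp (f := trans a b) (g := trans b c)); last 2 first.
- exact: trans_diff.
- by rewrite trans_coord //; exact: trans_diff.
apply: near_eq_derive; apply: filterS (cdom_near (@mopen_dom b) ap bp) => x.
by case/cdomP => ax bx E; rewrite /trans /= coordK.
Qed.

Lemma change_inv a b p v : dom N a p -> dom N b p ->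
  change_chart b a p (change_chart a b p v) = v.
Proof. by move=> ap bp; rewrite change_comp // change_id. Qed.

Lemma componentsE a X p : dom N a p ->
  components a X (coord N a p) = change_chart (chart_at N p) a p (X p).
Proof. by move=> ap; rewrite /components coordK. Qed.

Lemma components_at X p : components (chart_at N p) X (coord N (chart_at N p) p) = X p.
Proof.
by rewrite (componentsE _ (mem_chart_at mN p)) (change_id _ (mem_chart_at mN p)).
Qed.

Lemma components_change a b X p : dom N a p -> dom N b p ->
  components b X (coord N b p) = change_chart a b p (components a X (coord N a p)).
Proof.
move=> ap bp; rewrite (componentsE _ ap) (componentsE _ bp).
by rewrite (change_comp _ (mem_chart_at mN p) ap bp).
Qed.

Lemma components_coord_field a b v p : dom N a p -> dom N b p ->
  components b (coord_field a v) (coord N b p) = change_chart a b p v.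
Proof.
move=> ap bp; rewrite (componentsE _ bp).
by rewrite (change_comp _ ap (mem_chart_at mN p) bp).
Qed.

Lemma coord_field_at v p : coord_field (chart_at N p) v p = v.
Proof. by rewrite /coord_field (change_id _ (mem_chart_at mN p)). Qed.

Lemma coord_field_change a p v : dom N a p ->
  coord_field a (change_chart (chart_at N p) a p v) p = v.
Proof.
by move=> ap; rewrite /coord_field (change_inv _ (mem_chart_at mN p) ap).
Qed.

Lemma smooth_coord_field a v : smooth_field (dom N a) (coord_field a v).
Proof.
(* Read in [b], the field is the derivative of the transition from [a], taken at the point carried
   back to [a]. *)
move=> b; pose f x := 'D_v (trans a b) (trans b a x).
have bo : open (cdom b (dom N a)) by exact: mopen_dom.
have Ef x : cdom b (dom N a) x -> f x = components b (coord_field a v) x.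
  move=> [p [bp ap] <-]; rewrite (components_coord_field _ ap bp).
  by rewrite /f (trans_coord _ bp).
apply: (smooth_ext bo Ef).
apply: (@smooth_comp _ _ _ _ _ (cdom a (dom N b)) (trans b a) ('D_v (trans a b)) bo).
- move=> _ [p [bp ap] <-]; rewrite (trans_coord _ bp); exact: cdom_coord.
- exact: trans_smooth.
- apply: smooth_derive; exact: trans_smooth.
Qed.

Lemma coord_field_near a v p : dom N a p -> smooth_field_near p (coord_field a v).
Proof. by move=> ap; exists (dom N a); split;
  [exact: mopen_dom | | exact: smooth_coord_field]. Qed.

Lemma smooth_field_sub V V' X : V' `<=` V -> smooth_field V X -> smooth_field V' X.
Proof. by move=> VV sX a; apply: smooth_sub (sX a); exact: cdom_sub. Qed.

Lemma smooth_field_add V X Y : mopen V -> smooth_field V X -> smooth_field V Y ->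
  smooth_field V (fun p => X p + Y p).
Proof.
move=> oV sX sY a.
apply: smooth_ext (smooth_add (oV a) (sX a) (sY a)); first exact: oV.
move=> _ [p [ap Vp] <-]; have cl := change_linear (mem_chart_at mN p) ap.
by rewrite !(componentsE _ ap) (linD cl).
Qed.

Lemma smooth_field_opp V X : mopen V -> smooth_field V X ->
  smooth_field V (fun p => - X p).
Proof.
move=> oV sX a.
apply: smooth_ext (smooth_opp (oV a) (sX a)); first exact: oV.
move=> _ [p [ap Vp] <-]; have cl := change_linear (mem_chart_at mN p) ap.
by rewrite !(componentsE _ ap) (linN cl).
Qed.

Lemma smooth_field_scale V (f : N -> R) X : mopen V -> smooth_fun V f ->
  smooth_field V X -> smooth_field V (fun p => f p *: X p).
Proof.
move=> oV sf sX a.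
apply: smooth_ext (smooth_scaler (oV a) (sf a) (sX a)); first exact: oV.
move=> _ [p [ap Vp] <-]; have cl := change_linear (mem_chart_at mN p) ap.
by rewrite !(componentsE _ ap) /= (coordK mN ap) (linZ cl).
Qed.

Lemma smooth_field_near_add p X Y : smooth_field_near p X ->
  smooth_field_near p Y -> smooth_field_near p (fun q => X q + Y q).
Proof.
move=> [V [oV Vp sX]] [V' [oV' V'p sY]]; exists (V `&` V').
have oVV := mopenI oV oV'; split; [exact: oVV | by [] | ].
apply: smooth_field_add.
- exact: oVV.
- by apply: (smooth_field_sub _ sX) => q [].
- by apply: (smooth_field_sub _ sY) => q [].
Qed.

Lemma smooth_field_near_scale p f X : smooth_fun_near p f ->
  smooth_field_near p X -> smooth_field_near p (fun q => f q *: X q).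
Proof.
move=> [V [oV Vp sX]] [V' [oV' V'p sY]]; exists (V `&` V').
have oVV := mopenI oV oV'; split; [exact: oVV | by [] | ].
apply: smooth_field_scale.
- exact: oVV.
- move=> a; apply: smooth_sub (sX a); apply: cdom_sub => q [] //.
- by apply: (smooth_field_sub _ sY) => q [].
Qed.

Lemma smooth_field_near_endo J p X : smooth_endo J -> smooth_field_near p X ->
  smooth_field_near p (fun q => J q (X q)).
Proof.
by move=> sJ [V [oV Vp sX]]; exists V; split;
  [exact: oV | exact: Vp | exact: (endo_smooth sJ)].
Qed.

Lemma smooth_fun_cst V (k : R) : smooth_fun V (fun _ => k).
Proof. by move=> a; exact: smooth_cst. Qed.

Lemma smooth_field_near_comp p X a : dom N a p -> smooth_field_near p X ->
  \forall x \near coord N a p, differentiable (components a X) x.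
Proof.
move=> ap [V [oV Vp sX]]; apply: filterS (cdom_near oV ap Vp) => x Vx.
exact: smooth_diff (sX a) Vx.
Qed.

Lemma components_diff p X a : dom N a p -> smooth_field_near p X ->
  differentiable (components a X) (coord N a p).
Proof. by move=> ap /(smooth_field_near_comp ap)/nbhs_singleton. Qed.

Lemma near_components a p X Y V : mopen V -> V p -> dom N a p ->
  (forall q, V q -> X q = Y q) ->
  \forall x \near coord N a p, components a X x = components a Y x.
Proof.
move=> oV Vp ap XY; apply: filterS (cdom_near oV ap Vp) => _ [q [aq Vq] <-].
by rewrite !(componentsE _ aq) (XY _ Vq).
Qed.

(** The matrix of [J] in the chart [a]. Writing it as the components of [J] applied to a coordinate
    field makes its smoothness an instance of [endo_smooth]. *)
Definition endo_chart (J : N -> 'rV[R]_n -> 'rV[R]_n) a (x u : 'rV[R]_n) :=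
  components a (fun p => J p (coord_field a u p)) x.

Lemma endo_chartE (J : N -> 'rV[R]_n -> 'rV[R]_n) a p u : dom N a p ->
  change_chart (chart_at N p) a p (J p u) =
  endo_chart J a (coord N a p) (change_chart (chart_at N p) a p u).
Proof. by move=> ap; rewrite /endo_chart (componentsE _ ap) (coord_field_change _
  ap). Qed.

Lemma endo_chart_at (J : N -> 'rV[R]_n -> 'rV[R]_n) p u :
  endo_chart J (chart_at N p) (coord N (chart_at N p) p) u = J p u.
Proof. by rewrite /endo_chart components_at coord_field_at. Qed.

Lemma endo_chart_linear J a p : smooth_endo J -> dom N a p ->
  linear (endo_chart J a (coord N a p)).
Proof.
move=> sJ ap k u v; have cp := mem_chart_at mN p.
have E w : endo_chart J a (coord N a p) w =
    change_chart (chart_at N p) a p (J p (coord_field a w p)) := componentsE _ ap.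
rewrite 3!E /coord_field (linD (change_linear ap cp)) (linZ (change_linear ap cp)).
rewrite (linD (endo_linear sJ p)) (linZ (endo_linear sJ p)).
by rewrite (linD (change_linear cp ap)) (linZ (change_linear cp ap)).
Qed.

Lemma endo_chart_smooth J a u : smooth_endo J ->
  smooth_on (cdom a setT) (fun x => endo_chart J a x u).
Proof.
move=> sJ; have sJu : smooth_field (dom N a) (fun p => J p (coord_field a u p)).
  by apply: (endo_smooth sJ); [exact: mopen_dom | exact: smooth_coord_field].
apply: smooth_sub (sJu a).
by move=> _ [p [ap _] <-]; exact: cdom_coord.
Qed.

Lemma endo_chart_change J a b p u : dom N a p -> dom N b p ->
  endo_chart J b (coord N b p) (change_chart a b p u) =
  change_chart a b p (endo_chart J a (coord N a p) u).
Proof.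
move=> ap bp; have cp := mem_chart_at mN p.
rewrite /endo_chart (components_change _ ap bp) 2!(componentsE _ ap).
by rewrite /coord_field (change_comp _ ap bp cp).
Qed.

End ManifoldTheory.

Arguments mopen_dom {R n N} mN a.
Arguments smooth_coord_field {R n N} mN a v.
Arguments trans_smooth {R n N} mN a b.

(** * Connections in charts *)

Section ConnectionCharts.
Context {R : realType} {n : nat} {N : atlas R n}.
Hypothesis mN : manifold N.
Implicit Types (a b c : chart N) (p q : N) (V : set N) (X Y Z : N -> 'rV[R]_n).

Lemma coord_fun_smooth a V Y i : mopen V -> smooth_field V Y ->
  smooth_fun (V `&` dom N a) (fun q => components a Y (coord N a q) 0 i).
Proof.
move=> oV sY c.
have oc : open (cdom c (V `&` dom N a)) by exact: (mopenI mN oV (mopen_dom mN a)).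
apply: (@smooth_coef _ _ _ _ (fun x => components a Y (trans c a x)) _ oc).
apply: (@smooth_comp _ _ _ _ _ (cdom a V) (trans c a) (components a Y) oc).
- move=> _ [p [cp [Vp ap]] <-]; rewrite (trans_coord mN _ cp); exact: cdom_coord.
- by apply: smooth_sub (trans_smooth mN c a); apply: cdom_sub => q [].
- exact: sY.
Qed.

Lemma dfun_coord a (g : 'rV[R]_n -> R) p v : dom N a p ->
  differentiable g (coord N a p) ->
  dfun (fun q => g (coord N a q)) p v =
  'D_(change_chart (chart_at N p) a p v) g (coord N a p).
Proof.
move=> ap dg; have cp := mem_chart_at mN p.
have dt := trans_diff mN cp ap.
exact: (derive_comp_eq v (trans_coord mN a cp) dt dg).
Qed.

Variable D : N -> 'rV[R]_n -> (N -> 'rV[R]_n) -> 'rV[R]_n.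
Hypothesis cD : connection D.

Lemma smooth_fun_near_cst p (k : R) : smooth_fun_near p (fun _ => k).
Proof. by exists setT; split; [exact: mopenT | by [] | exact: smooth_fun_cst]. Qed.

Lemma conn_scale p v (k : R) Y : smooth_field_near p Y ->
  D p v (fun q => k *: Y q) = k *: D p v Y.
Proof.
move=> sY; rewrite (conn_leibniz cD v (smooth_fun_near_cst p k) sY).
have -> : dfun (fun _ => k) p v = 0 by exact: (derive_cst k).
by rewrite scale0r add0r.
Qed.

Lemma conn_opp p v Y : smooth_field_near p Y ->
  D p v (fun q => - Y q) = - D p v Y.
Proof.
move=> sY; rewrite -scaleN1r -(conn_scale _ _ sY); congr (D p v _).
by apply/funext => q; rewrite scaleN1r.
Qed.

Lemma conn_sum p v m (Z : 'I_m -> N -> 'rV[R]_n) :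
  (forall i, smooth_field_near p (Z i)) ->
  smooth_field_near p (fun q => \sum_i Z i q) /\
  D p v (fun q => \sum_i Z i q) = \sum_i D p v (Z i).
Proof.
elim: m Z => [|m IH] Z sZ.
  (* The empty sum is presented as 0 times a smooth field, so that both claims follow from the rules
     for scaling. *)
  pose E := coord_field (chart_at N p) 0.
  have sE : smooth_field_near p E by exact: (coord_field_near mN 0 (mem_chart_at mN p)).
  have E0 : (fun q => \sum_(i < 0) Z i q) = (fun q => (0 : R) *: E q).
    by apply/funext => q; rewrite big_ord0 scale0r.
  rewrite E0 (conn_scale _ _ sE) scale0r big_ord0; split; last by [].
  exact: smooth_field_near_scale (smooth_fun_near_cst p 0) sE.
have [s1 e1] := IH (fun i => Z (lift ord0 i)) (fun i => sZ _).
have -> : (fun q => \sum_(i < m.+1) Z i q) =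
    (fun q => Z ord0 q + \sum_i Z (lift ord0 i) q).
  by apply/funext => q; rewrite big_ord_recl.
split; first exact: (smooth_field_near_add mN (sZ ord0) s1).
by rewrite (conn_add cD v (sZ _) s1) e1 big_ord_recl.
Qed.

(** Gamma^k_{ij} u^i v^j in the chart [a]. As the components of a covariant derivative of coordinate
    fields it is smooth by [conn_smooth]. *)
Definition chris a (x u v : 'rV[R]_n) : 'rV[R]_n :=
  components a (fun p => D p (coord_field a u p) (coord_field a v)) x.

Lemma chrisE a p u v : dom N a p -> chris a (coord N a p) u v =
  change_chart (chart_at N p) a p (D p (coord_field a u p) (coord_field a v)).
Proof. by move=> ap; rewrite /chris (componentsE mN _ ap). Qed.

Lemma chris_linearl a p v : dom N a p ->
  linear (fun u => chris a (coord N a p) u v).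
Proof.
move=> ap k u u'; have cp := mem_chart_at mN p.
rewrite 3!(chrisE _ _ ap) /coord_field.
rewrite (linD (change_linear mN ap cp)) (linZ (change_linear mN ap cp)).
have DL := conn_linear cD (coord_field_near mN v ap).
rewrite -/(coord_field a v) (linD DL) (linZ DL).
by rewrite (linD (change_linear mN cp ap)) (linZ (change_linear mN cp ap)).
Qed.

Lemma chris_linearr a p u : dom N a p -> linear (chris a (coord N a p) u).
Proof.
move=> ap k v v'; have cp := mem_chart_at mN p.
have sv := coord_field_near mN v ap; have sv' := coord_field_near mN v' ap.
have skv : smooth_field_near p (fun q => k *: coord_field a v q).
  exact: smooth_field_near_scale (smooth_fun_near_cst p k) sv.
rewrite 3!(chrisE _ _ ap); set w := coord_field a u p.
transitivity (change_chart (chart_at N p) a p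
    (D p w (fun q => k *: coord_field a v q + coord_field a v' q))).
  congr (change_chart _ _ _ _);
    apply: (conn_local cD w (mopen_dom mN a) ap (smooth_coord_field mN a _)) => q aq.
  have cq := mem_chart_at mN q.
  by rewrite /coord_field (linD (change_linear mN aq cq)) (linZ (change_linear mN
    aq cq)).
rewrite (conn_add cD w skv sv') (conn_scale w k sv).
by rewrite (linD (change_linear mN cp ap)) (linZ (change_linear mN cp ap)).
Qed.

Lemma chris_smooth a u v : smooth_on (cdom a setT) (fun x => chris a x u v).
Proof.
have sD := conn_smooth cD (mopen_dom mN a) (smooth_coord_field mN a u)
  (smooth_coord_field mN a v).
apply: (smooth_sub _ (sD a)).
by move=> _ [p [ap _] <-]; exact: cdom_coord.
Qed.

(** Expand [Y] in the coordinate frame of [a] and apply the Leibniz rule. The expansion holds only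
    on the domain of [a], so locality of [D] has to replace [Y] first. *)
Lemma conn_chartE a p v Y : dom N a p -> smooth_field_near p Y ->
  change_chart (chart_at N p) a p (D p v Y) =
  'D_(change_chart (chart_at N p) a p v) (components a Y) (coord N a p) +
  chris a (coord N a p) (change_chart (chart_at N p) a p v)
    (components a Y (coord N a p)).
Proof.
move=> ap [V [oV Vp sY]].
have sYp : smooth_field_near p Y by exists V.
have cp := mem_chart_at mN p; set w := change_chart _ a p v.
have oVa := mopenI mN oV (mopen_dom mN a).
pose f i q : R := components a Y (coord N a q) 0 i.
pose E i := coord_field a (delta_mx 0 i).
have sf i : smooth_fun_near p (f i).
  exists (V `&` dom N a); split; [exact: oVa | by [] | exact: coord_fun_smooth].
have sE i : smooth_field_near p (E i) by exact: (coord_field_near mN _ ap).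
have -> : D p v Y = D p v (fun q => \sum_i f i q *: E i q).
  have sYa : smooth_field (V `&` dom N a) Y.
    by apply: (smooth_field_sub _ sY) => q [].
  apply: (conn_local cD v oVa (conj Vp ap) sYa) => q [Vq aq].
  have cq := mem_chart_at mN q; have cl := change_linear mN aq cq.
  rewrite -(lin_rV_sum cl) (componentsE mN _ aq).
  by rewrite (change_inv mN _ cq aq).
have [_ ->] := conn_sum v (fun i => smooth_field_near_scale mN (sf i) (sE i)).
have cl := change_linear mN cp ap; rewrite (lin_sum cl).
have dY := components_diff ap sYp.
under eq_bigr => i _.
  rewrite (conn_leibniz cD v (sf i) (sE i)) (linD cl) 2!(linZ cl).
  rewrite (change_comp mN _ ap cp ap) (change_id mN _ ap).
  rewrite /f (dfun_coord _ ap (differentiable_coef i dY)) -/w (derive_coef _ _ dY).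
  over.
rewrite big_split /= -row_sum_delta; congr (_ + _).
rewrite (lin_rV_sum (chris_linearr w ap)); apply: eq_bigr => i _.
by rewrite (chrisE _ _ ap) (coord_field_change mN _ ap).
Qed.

End ConnectionCharts.

(** * Change of chart, torsion and flatness for Christoffel symbols *)

Section FlatCharts.
Context {R : realType} {n : nat} {N : atlas R n}.
Hypothesis mN : manifold N.
Implicit Types (a b c : chart N) (p q : N) (V : set N) (X Y Z : N -> 'rV[R]_n).

(** Source of all Hessians of transition maps: read in [b], the field is a first derivative of
    [trans a b]. The symmetry of this Hessian makes coordinate fields commute. *)
Lemma derive_components_coord_field a b p u v : dom N a p -> dom N b p ->
  'D_(change_chart a b p u) (components b (coord_field a v)) (coord N b p) =
  'D_u ('D_v (trans a b)) (coord N a p).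
Proof.
move=> ap bp; have dt := trans_diff mN ap bp.
have dY := components_diff bp (coord_field_near mN v ap).
rewrite -(derive_comp_eq u (trans_coord mN b ap) dt dY).
apply: near_eq_derive; apply: filterS (cdom_near (mopen_dom mN b) ap bp).
move=> _ [q [aq bq] <-]; rewrite (trans_coord mN _ aq).
exact: components_coord_field.
Qed.

Lemma trans_schwarz a b p u v : dom N a p -> dom N b p ->
  'D_u ('D_v (trans a b)) (coord N a p) = 'D_v ('D_u (trans a b)) (coord N a p).
Proof.
move=> ap bp; apply: (schwarz u v (mopen_dom mN b a) (trans_smooth mN a b)).
exact: cdom_coord.
Qed.

Lemma bracket_coord_field a p u v : dom N a p ->
  bracket (coord_field a u) (coord_field a v) p = 0.
Proof.
move=> ap; have cp := mem_chart_at mN p; rewrite /bracket.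
apply/eqP; rewrite subr_eq0; apply/eqP.
apply: (etrans (derive_components_coord_field u v ap cp)).
apply: (etrans (trans_schwarz u v ap cp)).
exact: (esym (derive_components_coord_field v u ap cp)).
Qed.

Variable D : N -> 'rV[R]_n -> (N -> 'rV[R]_n) -> 'rV[R]_n.
Hypothesis cD : connection D.

(** The inhomogeneous term does not depend on [D]. Hence an average of two connections obeys the
    same law, and their difference is a tensor. *)
Lemma chris_change a b p u v : dom N a p -> dom N b p ->
  chris D b (coord N b p) (change_chart a b p u) (change_chart a b p v) =
  change_chart a b p (chris D a (coord N a p) u v)
  - 'D_u ('D_v (trans a b)) (coord N a p).
Proof.
move=> ap bp; have cp := mem_chart_at mN p.
have := conn_chartE mN cD (coord_field a u p) bp (coord_field_near mN v ap).
rewrite (change_comp mN _ ap cp bp) (derive_components_coord_field _ _ ap bp).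
rewrite (components_coord_field mN _ ap bp) (chrisE mN _ _ _ ap) => E.
by rewrite (change_comp mN _ cp ap bp) E addrC addKr.
Qed.

Lemma chris_sym a p u v : torsion_free D -> dom N a p ->
  chris D a (coord N a p) u v = chris D a (coord N a p) v u.
Proof.
move=> tD ap; have su := coord_field_near mN u ap; have sv := coord_field_near mN v ap.
have := tD p _ _ su sv; rewrite (bracket_coord_field _ _ ap) => /subr0_eq E.
by rewrite (chrisE mN _ u v ap) (chrisE mN _ v u ap) E.
Qed.

Lemma conn_field_near a p u v : dom N a p ->
  smooth_field_near p (fun q => D q (coord_field a u q) (coord_field a v)).
Proof.
move=> ap; exists (dom N a); split; [exact: mopen_dom | exact: ap |].
exact: (conn_smooth cD (mopen_dom mN a) (smooth_coord_field mN a u)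
  (smooth_coord_field mN a v)).
Qed.

Lemma conn_conn_chart a p u v w : dom N a p ->
  change_chart (chart_at N p) a p (D p (coord_field a u p)
    (fun q => D q (coord_field a v q) (coord_field a w))) =
  'D_u (fun x => chris D a x v w) (coord N a p) +
  chris D a (coord N a p) u (chris D a (coord N a p) v w).
Proof.
move=> ap; have cp := mem_chart_at mN p.
have := conn_chartE mN cD (coord_field a u p) ap (conn_field_near v w ap).
by rewrite (change_inv mN _ ap cp).
Qed.

(** The curvature on coordinate fields; their bracket vanishes, so only the two iterated derivatives
    remain. *)
Lemma chris_flat a p u v w : flat D -> dom N a p ->
  let x := coord N a p in
  'D_u (fun x => chris D a x v w) x + chris D a x u (chris D a x v w) =
  'D_v (fun x => chris D a x u w) x + chris D a x v (chris D a x u w).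
Proof.
move=> fD ap x; have cp := mem_chart_at mN p.
have [su sv sw] : [/\ smooth_field_near p (coord_field a u),
    smooth_field_near p (coord_field a v) & smooth_field_near p (coord_field a w)].
  by split; exact: coord_field_near.
have := fD p _ _ _ su sv sw.
rewrite /curvature (bracket_coord_field _ _ ap) (lin0 (conn_linear cD sw)) subr0.
move=> /subr0_eq E.
apply: (etrans (esym (conn_conn_chart u v w ap))).
exact: (etrans (congr1 _ E) (conn_conn_chart v u w ap)).
Qed.

End FlatCharts.

Lemma sub_eq_swap (V : zmodType) (a b c d : V) : a - b = c - d -> a - c = b - d.
Proof.
by move=> /eqP; rewrite subr_eq => /eqP ->; rewrite addrAC (addrAC c) subrr add0r addrC.
Qed.

(** * The conjugate connection *)

Section ConjugateConnection.
Context {R : realType} {n : nat} {N : atlas R n}.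
Variables (J : N -> 'rV[R]_n -> 'rV[R]_n)
  (D : N -> 'rV[R]_n -> (N -> 'rV[R]_n) -> 'rV[R]_n).
Hypothesis sm : special_complex_manifold J D.

Let mN := special_manifold sm.
Let cD := special_connection sm.
Let sJ := complex_endo (special_complex sm).
Let JJ := complex_sq (special_complex sm).

Definition conj_conn p v (Y : N -> 'rV[R]_n) : 'rV[R]_n :=
  - J p (D p v (fun q => J q (Y q))).

Let Jnear p Y : smooth_field_near p Y -> smooth_field_near p (fun q => J q (Y q)).
Proof. exact: smooth_field_near_endo. Qed.

Lemma conj_connection : connection conj_conn.
Proof.
have Jl := endo_linear sJ; split.
- move=> p Y /Jnear sY k v v'; rewrite /conj_conn.
  have Dl := conn_linear cD sY.
  by rewrite (linD Dl) (linZ Dl) (linD (Jl p)) (linZ (Jl p)) opprD scalerN.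
- move=> p v Y Z /Jnear sY /Jnear sZ; rewrite /conj_conn.
  have -> : (fun q => J q (Y q + Z q)) = (fun q => J q (Y q) + J q (Z q)).
    by apply/funext => q; rewrite (linD (Jl q)).
  by rewrite (conn_add cD v sY sZ) (linD (Jl p)) opprD.
- move=> p v f Y sf /Jnear sY; rewrite /conj_conn.
  have -> : (fun q => J q (f q *: Y q)) = (fun q => f q *: J q (Y q)).
    by apply/funext => q; rewrite (linZ (Jl q)).
  rewrite (conn_leibniz cD v sf sY) (linD (Jl p)) 2!(linZ (Jl p)) JJ.
  by rewrite opprD 2!scalerN opprK.
- move=> p v Y Z V oV Vp sY YZ; rewrite /conj_conn; congr (- J p _).
  apply: (conn_local cD v oV Vp (endo_smooth sJ oV sY)) => q Vq.
  by rewrite (YZ q Vq).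
- move=> V X Y oV sX sY; apply: (smooth_field_opp mN oV).
  exact: (endo_smooth sJ oV (conn_smooth cD oV sX (endo_smooth sJ oV sY))).
Qed.

(** The symmetry of DJ says D_X (JY) - D_Y (JX) = J (D_X Y - D_Y X), which is J applied to the
    bracket of X and Y; apply -J. *)
Lemma conj_torsion_free : torsion_free conj_conn.
Proof.
move=> p X Y sX sY; have Jl := endo_linear sJ p.
have := special_symmetric sm sX sY; rewrite /nabla_endo => /sub_eq_swap E.
rewrite /conj_conn -opprD -(linB Jl) E -(linB Jl).
by rewrite (special_torsion_free sm sX sY) JJ opprK.
Qed.

(** In an iterated derivative the inner J and -J cancel, so the curvature of the conjugate is -J
    applied to the curvature of [D] on [J Z]. *)
Lemma conj_flat : flat conj_conn.
Proof.
move=> p X Y Z sX sY /Jnear sZ.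
have E U U' : conj_conn p (U p) (fun q => conj_conn q (U' q) Z) =
    - J p (D p (U p) (fun q => D q (U' q) (fun q' => J q' (Z q')))).
  rewrite {1}/conj_conn; congr (- J p (D p _ _)); apply/funext => q.
  by rewrite /conj_conn (linN (endo_linear sJ q)) JJ opprK.
rewrite /curvature 2!E /conj_conn -2!opprD -2!(linB (endo_linear sJ p)).
have := special_flat sm sX sY sZ; rewrite /curvature => ->.
by rewrite (lin0 (endo_linear sJ p)) oppr0.
Qed.

Lemma conn_endo p v Y : smooth_field_near p Y ->
  D p v (fun q => J q (Y q)) = J p (conj_conn p v Y).
Proof. by move=> sY; rewrite /conj_conn (linN (endo_linear sJ p)) JJ opprK. Qed.

(** Together with [conn_endo]: J exchanges the two connections in both directions, the second time
    because J^2 = -1. The half-sum and half-difference of these two identities give parallelism of J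
    and anticommutation with C. *)
Lemma conj_conn_endo p v Y : smooth_field_near p Y ->
  conj_conn p v (fun q => J q (Y q)) = J p (D p v Y).
Proof.
move=> sY; rewrite /conj_conn.
have -> : (fun q => J q (J q (Y q))) = (fun q => - Y q).
  by apply/funext => q; exact: JJ.
by rewrite (conn_opp mN cD v sY) (linN (endo_linear sJ p)) opprK.
Qed.

Lemma chris_endo a p u v : dom N a p -> let x := coord N a p in
  'D_u (fun x => endo_chart J a x v) x + chris D a x u (endo_chart J a x v) =
  endo_chart J a x (chris conj_conn a x u v).
Proof.
move=> ap x; have cp := mem_chart_at mN p; have sv := coord_field_near mN v ap.
have := conn_chartE mN cD (coord_field a u p) ap (Jnear sv).
rewrite (conn_endo _ sv) (change_inv mN _ ap cp) => <-.
by rewrite (endo_chartE mN _ _ ap) (chrisE mN _ _ _ ap).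
Qed.

Lemma chris_conj_endo a p u v : dom N a p -> let x := coord N a p in
  'D_u (fun x => endo_chart J a x v) x
    + chris conj_conn a x u (endo_chart J a x v) =
  endo_chart J a x (chris D a x u v).
Proof.
move=> ap x; have cp := mem_chart_at mN p; have sv := coord_field_near mN v ap.
have := conn_chartE mN conj_connection (coord_field a u p) ap (Jnear sv).
rewrite (conj_conn_endo _ sv) (change_inv mN _ ap cp) => <-.
by rewrite (endo_chartE mN _ _ ap) (chrisE mN _ _ _ ap).
Qed.

End ConjugateConnection.

(** * Bilinear families and block vectors *)

Section FamilyCalculus.
Context {R : realType} {n : nat}.
Implicit Types (U : set 'rV[R]_n).

(** Coordinate form of a tensor or of Christoffel symbols. Smoothness is asked for fixed arguments
    only; linearity extends it to varying ones. *)
Record linear_family m k U (B : 'rV[R]_n -> 'rV[R]_m -> 'rV[R]_k) : Prop :=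
  LinearFamily {
  lf_linear : forall x, U x -> linear (B x);
  lf_smooth : forall u, smooth_on U (fun x => B x u) }.

Record bilinear_family m m' k U (B : 'rV[R]_n -> 'rV[R]_m -> 'rV[R]_m' -> 'rV[R]_k)
    : Prop := BilinearFamily {
  bf_linearl : forall x v, U x -> linear (fun u => B x u v);
  bf_linearr : forall x u, U x -> linear (B x u);
  bf_smooth : forall u v, smooth_on U (fun x => B x u v) }.

Lemma bf_diff m m' k U (B : 'rV[R]_n -> 'rV[R]_m -> 'rV[R]_m' -> 'rV[R]_k) u v x :
  bilinear_family U B -> U x -> differentiable (fun x => B x u v) x.
Proof. by move=> bB Ux; exact: (smooth_diff (bf_smooth bB u v) Ux). Qed.

Section Pullback.
Variables (V : normedModType R) (f : V -> 'rV[R]_n) (z : V) (U : set 'rV[R]_n).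
Hypotheses (Uo : open U) (Uz : U (f z)) (df : differentiable f z).

Lemma near_pullback : \forall y \near z, U (f y).
Proof.
have cf := differentiable_continuous df.
exact: (cf U (open_nbhs_nbhs (conj Uo Uz))).
Qed.

(** The base point map [f] will be [lsubmx], the bundle projection in charts: families living on N
    are differentiated at points of TN. *)
Lemma linear_family_derive m k (B : 'rV[R]_n -> 'rV[R]_m -> 'rV[R]_k) s W :
  linear_family U B -> differentiable s z ->
  differentiable (fun y => B (f y) (s y)) z /\
  'D_W (fun y => B (f y) (s y)) z =
    'D_('D_W f z) (fun x => B x (s z)) (f z) + B (f z) ('D_W s z).
Proof.
move=> lB ds.
have Bl : \forall y \near z, linear (B (f y)).
  by apply: filterS near_pullback => y; exact: lf_linear.
have dB u : differentiable (fun x => B x u) (f z).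
  exact: (smooth_diff (lf_smooth lB u) Uz).
have dBf u : differentiable (fun y => B (f y) u) z.
  exact: (differentiable_comp df (dB u)).
split; first exact: (differentiable_family Bl dBf ds).
by rewrite (derive_family W Bl dBf ds) (derive_comp W df (dB (s z))).
Qed.

Lemma bilinear_family_derive m m' k
    (B : 'rV[R]_n -> 'rV[R]_m -> 'rV[R]_m' -> 'rV[R]_k) s t W :
  bilinear_family U B -> differentiable s z -> differentiable t z ->
  differentiable (fun y => B (f y) (s y) (t y)) z /\
  'D_W (fun y => B (f y) (s y) (t y)) z =
    'D_('D_W f z) (fun x => B x (s z) (t z)) (f z) + B (f z) ('D_W s z) (t z)
    + B (f z) (s z) ('D_W t z).
Proof.
move=> bB ds dt.
have Br : \forall y \near z, linear (B (f y) (s y)).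
  by apply: filterS near_pullback => y Uy; exact: (bf_linearr bB _ Uy).
have lB v : linear_family U (fun x u => B x u v).
  by split=> [x Ux|u]; [exact: (bf_linearl bB _ Ux) | exact: (bf_smooth bB)].
have dBs v : differentiable (fun y => B (f y) (s y) v) z.
  exact: (linear_family_derive 0 (lB v) ds).1.
split; first exact: (differentiable_family Br dBs dt).
rewrite (derive_family W Br dBs dt); congr (_ + _).
by have [_ ->] := linear_family_derive W (lB (t z)) ds.
Qed.

End Pullback.

Section SmoothPullback.
Variables (m : nat) (f : 'rV[R]_m -> 'rV[R]_n) (V : set 'rV[R]_m) (U : set 'rV[R]_n).
Hypotheses (Vo : open V) (VU : forall y, V y -> U (f y)) (sf : smooth_on V f).

Lemma linear_family_smooth p k (B : 'rV[R]_n -> 'rV[R]_p -> 'rV[R]_k) s :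
  linear_family U B -> smooth_on V s -> smooth_on V (fun y => B (f y) (s y)).
Proof.
move=> lB ss; apply: (smooth_family (F := fun y => B (f y)) Vo _ _ ss).
- by move=> y /VU; exact: lf_linear.
- by move=> u; exact: (smooth_comp Vo VU sf (lf_smooth lB u)).
Qed.

Lemma bilinear_family_smooth p p' k
    (B : 'rV[R]_n -> 'rV[R]_p -> 'rV[R]_p' -> 'rV[R]_k) s t :
  bilinear_family U B -> smooth_on V s -> smooth_on V t ->
  smooth_on V (fun y => B (f y) (s y) (t y)).
Proof.
move=> bB ss st; apply: (smooth_family (F := fun y => B (f y) (s y)) Vo _ _ st).
- by move=> y /VU Uy; exact: (bf_linearr bB _ Uy).
- move=> v; apply: (linear_family_smooth (B := fun x u => B x u v) _ ss).
  by split=> [x Ux|u]; [exact: (bf_linearl bB _ Ux) | exact: (bf_smooth bB)].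
Qed.

End SmoothPullback.

Lemma bilinear_family_lin m m' k U
    (B B' : 'rV[R]_n -> 'rV[R]_m -> 'rV[R]_m' -> 'rV[R]_k) (a a' : R) : open U ->
  bilinear_family U B -> bilinear_family U B' ->
  bilinear_family U (fun x u v => a *: B x u v + a' *: B' x u v).
Proof.
move=> Uo bB bB'; split=> [x v Ux c u u'|x u Ux c v v'|u v].
- rewrite (linD (bf_linearl bB v Ux)) (linZ (bf_linearl bB v Ux)).
  rewrite (linD (bf_linearl bB' v Ux)) (linZ (bf_linearl bB' v Ux)).
  by apply/rowP => i; rewrite !mxE; ring.
- rewrite (linD (bf_linearr bB u Ux)) (linZ (bf_linearr bB u Ux)).
  rewrite (linD (bf_linearr bB' u Ux)) (linZ (bf_linearr bB' u Ux)).
  by apply/rowP => i; rewrite !mxE; ring.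
- by apply: (smooth_add Uo); apply: (smooth_scaler Uo (smooth_cst (_ : R)));
  exact: bf_smooth.
Qed.

End FamilyCalculus.

(** * Rows in two blocks and traces of maps *)

Section RowBlocks.
Context {R : realType}.

Lemma lsubmx_is_linear m k : linear (lsubmx : 'rV[R]_(m + k) -> 'rV[R]_m).
Proof. exact: linearP. Qed.

Lemma rsubmx_is_linear m k : linear (rsubmx : 'rV[R]_(m + k) -> 'rV[R]_k).
Proof. exact: linearP. Qed.

Lemma row_mx_linearl m k : linear (fun u : 'rV[R]_m => row_mx u (0 : 'rV[R]_k)).
Proof. by move=> a u v; rewrite scale_row_mx add_row_mx scaler0 addr0. Qed.

Lemma row_mx_linearr m k : linear (fun u : 'rV[R]_k => row_mx (0 : 'rV[R]_m) u).
Proof. by move=> a u v; rewrite scale_row_mx add_row_mx scaler0 addr0. Qed.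

Lemma row_mxE m k (u : 'rV[R]_m) (v : 'rV[R]_k) : row_mx u v = row_mx u 0 + row_mx 0 v.
Proof. by rewrite add_row_mx addr0 add0r. Qed.

Lemma linear_row_mx (V : lmodType R) m k (f : V -> 'rV[R]_m) (g : V -> 'rV[R]_k) :
  linear f -> linear g -> linear (fun v => row_mx (f v) (g v)).
Proof.
by move=> fl gl a u v; rewrite scale_row_mx add_row_mx fl gl.
Qed.

Section Derivative.
Context {V : normedModType R} {m k : nat}.
Implicit Types (f : V -> 'rV[R]_m) (g : V -> 'rV[R]_k) (s : V -> 'rV[R]_(m + k)).

Lemma differentiable_lsub s z : differentiable s z -> differentiable (fun y =>
  lsubmx (s y)) z.
Proof. by move=> ds; apply: (differentiable_comp ds);
  exact: differentiable_linear (@lsubmx_is_linear m k). Qed.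

Lemma differentiable_rsub s z : differentiable s z -> differentiable (fun y =>
  rsubmx (s y)) z.
Proof. by move=> ds; apply: (differentiable_comp ds);
  exact: differentiable_linear (@rsubmx_is_linear m k). Qed.

Lemma derive_lsub s z W : differentiable s z ->
  'D_W (fun y => lsubmx (s y)) z = lsubmx ('D_W s z).
Proof.
move=> ds; have dl := differentiable_linear (s z) (@lsubmx_is_linear m k).
by rewrite (derive_comp W ds dl) (derive_linear _ _ (@lsubmx_is_linear m k)).
Qed.

Lemma derive_rsub s z W : differentiable s z ->
  'D_W (fun y => rsubmx (s y)) z = rsubmx ('D_W s z).
Proof.
move=> ds; have dl := differentiable_linear (s z) (@rsubmx_is_linear m k).
by rewrite (derive_comp W ds dl) (derive_linear _ _ (@rsubmx_is_linear m k)).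
Qed.

Lemma row_mx_derive f g z W : differentiable f z -> differentiable g z ->
  differentiable (fun y => row_mx (f y) (g y)) z /\
  'D_W (fun y => row_mx (f y) (g y)) z = row_mx ('D_W f z) ('D_W g z).
Proof.
move=> df dg; rewrite (_ : (fun y => _) = fun y => row_mx (f y) 0 + row_mx 0 (g
  y)); last first.
  by apply/funext => y; exact: row_mxE.
have dl := differentiable_linear (f z) (@row_mx_linearl m k).
have dr := differentiable_linear (g z) (@row_mx_linearr m k).
have d1 : differentiable (fun y => row_mx (f y) (0 : 'rV_k)) z :=
  differentiable_comp df dl.
have d2 : differentiable (fun y => row_mx (0 : 'rV_m) (g y)) z :=
  differentiable_comp dg dr.
split; first exact: differentiable_add d1 d2.
rewrite (derive_add W d1 d2) (derive_comp W df dl) (derive_comp W dg dr).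
rewrite (derive_linear _ _ (@row_mx_linearl m k)) (derive_linear _ _
  (@row_mx_linearr m k)).
by rewrite -row_mxE.
Qed.

End Derivative.

Section Smooth.
Context {n m k : nat}.
Implicit Types U : set 'rV[R]_n.

Lemma smooth_row_mx U (f : 'rV[R]_n -> 'rV[R]_m) (g : 'rV[R]_n -> 'rV[R]_k) :
  open U -> smooth_on U f -> smooth_on U g -> smooth_on U (fun y => row_mx (f y) (g y)).
Proof.
move=> Uo sf sg; rewrite (_ : (fun y => _) = fun y => row_mx (f y) 0 + row_mx 0
  (g y)); last first.
  by apply/funext => y; exact: row_mxE.
apply: (smooth_add Uo).
- exact: (smooth_linear Uo (@row_mx_linearl m k) sf).
- exact: (smooth_linear Uo (@row_mx_linearr m k) sg).
Qed.

Lemma smooth_lsub U (s : 'rV[R]_n -> 'rV[R]_(m + k)) :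
  open U -> smooth_on U s -> smooth_on U (fun y => lsubmx (s y)).
Proof. by move=> Uo ss; exact: (smooth_linear Uo (@lsubmx_is_linear m k) ss). Qed.

Lemma smooth_rsub U (s : 'rV[R]_n -> 'rV[R]_(m + k)) :
  open U -> smooth_on U s -> smooth_on U (fun y => rsubmx (s y)).
Proof. by move=> Uo ss; exact: (smooth_linear Uo (@rsubmx_is_linear m k) ss). Qed.

End Smooth.

(** A trace for bare functions: sums, signs and blocks split without any proof of linearity, which
    only cyclicity asks for. *)
Definition ltrace m (f : 'rV[R]_m -> 'rV[R]_m) : R := \sum_i f (delta_mx 0 i) 0 i.

Lemma mxtrace_lin1 m (f : 'rV[R]_m -> 'rV[R]_m) : \tr (lin1_mx f) = ltrace f.
Proof. by apply: eq_bigr => i _; rewrite mxE. Qed.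

Lemma ltraceC m k (f : 'rV[R]_m -> 'rV[R]_k) (g : 'rV[R]_k -> 'rV[R]_m) :
  linear f -> linear g -> ltrace (fun u => f (g u)) = ltrace (fun u => g (f u)).
Proof.
move=> fl gl; rewrite /ltrace.
under eq_bigr do rewrite (lin_rV_sum fl) summxE.
rewrite exchange_big /=; apply: eq_bigr => j _.
rewrite (lin_rV_sum gl (f _)) summxE; apply: eq_bigr => i _.
by rewrite !mxE mulrC.
Qed.

Lemma ltraceD m (f g : 'rV[R]_m -> 'rV[R]_m) :
  ltrace (fun u => f u + g u) = ltrace f + ltrace g.
Proof. by rewrite /ltrace -big_split; apply: eq_bigr => i _; rewrite mxE. Qed.

Lemma ltraceN m (f : 'rV[R]_m -> 'rV[R]_m) : ltrace (fun u => - f u) = - ltrace f.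
Proof. by rewrite /ltrace -sumrN; apply: eq_bigr => i _; rewrite mxE. Qed.

Lemma ltrace_split m k (f : 'rV[R]_(m + k) -> 'rV[R]_(m + k)) :
  ltrace f = ltrace (fun u => lsubmx (f (row_mx u 0)))
           + ltrace (fun u => rsubmx (f (row_mx 0 u))).
Proof.
rewrite /ltrace big_split_ord /=; congr (_ + _); apply: eq_bigr => i _.
- by rewrite [RHS]mxE delta_mx_lshift.
- by rewrite [RHS]mxE delta_mx_rshift.
Qed.

End RowBlocks.

(** * Special complex structures in a chart *)

(** The hypothesis will be flatness of [G]: it trades the derivatives [a], [b] of the symbols for
    the quadratic terms [g1], [g2]. *)
Lemma row_mx_torsion_aux (R : comNzRingType) m k (f q : 'rV[R]_(m + k))
    (a b c d g1 g2 : 'rV[R]_k) : a + g2 = b + g1 ->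
  f + row_mx 0 (a + c) - (q + row_mx 0 (b + d)) =
  f - q + row_mx 0 (c + g1 - (d + g2)).
Proof.
move=> E; have -> : a = b + g1 - g2 by rewrite -E addrK.
rewrite opprD addrACA; congr (_ + _).
rewrite opp_row_mx add_row_mx subr0; congr row_mx.
by apply/rowP => i; rewrite !mxE; ring.
Qed.

Section SpecialChart.
Context {R : realType} {n : nat}.
Variables (U : set 'rV[R]_n) (G G' : 'rV[R]_n -> 'rV[R]_n -> 'rV[R]_n -> 'rV[R]_n)
  (J : 'rV[R]_n -> 'rV[R]_n -> 'rV[R]_n).

(** All that the computations in a chart use of D, D' and J, in this order: [G] and [G'] are their
    Christoffel symbols, and the last two fields say that J exchanges them. *)
Record special_chart : Prop := SpecialChart {
  sc_open : open U;
  sc_G : bilinear_family U G;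
  sc_G' : bilinear_family U G';
  sc_J : linear_family U J;
  sc_Gsym : forall x u v, U x -> G x u v = G x v u;
  sc_G'sym : forall x u v, U x -> G' x u v = G' x v u;
  sc_Gflat : forall x u v w, U x ->
    'D_u (fun x => G x v w) x + G x u (G x v w) =
    'D_v (fun x => G x u w) x + G x v (G x u w);
  sc_G'flat : forall x u v w, U x ->
    'D_u (fun x => G' x v w) x + G' x u (G' x v w) =
    'D_v (fun x => G' x u w) x + G' x v (G' x u w);
  sc_JJ : forall x u, U x -> J x (J x u) = - u;
  sc_JG : forall x u v, U x ->
    'D_u (fun x => J x v) x + G x u (J x v) = J x (G' x u v);
  sc_JG' : forall x u v, U x ->
    'D_u (fun x => J x v) x + G' x u (J x v) = J x (G x u v) }.

Definition chartM x u v := 2^-1 *: G x u v + 2^-1 *: G' x u v.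
(** Written as a linear combination rather than a difference so that [bilinear_family_lin] covers it
    together with [chartM]. *)
Definition chartC x u v := 2^-1 *: G' x u v + (- 2^-1) *: G x u v.

(** For a vector W = X^h + Y^v at the point z, this is the pair of components of X and Y: the
    isomorphism of TM with two copies of the pullback of TN. [coframe] is its inverse. *)
Definition frame (z W : 'rV[R]_(n + n)) : 'rV[R]_(n + n) :=
  row_mx (lsubmx W) (rsubmx W + G (lsubmx z) (lsubmx W) (rsubmx z)).

Definition coframe (z s : 'rV[R]_(n + n)) : 'rV[R]_(n + n) :=
  row_mx (lsubmx s) (rsubmx s - G (lsubmx z) (lsubmx s) (rsubmx z)).

(* The real form of [M + C (xi1 + i xi2)] acting on [s1 + i s2]. *)
Definition conn_form (x : 'rV[R]_n) (xi s : 'rV[R]_(n + n)) : 'rV[R]_(n + n) :=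
  row_mx (chartM x (lsubmx xi) (lsubmx s) - chartC x (rsubmx xi) (rsubmx s))
         (chartM x (lsubmx xi) (rsubmx s) + chartC x (rsubmx xi) (lsubmx s)).

(** The covariant derivative of a section [s] of the pullback bundle; [chart_obata] is its transport
    to TM. *)
Definition frame_deriv (s : 'rV[R]_(n + n) -> 'rV[R]_(n + n)) z W :=
  'D_W s z + conn_form (lsubmx z) (frame z W) (s z).

Definition chart_obata (Y : 'rV[R]_(n + n) -> 'rV[R]_(n + n)) z W :=
  coframe z (frame_deriv (fun z => frame z (Y z)) z W).

(** I1 on the pullback bundle: J after complex conjugation. *)
Definition block1 (x : 'rV[R]_n) (s : 'rV[R]_(n + n)) : 'rV[R]_(n + n) :=
  row_mx (J x (lsubmx s)) (- J x (rsubmx s)).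

(** I2 as multiplication by -i. The argument [x] gives it the shape of a family, shared with
    [block1]. *)
Definition block2 (x : 'rV[R]_n) (s : 'rV[R]_(n + n)) : 'rV[R]_(n + n) :=
  row_mx (rsubmx s) (- lsubmx s).

Definition chart_endo (B : 'rV[R]_n -> 'rV[R]_(n + n) -> 'rV[R]_(n + n)) z W :=
  coframe z (B (lsubmx z) (frame z W)).

Hypothesis sc : special_chart.

Let Uo := sc_open sc.
Let bG := sc_G sc.

Lemma chartM_family : bilinear_family U chartM.
Proof. by apply: (bilinear_family_lin _ _ Uo); [exact: bG | exact: (sc_G' sc)]. Qed.

Lemma chartC_family : bilinear_family U chartC.
Proof. by apply: (bilinear_family_lin _ _ Uo); [exact: (sc_G' sc) | exact: bG]. Qed.

Let bM := chartM_family.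
Let bC := chartC_family.

Lemma chartM_sym x u v : U x -> chartM x u v = chartM x v u.
Proof.
by move=> Ux; rewrite /chartM (sc_Gsym sc u v Ux) (sc_G'sym sc u v Ux).
Qed.

Lemma chartC_sym x u v : U x -> chartC x u v = chartC x v u.
Proof.
by move=> Ux; rewrite /chartC (sc_Gsym sc u v Ux) (sc_G'sym sc u v Ux).
Qed.

(** Subtracting the two exchange identities [sc_JG] and [sc_JG'] removes the derivative of J. Their
    mean gives [chartM_J]. *)
Lemma chartC_J x u v : U x -> chartC x u (J x v) = - J x (chartC x u v).
Proof.
move=> Ux; have Jl := lf_linear (sc_J sc) Ux.
have E1 := sc_JG sc u v Ux; have E2 := sc_JG' sc u v Ux.
rewrite /chartC (linD Jl) 2!(linZ Jl) -E1 -E2.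
move: ('D_u _ x) (G _ _ _) (G' _ _ _) => a b c.
by apply/rowP => i; rewrite !mxE; ring.
Qed.

Lemma chartM_J x u v : U x ->
  'D_u (fun x => J x v) x + chartM x u (J x v) = J x (chartM x u v).
Proof.
move=> Ux; have Jl := lf_linear (sc_J sc) Ux.
have E1 := sc_JG sc u v Ux; have E2 := sc_JG' sc u v Ux.
rewrite /chartM (linD Jl) 2!(linZ Jl) -E1 -E2.
move: ('D_u _ x) (G _ _ _) (G' _ _ _) => a b c.
by apply/rowP => i; rewrite !mxE; field.
Qed.

(** Cyclicity equates the traces of J J C and J C J; the first is -tr C, the second tr C by
    anticommutation. *)
Lemma ltrace_chartC x u : U x -> ltrace (chartC x u) = 0.
Proof.
move=> Ux; have Jl := lf_linear (sc_J sc) Ux; have Cl := bf_linearr bC u Ux.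
have JCl : linear (fun v => J x (chartC x u v)).
  by move=> k v w; rewrite Cl Jl.
have E1 : ltrace (fun v => J x (J x (chartC x u v))) = - ltrace (chartC x u).
  rewrite -ltraceN; apply: eq_bigr => i _; by rewrite (sc_JJ sc _ Ux).
have E2 : ltrace (fun v => J x (chartC x u (J x v))) = ltrace (chartC x u).
  apply: eq_bigr => i _.
  by rewrite (chartC_J _ _ Ux) (linN Jl) (sc_JJ sc _ Ux) opprK.
have := ltraceC Jl JCl; rewrite E1 E2 => E.
have : ltrace (chartC x u) + ltrace (chartC x u) = 0 by rewrite -{1}E addNr.
by move=> /eqP; rewrite -mulr2n mulrn_eq0 /= => /eqP.
Qed.

Lemma frame_linear z : U (lsubmx z) -> linear (frame z).
Proof.
move=> Uz; have Gl := bf_linearl bG (rsubmx z) Uz.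
apply: linear_row_mx; first exact: lsubmx_is_linear.
move=> k W W'; rewrite (linD (@lsubmx_is_linear _ n n)) (linZ (@lsubmx_is_linear
  _ n n)).
rewrite (linD Gl) (linZ Gl) (linD (@rsubmx_is_linear _ n n)) (linZ
  (@rsubmx_is_linear _ n n)).
by rewrite [in RHS]scalerDr [LHS]addrACA.
Qed.

Lemma coframe_linear z : U (lsubmx z) -> linear (coframe z).
Proof.
move=> Uz; have Gl := bf_linearl bG (rsubmx z) Uz.
apply: linear_row_mx; first exact: lsubmx_is_linear.
move=> k W W'; rewrite (linD (@lsubmx_is_linear _ n n)) (linZ (@lsubmx_is_linear
  _ n n)).
rewrite (linD Gl) (linZ Gl) (linD (@rsubmx_is_linear _ n n)) (linZ
  (@rsubmx_is_linear _ n n)).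
by rewrite [in RHS]scalerBr opprD [LHS]addrACA.
Qed.

Lemma frameK z : cancel (frame z) (coframe z).
Proof. by move=> W; rewrite /coframe !row_mxKl row_mxKr addrK hsubmxK. Qed.

Lemma coframeK z : cancel (coframe z) (frame z).
Proof. by move=> W; rewrite /frame !row_mxKl row_mxKr subrK hsubmxK. Qed.

Lemma conn_form_family : bilinear_family U conn_form.
Proof.
have ll := @lsubmx_is_linear R n n; have rl := @rsubmx_is_linear R n n.
split=> [x s Ux|x xi Ux|xi s].
- have [M1 M2 C1 C2] := And4 (bf_linearl bM (lsubmx s) Ux)
    (bf_linearl bM (rsubmx s) Ux) (bf_linearl bC (rsubmx s) Ux) (bf_linearl bC
      (lsubmx s) Ux).
  apply: linear_row_mx => k a b.
    rewrite (linD ll) (linZ ll) (linD rl) (linZ rl) M1 C1.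
    by rewrite [in RHS]scalerBr opprD [LHS]addrACA.
  rewrite (linD ll) (linZ ll) (linD rl) (linZ rl) M2 C2.
  by rewrite [in RHS]scalerDr [LHS]addrACA.
- have [M1 C1] := conj (bf_linearr bM (lsubmx xi) Ux) (bf_linearr bC (rsubmx xi) Ux).
  apply: linear_row_mx => k a b.
    rewrite (linD ll) (linZ ll) (linD rl) (linZ rl) M1 C1.
    by rewrite [in RHS]scalerBr opprD [LHS]addrACA.
  rewrite (linD ll) (linZ ll) (linD rl) (linZ rl) M1 C1.
  by rewrite [in RHS]scalerDr [LHS]addrACA.
- apply: (smooth_row_mx Uo).
    apply: (smooth_add Uo); first exact: (bf_smooth bM).
    by apply: (smooth_opp Uo); exact: (bf_smooth bC).
  by apply: (smooth_add Uo); [exact: (bf_smooth bM) | exact: (bf_smooth bC)].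
Qed.


Lemma chartME x u v : chartM x u v = G x u v + chartC x u v.
Proof.
rewrite /chartM /chartC; move: (G x u v) (G' x u v) => a b.
by apply/rowP => i; rewrite !mxE; field.
Qed.

(** The form is [G] along the first block of [xi] plus the complex bilinear extension of [chartC].
    The latter is symmetric, and in the first block so is [G]; only the second block of the [G] part
    survives. *)
Lemma conn_form_skew x xi eta : U x ->
  conn_form x xi eta - conn_form x eta xi =
  row_mx 0 (G x (lsubmx xi) (rsubmx eta) - G x (lsubmx eta) (rsubmx xi)).
Proof.
move=> Ux; rewrite /conn_form opp_row_mx add_row_mx; congr row_mx.
  rewrite (chartM_sym (lsubmx eta) _ Ux) (chartC_sym (rsubmx eta) _ Ux).
  exact: subrr.
rewrite 2!chartME (chartC_sym (rsubmx eta) _ Ux) (chartC_sym (rsubmx xi) _ Ux).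
move: (G _ _ _) (G _ _ _) (chartC _ _ _) (chartC _ _ _) => a b c d.
by apply/rowP => i; rewrite !mxE; ring.
Qed.

Lemma frame_l z W : lsubmx (frame z W) = lsubmx W.
Proof. exact: row_mxKl. Qed.

Lemma frame_r z W :
  rsubmx (frame z W) = rsubmx W + G (lsubmx z) (lsubmx W) (rsubmx z).
Proof. exact: row_mxKr. Qed.

Section AtPoint.
Variable z : 'rV[R]_(n + n).
Hypothesis Uz : U (lsubmx z).

Let ll := @lsubmx_is_linear R n n.
Let rl := @rsubmx_is_linear R n n.
Let dl : differentiable (lsubmx : 'rV[R]_(n + n) -> 'rV[R]_n) z :=
  differentiable_linear z ll.
Let dr : differentiable (rsubmx : 'rV[R]_(n + n) -> 'rV[R]_n) z :=
  differentiable_linear z rl.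
Let Dl W : 'D_W (lsubmx : 'rV[R]_(n + n) -> 'rV[R]_n) z = lsubmx W :=
  derive_linear z W ll.
Let Dr W : 'D_W (rsubmx : 'rV[R]_(n + n) -> 'rV[R]_n) z = rsubmx W :=
  derive_linear z W rl.

Lemma frame_derive Y W : differentiable Y z ->
  differentiable (fun y => frame y (Y y)) z /\
  'D_W (fun y => frame y (Y y)) z = frame z ('D_W Y z) +
    row_mx 0 ('D_(lsubmx W) (fun x => G x (lsubmx (Y z)) (rsubmx z)) (lsubmx z)
      + G (lsubmx z) (lsubmx (Y z)) (rsubmx W)).
Proof.
move=> dY; have dlY := differentiable_lsub dY; have drY := differentiable_rsub dY.
have [dG DG] := bilinear_family_derive Uo Uz dl W bG dlY dr.
have dB := differentiable_add drY dG.
have [dF DF] := row_mx_derive W dlY dB.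
split; first exact: dF.
apply: (etrans DF); rewrite (derive_add W drY dG) DG Dl Dr.
rewrite (derive_lsub W dY) (derive_rsub W dY) /frame add_row_mx addr0.
congr row_mx.
move: ('D_ _ _ _) (G _ _ _) (G _ _ _) (rsubmx _) => a b c d.
by apply/rowP => i; rewrite !mxE; ring.
Qed.

(** Structure equation of the frame. Flatness of [G] absorbs the derivatives of the symbols; what
    remains has no derivative and is the opposite of the term in [conn_form_skew]. *)
Lemma frame_torsion X Y : differentiable X z -> differentiable Y z ->
  'D_(X z) (fun y => frame y (Y y)) z - 'D_(Y z) (fun y => frame y (X y)) z =
  frame z ('D_(X z) Y z - 'D_(Y z) X z)
  + row_mx 0 (G (lsubmx z) (lsubmx (Y z)) (rsubmx (frame z (X z)))
              - G (lsubmx z) (lsubmx (X z)) (rsubmx (frame z (Y z)))).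
Proof.
move=> dX dY.
have [_ ->] := frame_derive (X z) dY; have [_ ->] := frame_derive (Y z) dX.
rewrite (linB (frame_linear Uz)) (frame_r z (X z)) (frame_r z (Y z)).
rewrite (linD (bf_linearr bG (lsubmx (Y z)) Uz)) (linD (bf_linearr bG (lsubmx (X
  z)) Uz)).
have := sc_Gflat sc (lsubmx (X z)) (lsubmx (Y z)) (rsubmx z) Uz.
exact: row_mx_torsion_aux.
Qed.

Lemma frame_deriv_linear s : differentiable s z -> linear (frame_deriv s z).
Proof.
move=> ds k W W'; rewrite /frame_deriv (frame_linear Uz).
rewrite (linear_derive ds) (bf_linearl conn_form_family _ Uz).
by rewrite [in RHS]scalerDr [LHS]addrACA.
Qed.

Lemma frame_deriv_add s t W : differentiable s z -> differentiable t z ->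
  frame_deriv (fun y => s y + t y) z W = frame_deriv s z W + frame_deriv t z W.
Proof.
move=> ds dt; rewrite /frame_deriv (derive_add W ds dt).
by rewrite (linD (bf_linearr conn_form_family _ Uz)) [LHS]addrACA.
Qed.

Lemma frame_deriv_scale (f : 'rV[R]_(n + n) -> R) s W :
  differentiable f z -> differentiable s z ->
  frame_deriv (fun y => f y *: s y) z W = 'D_W f z *: s z + f z *: frame_deriv s z W.
Proof.
move=> df ds; rewrite /frame_deriv (derive_scaler W df ds).
by rewrite (linZ (bf_linearr conn_form_family _ Uz)) [in RHS]scalerDr addrA.
Qed.

Lemma chart_obata_linear Y : differentiable Y z -> linear (chart_obata Y z).
Proof.
move=> dY k W W'; rewrite /chart_obata.
by rewrite (frame_deriv_linear (frame_derive 0 dY).1) (coframe_linear Uz).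
Qed.

Lemma chart_obata_near Y Y' W : (\forall y \near z, Y y = Y' y) ->
  chart_obata Y z W = chart_obata Y' z W.
Proof.
move=> YY'; rewrite /chart_obata /frame_deriv (nbhs_singleton YY').
have E : 'D_W (fun y => frame y (Y y)) z = 'D_W (fun y => frame y (Y' y)) z.
  by apply: near_eq_derive; apply: filterS YY' => y ->.
by rewrite E.
Qed.

Lemma chart_obata_add Y Y' W : differentiable Y z -> differentiable Y' z ->
  chart_obata (fun y => Y y + Y' y) z W = chart_obata Y z W + chart_obata Y' z W.
Proof.
move=> dY dY'; have [dF _] := frame_derive 0 dY; have [dF' _] := frame_derive 0 dY'.
have near_lin : \forall y \near z, U (lsubmx y) := near_pullback Uo Uz dl.
(* [frame] is linear only over [U], so it is split under the derivative just near [z]. *)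
have E : 'D_W (fun y => frame y (Y y + Y' y)) z =
    'D_W (fun y => frame y (Y y) + frame y (Y' y)) z.
  apply: near_eq_derive; apply: filterS near_lin => y Uy.
  exact: (linD (frame_linear Uy)).
rewrite /chart_obata -(linD (coframe_linear Uz)) -(frame_deriv_add W dF dF').
by rewrite /frame_deriv (linD (frame_linear Uz)) E.
Qed.

Lemma chart_obata_scale (f : 'rV[R]_(n + n) -> R) Y W :
  differentiable f z -> differentiable Y z ->
  chart_obata (fun y => f y *: Y y) z W = 'D_W f z *: Y z + f z *: chart_obata Y z W.
Proof.
move=> df dY; have [dF _] := frame_derive 0 dY.
have near_lin : \forall y \near z, U (lsubmx y) := near_pullback Uo Uz dl.
have cl := coframe_linear Uz.
have E : 'D_W (fun y => frame y (f y *: Y y)) z =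
    'D_W (fun y => f y *: frame y (Y y)) z.
  apply: near_eq_derive; apply: filterS near_lin => y Uy.
  exact: (linZ (frame_linear Uy)).
transitivity (coframe z (frame_deriv (fun y => f y *: frame y (Y y)) z W)).
  by rewrite /chart_obata /frame_deriv (linZ (frame_linear Uz)) E.
by rewrite (frame_deriv_scale W df dF) (linD cl) 2!(linZ cl) frameK.
Qed.

Lemma chart_obata_torsion X Y : differentiable X z -> differentiable Y z ->
  chart_obata Y z (X z) - chart_obata X z (Y z) = 'D_(X z) Y z - 'D_(Y z) X z.
Proof.
move=> dX dY; have cl := coframe_linear Uz.
have E : frame_deriv (fun y => frame y (Y y)) z (X z)
    - frame_deriv (fun y => frame y (X y)) z (Y z)
    = frame z ('D_(X z) Y z - 'D_(Y z) X z).
  rewrite /frame_deriv opprD addrACA (frame_torsion dX dY) (conn_form_skew _ _ Uz).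
  rewrite -addrA add_row_mx addr0 (frame_l z (X z)) (frame_l z (Y z)).
  by rewrite addrA subrK subrr row_mx0 addr0.
by rewrite /chart_obata -(linB cl) E frameK.
Qed.


(** The mean connection commutes with J and is real, so it commutes with conjugation. In i C_Y, the
    factor i changes sign against conjugation and C_Y against J; the signs compensate. *)
Lemma frame_deriv_block1 s W : differentiable s z ->
  frame_deriv (fun y => block1 (lsubmx y) (s y)) z W =
  block1 (lsubmx z) (frame_deriv s z W).
Proof.
move=> ds; have dls := differentiable_lsub ds; have drs := differentiable_rsub ds.
have lJ := sc_J sc; have Jl := lf_linear lJ Uz.
have [dJl DJl] := linear_family_derive Uo Uz dl W lJ dls.
have [dJr DJr] := linear_family_derive Uo Uz dl W lJ drs.
have dNJr : differentiable (fun y => - J (lsubmx y) (rsubmx (s y))) z.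
  exact: differentiableN.
have [_ DB] := row_mx_derive W dJl dNJr.
rewrite /frame_deriv; apply: (etrans (congr1 (fun v => v + _) DB)).
rewrite (derive_opp W dJr) DJl DJr Dl (derive_lsub W ds) (derive_rsub W ds).
rewrite /conn_form /block1 frame_l.
set u := lsubmx W; set w := rsubmx (frame z W); rewrite !row_mxKl !row_mxKr.
set p := lsubmx ('D_W s z); set q := rsubmx ('D_W s z).
have Ml := bf_linearr bM u Uz; have Cl := bf_linearr bC w Uz.
rewrite (linN Ml) (linN Cl) (linD ll) (linD rl) -/p -/q.
rewrite [LHS]add_row_mx !row_mxKl !row_mxKr.
have JD3 a b c : J (lsubmx z) (a + (b + c)) =
    J (lsubmx z) a + (J (lsubmx z) b + J (lsubmx z) c) by rewrite 2!(linD Jl).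
rewrite 2!(chartC_J _ _ Uz) 2!JD3 (linN Jl) -2!(chartM_J _ _ Uz).
move: ('D_u _ _) ('D_u _ _) (J _ p) (J _ q) => a b c d.
move: (chartM _ _ _) (chartM _ _ _) (J _ (chartC _ _ _)) (J _ (chartC _ _ _)) =>
  a' b' c' d'.
by congr row_mx; apply/rowP => i; rewrite !mxE; ring.
Qed.

Lemma block2_linear x : linear (block2 x).
Proof.
apply: linear_row_mx => k a b; first exact: rl.
by rewrite ll opprD scalerN.
Qed.

(** This holds because the connection form acts complex linearly on [s]. *)
Lemma frame_deriv_block2 s W : differentiable s z ->
  frame_deriv (fun y => block2 (lsubmx y) (s y)) z W =
  block2 (lsubmx z) (frame_deriv s z W).
Proof.
move=> ds; have b2 := block2_linear 0.
have DB := derive_comp W ds (differentiable_linear (s z) b2).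
rewrite /frame_deriv; apply: (etrans (congr1 (fun v => v + _) DB)).
rewrite (derive_linear _ _ b2) -[block2 0 _]/(block2 (lsubmx z) _).
rewrite [RHS](linD (block2_linear _)); congr (_ + _).
rewrite /conn_form /block2; set fW := frame z W; rewrite !row_mxKl !row_mxKr.
rewrite (linN (bf_linearr bM _ Uz)) (linN (bf_linearr bC _ Uz)).
by rewrite opprK opprB [- _ + _]addrC.
Qed.

(** Both sides are conjugates by [frame], so commutation only has to be checked on the pullback
    bundle. *)
Lemma chart_obata_endo B Y W :
  (forall s W', differentiable s z -> frame_deriv (fun y => B (lsubmx y) (s y)) z W' =
     B (lsubmx z) (frame_deriv s z W')) ->
  differentiable Y z ->
  chart_obata (fun y => chart_endo B y (Y y)) z W = chart_endo B z (chart_obata Y z W).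
Proof.
move=> HB dY; rewrite /chart_obata /chart_endo coframeK -HB; last first.
  exact: (frame_derive 0 dY).1.
congr (coframe z (frame_deriv _ z W)).
by apply/funext => y; rewrite coframeK.
Qed.

End AtPoint.

Lemma block1_family : linear_family U block1.
Proof.
have ll := @lsubmx_is_linear R n n; have rl := @rsubmx_is_linear R n n.
have lJ := sc_J sc; split=> [x Ux|s].
  have Jl := lf_linear lJ Ux.
  apply: linear_row_mx => k a b; first by rewrite ll Jl.
  by rewrite rl Jl opprD scalerN.
apply: (smooth_row_mx Uo); first exact: (lf_smooth lJ).
by apply: (smooth_opp Uo); exact: (lf_smooth lJ).
Qed.

Lemma block2_family : linear_family U block2.
Proof. by split=> [x _|s]; [exact: block2_linear | exact: smooth_cst]. Qed.

Section Smoothness.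
Variable V : set 'rV[R]_(n + n).
Hypotheses (Vo : open V) (VU : forall z, V z -> U (lsubmx z)).

Let sl : smooth_on V (lsubmx : 'rV[R]_(n + n) -> 'rV[R]_n) :=
  smooth_lsub Vo (@smooth_id _ _ V).
Let sr : smooth_on V (rsubmx : 'rV[R]_(n + n) -> 'rV[R]_n) :=
  smooth_rsub Vo (@smooth_id _ _ V).

Lemma frame_smooth Y : smooth_on V Y -> smooth_on V (fun y => frame y (Y y)).
Proof.
move=> sY; have slY := smooth_lsub Vo sY; apply: (smooth_row_mx Vo slY).
apply: (smooth_add Vo (smooth_rsub Vo sY)).
exact: (bilinear_family_smooth Vo VU sl bG slY sr).
Qed.

Lemma coframe_smooth Y : smooth_on V Y -> smooth_on V (fun y => coframe y (Y y)).
Proof.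
move=> sY; have slY := smooth_lsub Vo sY; apply: (smooth_row_mx Vo slY).
apply: (smooth_add Vo (smooth_rsub Vo sY)); apply: (smooth_opp Vo).
exact: (bilinear_family_smooth Vo VU sl bG slY sr).
Qed.

Lemma chart_endo_smooth B Y : linear_family U B -> smooth_on V Y ->
  smooth_on V (fun y => chart_endo B y (Y y)).
Proof.
move=> lB sY; apply: coframe_smooth.
exact: (linear_family_smooth Vo VU sl lB (frame_smooth sY)).
Qed.

Lemma frame_deriv_smooth s X : smooth_on V s -> smooth_on V X ->
  smooth_on V (fun y => frame_deriv s y (X y)).
Proof.
move=> ss sX; apply: (smooth_add Vo).
  apply: (smooth_family (F := fun y u => 'D_u s y) Vo _ _ sX).
  - by move=> y Vy; apply: linear_derive; exact: (smooth_diff ss Vy).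
  - by move=> u; exact: smooth_derive.
exact: (bilinear_family_smooth Vo VU sl conn_form_family (frame_smooth sX) ss).
Qed.

Lemma chart_obata_smooth Y X : smooth_on V Y -> smooth_on V X ->
  smooth_on V (fun y => chart_obata Y y (X y)).
Proof.
by move=> sY sX; exact: (coframe_smooth (frame_deriv_smooth (frame_smooth sY) sX)).
Qed.

End Smoothness.
End SpecialChart.

(** * Curvature in a chart *)

Section LinearClosure.
Context {K : comNzRingType} {U V W : lmodType K}.
Implicit Types (f g : U -> V) (h : V -> W).

Lemma linear_add_fun f g : linear f -> linear g -> linear (fun u => f u + g u).
Proof. by move=> fl gl k u v; rewrite fl gl scalerDr addrACA. Qed.

Lemma linear_sub_fun f g : linear f -> linear g -> linear (fun u => f u - g u).
Proof. by move=> fl gl k u v; rewrite fl gl scalerBr opprD addrACA. Qed.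

Lemma linear_comp_fun f h : linear f -> linear h -> linear (fun u => h (f u)).
Proof. by move=> fl hl k u v; rewrite fl hl. Qed.

End LinearClosure.

Section ChartCurvature.
Context {R : realType} {n : nat}.
Variables (U : set 'rV[R]_n) (G G' : 'rV[R]_n -> 'rV[R]_n -> 'rV[R]_n -> 'rV[R]_n)
  (J : 'rV[R]_n -> 'rV[R]_n -> 'rV[R]_n).
Hypothesis sc : special_chart U G G' J.

Let Uo := sc_open sc.
Let bG := sc_G sc.
Let bC := chartC_family sc.
Let bA := conn_form_family sc.
Local Notation C := (chartC G G').
Local Notation A := (conn_form G G').

(** dA + [A, A] for the connection form A in the frame. Derivatives are taken along the first blocks
    since A depends on the base point alone; the third term comes from [frame_torsion]. *)
Definition chart_curvature (x : 'rV[R]_n) (xi eta t : 'rV[R]_(n + n)) :=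
  'D_(lsubmx xi) (fun x => conn_form G G' x eta t) x
  - 'D_(lsubmx eta) (fun x => conn_form G G' x xi t) x
  + conn_form G G' x (row_mx 0 (G x (lsubmx eta) (rsubmx xi)
                                - G x (lsubmx xi) (rsubmx eta))) t
  + (conn_form G G' x xi (conn_form G G' x eta t)
     - conn_form G G' x eta (conn_form G G' x xi t)).

(** [S], [S'] stand for the mixed second derivatives of the section, [D1] for its derivative along
    the bracket, [D0] for that along the derivative of a constant field, and the [k]s for the frame
    torsion inserted into A. *)
Lemma curvature_aux k (S S' D1 D0 a1 a2 k1 k2 k3 k4 e1 e2 q1 q2 : 'rV[R]_k) :
  S = S' -> D0 = 0 -> k1 - k2 - k3 = k4 ->
  S + D1 + (a1 + k1 + e1) + (e2 + q1) - (S' + D0 + (a2 + k2 + e2) + (e1 + q2))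
  - (D1 + k3) = a1 - a2 + k4 + (q1 - q2).
Proof. by move=> -> -> <-; apply/rowP => i; rewrite !mxE; ring. Qed.

Section AtPoint.
Variables (V : set 'rV[R]_(n + n)) (z : 'rV[R]_(n + n)).
Hypotheses (Vo : open V) (VU : forall z, V z -> U (lsubmx z)) (Vz : V z).
Variables (t X : 'rV[R]_(n + n) -> 'rV[R]_(n + n)).
Hypotheses (st : smooth_on V t) (sX : smooth_on V X).

Lemma frame_deriv_frame_deriv w :
  frame_deriv G G' (fun y => frame_deriv G G' t y (X y)) z w =
  'D_w ('D_(X z) t) z + 'D_('D_w X z) t z
  + ('D_(lsubmx w) (fun x => A x (frame G z (X z)) (t z)) (lsubmx z)
     + A (lsubmx z) ('D_w (fun y => frame G y (X y)) z) (t z)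
     + A (lsubmx z) (frame G z (X z)) ('D_w t z))
  + (A (lsubmx z) (frame G z w) ('D_(X z) t z)
     + A (lsubmx z) (frame G z w) (A (lsubmx z) (frame G z (X z)) (t z))).
Proof.
have Uz := VU Vz; have dt := smooth_diff st Vz; have dX := smooth_diff sX Vz.
have dl := differentiable_linear z (@lsubmx_is_linear R n n).
have Dl := derive_linear z w (@lsubmx_is_linear R n n).
have dF := (frame_derive sc Uz 0 dX).1.
have [dAt DAt] := bilinear_family_derive Uo Uz dl w bA dF dt.
have tl : \forall y \near z, linear (fun u => 'D_u t y).
  apply: filterS (open_nbhs_nbhs (conj Vo Vz)) => y Vy.
  by apply: linear_derive; exact: (smooth_diff st Vy).
have dDt u : differentiable (fun y => 'D_u t y) z.
  exact: (smooth_diff (smooth_derive u st) Vz).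
have dDX := differentiable_family tl dDt dX.
have DDX := derive_family w tl dDt dX.
have Al := bf_linearr bA (frame G z w) Uz.
have E : frame_deriv G G' (fun y => frame_deriv G G' t y (X y)) z w =
    'D_w (fun y => 'D_(X y) t y + A (lsubmx y) (frame G y (X y)) (t y)) z
    + A (lsubmx z) (frame G z w) ('D_(X z) t z + A (lsubmx z) (frame G z (X z)) (t z)).
  by [].
apply: (etrans E); rewrite (derive_add w dDX dAt) (linD Al).
rewrite Dl in DAt; set rest := (X in _ = _ + _ + X).
exact: (congr2 (fun u v => u + v + rest) DDX DAt).
Qed.

End AtPoint.

(** The vector [x] is extended with constant components, so the bracket is just ['D_x Y]. All
    derivatives of the section [frame y (Z y)] cancel, the second ones by Schwarz, and a tensorial
    expression remains. *)
Lemma chart_obata_curvature V z (Y Z : 'rV[R]_(n + n) -> 'rV[R]_(n + n)) x :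
  open V -> (forall z, V z -> U (lsubmx z)) -> V z ->
  smooth_on V Y -> smooth_on V Z ->
  let Ob := chart_obata G G' in
  Ob (fun y => Ob Z y (Y y)) z x - Ob (fun y => Ob Z y x) z (Y z)
    - Ob Z z ('D_x Y z) =
  coframe G z (chart_curvature (lsubmx z) (frame G z x) (frame G z (Y z))
    (frame G z (Z z))).
Proof.
move=> Vo VU Vz sY sZ Ob; have Uz := VU _ Vz; have cl := coframe_linear sc Uz.
have st := frame_smooth sc Vo VU sZ; set t := fun y => frame G y (Z y) in st.
have ObE X : (fun y => frame G y (Ob Z y (X y))) = (fun y => frame_deriv G G' t y
  (X y)).
  by apply/funext => y; exact: coframeK.
have dY := smooth_diff sY Vz; have sx := @smooth_cst _ _ _ V x.
have dx : differentiable (fun _ : 'rV[R]_(n + n) => x) z := smooth_diff sx Vz.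
have E0 w : 'D_w (fun _ : 'rV[R]_(n + n) => x) z = 0 := derive_cst x z w.
have tor : 'D_x (fun y => frame G y (Y y)) z - 'D_(Y z) (fun y => frame G y x) z =
    frame G z ('D_x Y z)
    + row_mx 0 (G (lsubmx z) (lsubmx (Y z)) (rsubmx (frame G z x))
              - G (lsubmx z) (lsubmx x) (rsubmx (frame G z (Y z)))).
  apply: (etrans (frame_torsion sc Uz dx dY)).
  by apply: (congr1 (fun v => frame G z v + _)); rewrite (E0 (Y z)) subr0.
have Al := bf_linearl bA (t z) Uz.
have H1 : Ob (fun y => Ob Z y (Y y)) z x =
    coframe G z (frame_deriv G G' (fun y => frame_deriv G G' t y (Y y)) z x).
  exact: (congr1 (fun s => coframe G z (frame_deriv G G' s z x)) (ObE Y)).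
have H2 : Ob (fun y => Ob Z y x) z (Y z) =
    coframe G z (frame_deriv G G' (fun y => frame_deriv G G' t y x) z (Y z)).
  exact: (congr1 (fun s => coframe G z (frame_deriv G G' s z (Y z))) (ObE (fun _
    => x))).
have H3 w : Ob Z z w = coframe G z ('D_w t z + A (lsubmx z) (frame G z w) (t z)).
  exact: erefl.
apply: (etrans (congr2 (fun u v => u - v)
  (congr2 (fun u v => u - v) H1 H2) (H3 ('D_x Y z)))).
rewrite -2!(linB cl); apply: (congr1 (coframe G z)).
have H4 := frame_deriv_frame_deriv Vo VU Vz st sY x.
have H5 := frame_deriv_frame_deriv Vo VU Vz st sx (Y z).
have D0 : 'D_('D_(Y z) (fun _ : 'rV[R]_(n + n) => x) z) t z = 0.
  by rewrite (E0 (Y z)); exact: derive0.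
have torE : 'D_x (fun y => frame G y (Y y)) z - 'D_(Y z) (fun y => frame G y x) z
    - frame G z ('D_x Y z) =
    row_mx 0 (G (lsubmx z) (lsubmx (Y z)) (rsubmx (frame G z x))
              - G (lsubmx z) (lsubmx x) (rsubmx (frame G z (Y z)))).
  apply: (etrans (congr1 (fun u => u - _) tor)); by rewrite addrC addKr.
apply: (etrans (congr2 (fun u v => u - v - _) H4 H5)).
have K : A (lsubmx z) ('D_x (fun y => frame G y (Y y)) z) (t z)
    - A (lsubmx z) ('D_(Y z) (fun y => frame G y x) z) (t z)
    - A (lsubmx z) (frame G z ('D_x Y z)) (t z) =
    A (lsubmx z) (row_mx 0 (G (lsubmx z) (lsubmx (Y z)) (rsubmx (frame G z x))
              - G (lsubmx z) (lsubmx x) (rsubmx (frame G z (Y z))))) (t z).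
  rewrite -2!(linB Al); exact: (congr1 (fun xi => A (lsubmx z) xi (t z)) torE).
have S := schwarz x (Y z) Vo st Vz.
pose DA u s := 'D_u (fun x => A x s (t z)) (lsubmx z).
pose x' := frame G z x; pose Y' := frame G z (Y z).
rewrite /chart_curvature (frame_l G z x) (frame_l G z (Y z)).
exact: (curvature_aux ('D_('D_x Y z) t z) (DA (lsubmx x) Y') (DA (lsubmx (Y z)) x')
  (A (lsubmx z) Y' ('D_x t z)) (A (lsubmx z) x' ('D_(Y z) t z))
  (A (lsubmx z) x' (A (lsubmx z) Y' (t z))) (A (lsubmx z) Y' (A (lsubmx z) x' (t z)))
  S D0 K).
Qed.


Let bM := chartM_family sc.

Lemma bf_derive0l m m' k (B : 'rV[R]_n -> 'rV[R]_m -> 'rV[R]_m' -> 'rV[R]_k) x v q :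
  bilinear_family U B -> U x -> 'D_v (fun x => B x 0 q) x = 0.
Proof.
move=> bB Ux; have E : \forall y \near x, (fun _ => 0) y = B y 0 q.
  apply: filterS (open_nbhs_nbhs (conj Uo Ux)) => y Uy.
  by rewrite (lin0 (bf_linearl bB q Uy)).
by rewrite -(near_eq_derive v E); exact: derive_cst.
Qed.

Lemma bf_chartC_aux k (d d' e e' a b c f g h g' h' : 'rV[R]_k) :
  d + a = e + b -> d' + c = e' + f ->
  2^-1 *: d' + (- 2^-1) *: d + (2^-1 *: g + (- 2^-1) *: a)
  + (2^-1 *: h + (- 2^-1) *: a)
  + 2 *: (2^-1 *: (2^-1 *: c + (- 2^-1) *: h) + (- 2^-1) *: (2^-1 *: g + (- 2^-1) *: a))
  = 2^-1 *: e' + (- 2^-1) *: e + (2^-1 *: g' + (- 2^-1) *: b)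
  + (2^-1 *: h' + (- 2^-1) *: b)
  + 2 *: (2^-1 *: (2^-1 *: f + (- 2^-1) *: h') + (- 2^-1) *: (2^-1 *: g' + (-
    2^-1) *: b)).
Proof.
move=> E E'; have -> : d = e + b - a by rewrite -E addrK.
have -> : d' = e' + f - c by rewrite -E' addrK.
by apply/rowP => i; rewrite !mxE; field.
Qed.

Lemma derive_chartC x u v w : U x ->
  'D_u (fun x => C x v w) x =
  2^-1 *: 'D_u (fun x => G' x v w) x + (- 2^-1) *: 'D_u (fun x => G x v w) x.
Proof.
move=> Ux; have dG := bf_diff v w bG Ux; have dG' := bf_diff v w (sc_G' sc) Ux.
have d1 : differentiable (fun x => 2^-1 *: G' x v w) x by exact: differentiableZ.
have d2 : differentiable (fun x => (- 2^-1) *: G x v w) x by exact: differentiableZ.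
by rewrite (derive_add u d1 d2) (derive_scale _ u dG) (derive_scale _ u dG').
Qed.

(* Flatness of [G] and of [G' = G + 2 C] amounts to
   [(nabla_u C)_v - (nabla_v C)_u = - 2 [C_u, C_v]]. *)
Lemma chartC_flat x u v w : U x ->
  'D_u (fun x => C x v w) x + G x u (C x v w) + C x u (G x v w)
    + 2 *: C x u (C x v w) =
  'D_v (fun x => C x u w) x + G x v (C x u w) + C x v (G x u w)
    + 2 *: C x v (C x u w).
Proof.
move=> Ux; rewrite 2!(derive_chartC _ _ _ Ux).
have Gl a := bf_linearr bG a Ux; have Gl' a := bf_linearr (sc_G' sc) a Ux.
rewrite /chartC 2!(linD (Gl _)) 2!(linD (Gl' _)) 4!(linZ (Gl _)) 4!(linZ (Gl' _)).
exact: bf_chartC_aux (sc_Gflat sc u v w Ux) (sc_G'flat sc u v w Ux).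
Qed.

(** [chartM] is split into [G] and [C] because the flatness identities are stated for these. *)
Lemma derive_conn_form x v xi s : U x ->
  'D_v (fun x => A x xi s) x =
  row_mx ('D_v (fun x => G x (lsubmx xi) (lsubmx s)) x
          + 'D_v (fun x => C x (lsubmx xi) (lsubmx s)) x
          - 'D_v (fun x => C x (rsubmx xi) (rsubmx s)) x)
         ('D_v (fun x => G x (lsubmx xi) (rsubmx s)) x
          + 'D_v (fun x => C x (lsubmx xi) (rsubmx s)) x
          + 'D_v (fun x => C x (rsubmx xi) (lsubmx s)) x).
Proof.
move=> Ux; have dG a b := bf_diff a b bG Ux; have dC a b := bf_diff a b bC Ux.
have dM a b : differentiable (fun x => chartM G G' x a b) x := bf_diff a b bM Ux.
have DM a b : 'D_v (fun x => chartM G G' x a b) x =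
    'D_v (fun x => G x a b) x + 'D_v (fun x => C x a b) x.
  rewrite -(derive_add v (dG a b) (dC a b)).
  by apply: (congr1 (fun f => 'D_v f x)); apply/funext => y; exact: chartME.
have d1 := differentiable_sub (dM (lsubmx xi) (lsubmx s)) (dC (rsubmx xi) (rsubmx s)).
have d2 := differentiable_add (dM (lsubmx xi) (rsubmx s)) (dC (rsubmx xi) (lsubmx s)).
apply: (etrans (row_mx_derive v d1 d2).2); congr row_mx.
  by rewrite (derive_sub v (dM _ _) (dC _ _)) DM.
by rewrite (derive_add v (dM _ _) (dC _ _)) DM.
Qed.

(** * The trace of the curvature *)

Section Trace.
Variables (x : 'rV[R]_n) (eta t : 'rV[R]_(n + n)).
Hypothesis Ux : U x.

Local Notation a := (lsubmx eta).
Local Notation b := (rsubmx eta).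
Local Notation p := (lsubmx t).
Local Notation q := (rsubmx t).
Local Notation dG u v w := ('D_u (fun x => G x v w) x).
Local Notation dC u v w := ('D_u (fun x => C x v w) x).
Local Notation g := (G x).
Local Notation c := (C x).
Local Notation mm := (chartM G G' x).

Let ll := @lsubmx_is_linear R n n.
Let rl := @rsubmx_is_linear R n n.

Let m0 v : mm 0 v = 0.
Proof. exact: (lin0 (bf_linearl bM v Ux)). Qed.

Let c0 v : c 0 v = 0.
Proof. exact: (lin0 (bf_linearl bC v Ux)). Qed.

Lemma conn_form_lblock u s :
  A x (row_mx u 0) s = row_mx (mm u (lsubmx s)) (mm u (rsubmx s)).
Proof. by rewrite /conn_form row_mxKl row_mxKr 2!c0 subr0 addr0. Qed.

Lemma conn_form_rblock u s :
  A x (row_mx 0 u) s = row_mx (- c u (rsubmx s)) (c u (lsubmx s)).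
Proof. by rewrite /conn_form row_mxKl row_mxKr 2!m0 sub0r add0r. Qed.

Lemma curvature_linear_aux (V W : lmodType R) (f : V -> W) a1 a2 a3 a4 a5 :
  linear f -> f (a1 - a2 + a3 + (a4 - a5)) = f a1 - f a2 + f a3 + (f a4 - f a5).
Proof. by move=> fl; rewrite 2!(linD fl) 2!(linB fl). Qed.

(** The trace needs the diagonal blocks only: this one and [curvature_r]. *)
Lemma curvature_l u : lsubmx (chart_curvature x (row_mx u 0) eta t) =
  dG u a p + dC u a p - dC u b q - (dG a u p + dC a u p)
  + c (g u b) q + (mm u (mm a p - c b q) - (mm a (mm u p) - c b (mm u q))).
Proof.
have E1 : lsubmx ('D_u (fun x => A x eta t) x) = dG u a p + dC u a p - dC u b q.
  by rewrite (derive_conn_form _ _ _ Ux) row_mxKl.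
have E2 : lsubmx ('D_a (fun x => A x (row_mx u 0) t) x) = dG a u p + dC a u p.
  rewrite (derive_conn_form _ _ _ Ux) row_mxKl row_mxKl row_mxKr.
  by rewrite (bf_derive0l _ _ bC Ux) subr0.
have g0 : g a 0 = 0 := lin0 (bf_linearr bG a Ux).
have E4 : lsubmx (A x (row_mx u 0) (A x eta t)) = mm u (mm a p - c b q).
  by rewrite conn_form_lblock row_mxKl /conn_form row_mxKl.
have E5 : lsubmx (A x eta (A x (row_mx u 0) t)) = mm a (mm u p) - c b (mm u q).
  by rewrite conn_form_lblock /conn_form row_mxKl row_mxKl row_mxKr.
have E3 : lsubmx (A x (row_mx 0 (g a 0 - g u b)) t) = c (g u b) q.
  rewrite conn_form_rblock row_mxKl g0 sub0r.
  by rewrite (linN (bf_linearl bC q Ux)) opprK.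
rewrite /chart_curvature row_mxKl row_mxKr.
apply: (etrans (curvature_linear_aux _ _ _ _ _ ll)).
exact: (congr2 +%R (congr2 +%R (congr2 (fun v w => v - w) E1 E2) E3)
  (congr2 (fun v w => v - w) E4 E5)).
Qed.

Lemma curvature_r u : rsubmx (chart_curvature x (row_mx 0 u) eta t) =
  - dC a u p + c (g a u) p
  + (c u (mm a p - c b q) - (mm a (c u p) - c b (c u q))).
Proof.
have E1 : rsubmx ('D_0 (fun x => A x eta t) x) = 0.
  have -> : 'D_0 (fun x => A x eta t) x = 0 by exact: derive0.
  exact: (lin0 rl).
have E2 : rsubmx ('D_a (fun x => A x (row_mx 0 u) t) x) = dC a u p.
  rewrite (derive_conn_form _ _ _ Ux) row_mxKr row_mxKl row_mxKr.
  by rewrite (bf_derive0l _ _ bC Ux) (bf_derive0l _ _ bG Ux) 2!add0r.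
have g0 : g 0 b = 0 := lin0 (bf_linearl bG b Ux).
have E4 : rsubmx (A x (row_mx 0 u) (A x eta t)) = c u (mm a p - c b q).
  by rewrite conn_form_rblock row_mxKr /conn_form row_mxKl.
have E5 : rsubmx (A x eta (A x (row_mx 0 u) t)) = mm a (c u p) - c b (c u q).
  rewrite conn_form_rblock /conn_form row_mxKr row_mxKl row_mxKr.
  by rewrite (linN (bf_linearr bC _ Ux)).
have E3 : rsubmx (A x (row_mx 0 (g a u - g 0 b)) t) = c (g a u) p.
  by rewrite conn_form_rblock row_mxKr g0 subr0.
rewrite -[- dC a u p]sub0r /chart_curvature row_mxKl row_mxKr.
apply: (etrans (curvature_linear_aux _ _ _ _ _ rl)).
exact: (congr2 +%R (congr2 +%R (congr2 (fun v w => v - w) E1 E2) E3)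
  (congr2 (fun v w => v - w) E4 E5)).
Qed.

(** (D_y C)(u, s). The argument [u] stands last because it is the one traced over. *)
Definition nablaC y s u : 'rV[R]_n :=
  dC y u s + g y (c u s) - c (g y u) s - c u (g y s).

Lemma curvature_trace_aux k (dga dgb d1 d2 d3 d4 ga gb gc1 gc2 cg1 cg2 cg3 cc1 cc2
   gc3 gc4 cg4 cg5 cc3 cc4 cg6 : 'rV[R]_k) :
  dga + ga = dgb + gb ->
  d1 + gc1 + cg1 + 2 *: cc1 = d2 + gc2 + cg2 + 2 *: cc2 ->
  d3 + gc3 + cg3 + 2 *: cc3 = d4 + gc4 + cg4 + 2 *: cc4 ->
  dga + d1 - d3 - (dgb + d2) + cg5
  + (ga + gc1 - gc3 + (cg1 + cc1 - cc3) - (gb + gc2 + (cg2 + cc2) - (cg4 + cc4)))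
  + (- d2 + cg6 + (cg1 + cc1 - cc3 - (gc2 + cc2 - cc4)))
  = - (d2 + gc2 - cg6 - cg1) - (d4 + gc4 - cg5 - cg3).
Proof.
move=> E1 E2 E3.
have -> : dga = dgb + gb - ga by rewrite -E1 addrK.
have -> : d1 = d2 + gc2 + cg2 + 2 *: cc2 - 2 *: cc1 - cg1 - gc1.
  by rewrite -E2; apply/rowP => i; rewrite !mxE; ring.
have -> : d3 = d4 + gc4 + cg4 + 2 *: cc4 - 2 *: cc3 - cg3 - gc3.
  by rewrite -E3; apply/rowP => i; rewrite !mxE; ring.
by apply/rowP => i; rewrite !mxE; ring.
Qed.

(** Flatness of [G] and of [C], the latter at [(u, a, p)] and [(u, b, q)], trades derivatives along
    [u] for derivatives along [a] and [b]. The terms quadratic in C then cancel between the two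
    blocks. *)
Lemma curvature_blocks u :
  lsubmx (chart_curvature x (row_mx u 0) eta t)
  + rsubmx (chart_curvature x (row_mx 0 u) eta t) =
  - nablaC a p u - nablaC b q u.
Proof.
rewrite curvature_l curvature_r.
have mE v w : mm v w = g v w + c v w := chartME G G' x v w.
have gl v : linear (g v) := bf_linearr bG v Ux.
have cl v : linear (c v) := bf_linearr bC v Ux.
rewrite !mE.
rewrite (linB (gl u)) (linD (gl u)) (linB (cl u)) (linD (cl u)).
rewrite (linD (gl a)) (linD (cl a)) (linD (cl b)).
rewrite /nablaC (sc_Gsym sc b u Ux : g b u = g u b).
exact: (curvature_trace_aux (c (g u b) q) (c (g a u) p) (sc_Gflat sc u a p Ux)
  (chartC_flat u a p Ux) (chartC_flat u b q Ux)).
Qed.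

(** After using the symmetry of C, two of the Christoffel terms cancel by cyclicity and the third is
    the trace of one C. The remaining term is the derivative of the trace of C, which is 0 at every
    point of [U]. *)
Lemma ltrace_nablaC y s : ltrace (nablaC y s) = 0.
Proof.
have cs v w : c v w = c w v := chartC_sym sc v w Ux.
have cl v : linear (c v) := bf_linearr bC v Ux.
have gl v : linear (g v) := bf_linearr bG v Ux.
have dE u : dC y u s = dC y s u.
  apply: near_eq_derive; apply: filterS (open_nbhs_nbhs (conj Uo Ux)) => x' Ux'.
  exact: (chartC_sym sc u s Ux').
have E u : nablaC y s u = dC y s u + g y (c s u) + (- c s (g y u)) + (- c (g y s) u).
  by rewrite /nablaC dE (cs u s) (cs (g y u) s) (cs u (g y s)).
have -> : ltrace (nablaC y s) = ltrace (fun u => dC y s u + g y (c s u) + (- c s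
  (g y u)) + (- c (g y s) u)).
  by apply: eq_bigr => i _; rewrite E.
rewrite 3!ltraceD 2!ltraceN.
have -> : ltrace (fun u => c (g y s) u) = 0 := ltrace_chartC sc (g y s) Ux.
rewrite (ltraceC (gl y) (cl s)) subr0 addrK.
have dCi i : differentiable (fun x => C x s (delta_mx 0 i)) x := bf_diff _ _ bC Ux.
have dCii i := differentiable_coef i (dCi i).
transitivity ('D_y (fun x => \sum_i C x s (delta_mx 0 i) 0 i) x).
  by rewrite (derive_bigsum y dCii); apply: eq_bigr => i _;
    rewrite (derive_coef y i (dCi i)).
have E0 : \forall x' \near x, \sum_i C x' s (delta_mx 0 i) 0 i = (fun _ => 0) x'.
  apply: filterS (open_nbhs_nbhs (conj Uo Ux)) => x' Ux'.
  exact: (ltrace_chartC sc s Ux').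
by rewrite (near_eq_derive y E0); exact: derive_cst.
Qed.

Lemma ltrace_curvature : ltrace (fun xi => chart_curvature x xi eta t) = 0.
Proof.
rewrite ltrace_split -ltraceD.
transitivity (ltrace (fun u => - nablaC a p u + - nablaC b q u)).
  by apply: eq_bigr => i _; rewrite curvature_blocks.
by rewrite ltraceD 2!ltraceN 2!ltrace_nablaC oppr0 addr0.
Qed.

End Trace.

(** Needed to apply cyclicity of the trace in [obata_ricci_flat]. *)
Lemma chart_curvature_linear x eta t : U x ->
  linear (fun xi => chart_curvature x xi eta t).
Proof.
move=> Ux; have ll := @lsubmx_is_linear R n n; have rl := @rsubmx_is_linear R n n.
have Al s := bf_linearl bA s Ux; have Ar s := bf_linearr bA s Ux.
have dA xi : differentiable (fun x => A x xi t) x := bf_diff xi t bA Ux.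
apply: linear_add_fun; last first.
  apply: linear_sub_fun; first exact: Al.
  exact: (linear_comp_fun (Al t) (Ar eta)).
apply: linear_add_fun.
  apply: linear_sub_fun.
    exact: (linear_comp_fun ll (linear_derive (bf_diff eta t bA Ux))).
  move=> k u v.
  have E : \forall y \near x, k *: A y u t + A y v t = A y (k *: u + v) t.
    apply: filterS (open_nbhs_nbhs (conj Uo Ux)) => y Uy.
    exact: (esym (bf_linearl bA t Uy k u v)).
  apply: (etrans (esym (near_eq_derive _ E))).
  have dk : differentiable (fun y => k *: A y u t) x by exact: differentiableZ.
  by rewrite (derive_add _ dk (dA v)) (derive_scale _ _ (dA u)).
apply: (linear_comp_fun _ (Al t)).
apply: (linear_comp_fun _ (@row_mx_linearr R n n)).
apply: linear_sub_fun.
  exact: (linear_comp_fun rl (bf_linearr bG _ Ux)).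
exact: (linear_comp_fun ll (bf_linearl bG (rsubmx eta) Ux)).
Qed.

End ChartCurvature.

(** * The tangent bundle *)

Section TangentBundle.
Context {R : realType} {n : nat} {N : atlas R n}.
Hypothesis mN : manifold N.
Implicit Types (a b c : chart N).

Local Notation TN := (tangent_bundle N).
Local Notation ll := (@lsubmx_is_linear R n n).
Local Notation rl := (@rsubmx_is_linear R n n).

Lemma coordT_l a (q : TN) : lsubmx (coord TN a q) = coord N a q.1.
Proof. exact: row_mxKl. Qed.

Lemma coordT_r a (q : TN) :
  rsubmx (coord TN a q) = change_chart (chart_at N q.1) a q.1 q.2.
Proof. exact: row_mxKr. Qed.

Lemma coordTK a (q : TN) : dom TN a q -> param TN a (coord TN a q) = q.
Proof.
case: q => p v /= ap; rewrite /= row_mxKl row_mxKr (coordK mN ap).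
by rewrite (change_inv mN _ (mem_chart_at mN p) ap).
Qed.

Lemma paramTK a z : cdom a setT (lsubmx z) -> coord TN a (param TN a z) = z.
Proof.
move=> /(cdomP mN) [ap _ E]; rewrite /= E.
by rewrite (change_inv mN _ ap (mem_chart_at mN _)) hsubmxK.
Qed.

Lemma cdomT a (W : set N) : cdom (N := TN) a (fun q => W q.1) =
  [set z : 'rV[R]_(n + n) | cdom a W (lsubmx z)].
Proof.
apply/seteqP; split=> [_ [q [aq Wq] <-] /=|z /= Wz].
  by rewrite row_mxKl; exact: cdom_coord.
have [ap Wp _] := cdomP mN Wz.
exists (param TN a z); first by split.
by apply: paramTK; apply: cdom_sub Wz.
Qed.

Lemma open_lsub (O : set 'rV[R]_n) : open O ->
  open [set z : 'rV[R]_(n + n) | O (lsubmx z)].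
Proof.
move=> Oo; apply: (open_comp _ Oo) => z _.
exact: differentiable_continuous (differentiable_linear z ll).
Qed.

Lemma open_overlapT a b : open (cdom (N := TN) a (dom TN b)).
Proof. by rewrite (cdomT a (dom N b)); apply: open_lsub; exact: (mopen_dom mN b). Qed.

Lemma transTE a b z : cdom a (dom N b) (lsubmx z) ->
  row_mx (trans a b (lsubmx z)) ('D_(rsubmx z) (trans a b) (lsubmx z)) =
  trans (N := TN) a b z.
Proof.
move=> /(cdomP mN) [ap bp E]; rewrite /trans /=; congr row_mx.
by rewrite (change_comp mN _ ap (mem_chart_at mN _) bp) /change_chart E.
Qed.

Lemma transT_family a b : linear_family (cdom a (dom N b)) (fun x u => 'D_u
  (trans a b) x).
Proof.
split=> [x ab|u]; last by apply: smooth_derive; exact: (trans_smooth mN a b).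
by apply: linear_derive; exact: (smooth_diff (trans_smooth mN a b) ab).
Qed.

Lemma transT_smooth a b :
  smooth_on (cdom (N := TN) a (dom TN b)) (trans (N := TN) a b).
Proof.
have Vo := @open_overlapT a b; rewrite (cdomT a (dom N b)) in Vo *.
apply: (smooth_ext Vo (@transTE a b)).
have sl := smooth_lsub Vo (@smooth_id _ _ [set z : 'rV[R]_(n + n) | cdom a (dom N
  b) (lsubmx z)]).
have sr := smooth_rsub Vo (@smooth_id _ _ [set z : 'rV[R]_(n + n) | cdom a (dom N
  b) (lsubmx z)]).
apply: (smooth_row_mx Vo).
  exact: (smooth_comp Vo _ sl (trans_smooth mN a b)).
exact: (linear_family_smooth Vo _ sl (transT_family a b) sr).
Qed.

Lemma mopenT_fst (W : set N) : mopen W -> mopen (N := TN) (fun q => W q.1).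
Proof.
move=> Wo a; have := cdomT a W; rewrite /cdom => ->.
by apply: open_lsub; exact: Wo.
Qed.

Lemma mopenT_chart a (O : set 'rV[R]_(n + n)) : open O ->
  mopen (N := TN) (fun q => dom N a q.1 /\ O (coord TN a q)).
Proof.
move=> Oo b; rewrite openE => _ [q [bq [aq Oq]] <-].
have Vo := @open_overlapT b a.
have Vq : cdom (N := TN) b (dom TN a) (coord TN b q) by exact: cdom_coord.
have cO : \forall z \near coord TN b q, O (trans (N := TN) b a z).
  have ct := differentiable_continuous (smooth_diff (@transT_smooth b a) Vq).
  apply: ct; apply: open_nbhs_nbhs; split; first exact: Oo.
  by rewrite /trans coordTK.
apply: filterS2 (open_nbhs_nbhs (conj Vo Vq)) cO => _ [q' [bq' aq'] <-] Oq'.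
exists q'; last exact: erefl.
have E := coordTK bq'; rewrite /trans E in Oq'.
by split; [exact: bq' | split; [exact: aq' | exact: Oq']].
Qed.

(** Distinct base points are separated by preimages of open sets of N; two vectors at one point
    share a chart, and their coordinates are separated there. *)
Lemma hausdorffT (p q : TN) : p <> q -> exists V W : set TN,
  [/\ mopen V, mopen W, V p, W q & V `&` W = set0].
Proof.
case: (pselect (p.1 = q.1)) => [E|pq _]; last first.
  have [V [W [oV oW Vp Wq VW]]] := hausdorff mN pq.
  exists (fun q => V q.1), (fun q => W q.1); split=> //; try exact: mopenT_fst.
  by apply/seteqP; split=> // q' [Vq Wq']; have : (V `&` W) q'.1 by []; rewrite VW.
move=> pq; pose a := chart_at N p.1.
have ap : dom TN a p := mem_chart_at mN p.1.
have aq : dom TN a q by rewrite /= -E.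
have zpq : coord TN a p != coord TN a q.
  by apply/eqP => Ez; apply: pq; rewrite -(coordTK ap) -(coordTK aq) Ez.
have := @norm_hausdorff R 'rV[R]_(n + n); rewrite open_hausdorff.
move=> /(_ _ _ zpq) [[A B] /= [Ap Bq] [oA oB /eqP AB]].
exists (fun q => dom N a q.1 /\ A (coord TN a q)), (fun q => dom N a q.1 /\ B
  (coord TN a q)).
split; try exact: mopenT_chart.
- by split=> //; rewrite inE in Ap.
- by split=> //; rewrite inE in Bq.
apply/seteqP; split=> // q' [[_ Aq'] [_ Bq']].
by have : (A `&` B) (coord TN a q') by []; rewrite AB.
Qed.

Lemma manifoldT : manifold TN.
Proof.
split.
- by move=> p; exact: (mem_chart_at mN p.1).
- exact: coordTK.
- exact: open_overlapT.
- exact: transT_smooth.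
- exact: hausdorffT.
- have [A [cA Acov]] := countable_cover mN; exists A; split=> // p.
  exact: Acov.
Qed.

Definition pair_change a b p (s : 'rV[R]_(n + n)) : 'rV[R]_(n + n) :=
  row_mx (change_chart a b p (lsubmx s)) (change_chart a b p (rsubmx s)).

(** Differentiating the fibre part of the transition, itself a derivative of [trans a b], yields a
    Hessian; [frame_change] cancels it against the one in [chris_change]. *)
Lemma changeT a b (q : TN) W : dom N a q.1 -> dom N b q.1 ->
  change_chart (N := TN) a b q W =
  row_mx (change_chart a b q.1 (lsubmx W))
    ('D_(lsubmx W) ('D_(rsubmx (coord TN a q)) (trans a b)) (coord N a q.1)
     + change_chart a b q.1 (rsubmx W)).
Proof.
move=> aq bq; set z := coord TN a q.
have Uz : cdom a (dom N b) (lsubmx z) by rewrite coordT_l; exact: cdom_coord.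
have Vo : open [set z : 'rV[R]_(n + n) | cdom a (dom N b) (lsubmx z)].
  by apply: open_lsub; exact: (mopen_dom mN b).
have Uo : open (cdom a (dom N b)) by exact: (mopen_dom mN b).
have dl := differentiable_linear z ll; have dr := differentiable_linear z rl.
have [dt Dt] := linear_family_derive Uo Uz dl W (transT_family a b) dr.
have dt1 := smooth_diff (trans_smooth mN a b) Uz.
have dt1' : differentiable (fun y : 'rV[R]_(n + n) => trans a b (lsubmx y)) z.
  exact: (differentiable_comp dl dt1).
have [_ Drow] := row_mx_derive W dt1' dt.
have E : \forall y \near z, row_mx (trans a b (lsubmx y))
    ('D_(rsubmx y) (trans a b) (lsubmx y)) = trans (N := TN) a b y.
  by apply: filterS (open_nbhs_nbhs (conj Vo Uz)) => y; exact: transTE.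
apply: (etrans (esym (near_eq_derive W E))); apply: (etrans Drow).
rewrite (derive_comp W dl dt1) Dt (derive_linear _ _ ll) (derive_linear _ _ rl).
by rewrite /z coordT_l.
Qed.

End TangentBundle.

Lemma add_sub_cancel_aux (V : zmodType) (d u v : V) : d + u + (v - d) = u + v.
Proof. by rewrite addrC addrA subrK addrC. Qed.

Lemma row_mx_sub (R : realType) m k (u u' : 'rV[R]_m) (v v' : 'rV[R]_k) :
  row_mx u v - row_mx u' v' = row_mx (u - u') (v - v').
Proof. by rewrite opp_row_mx add_row_mx. Qed.

Lemma conn_form_row (R : realType) n G G' x (u1 u2 s1 s2 : 'rV[R]_n) :
  conn_form G G' x (row_mx u1 u2) (row_mx s1 s2) =
  row_mx (chartM G G' x u1 s1 - chartC G G' x u2 s2)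
         (chartM G G' x u1 s2 + chartC G G' x u2 s1).
Proof. by rewrite /conn_form !row_mxKl !row_mxKr. Qed.

Lemma half_sum_aux (R : realType) m k (f : 'rV[R]_m -> 'rV[R]_k) x y d : linear f ->
  2^-1 *: (f x - d) + 2^-1 *: (f y - d) = f (2^-1 *: x + 2^-1 *: y) - d.
Proof.
move=> fl; rewrite (linD fl) 2!(linZ fl).
by apply/rowP => i; rewrite !mxE; field.
Qed.

Lemma half_diff_aux (R : realType) m k (f : 'rV[R]_m -> 'rV[R]_k) x y d : linear f ->
  2^-1 *: (f x - d) + (- 2^-1) *: (f y - d) = f (2^-1 *: x + (- 2^-1) *: y).
Proof.
move=> fl; rewrite (linD fl) 2!(linZ fl).
by apply/rowP => i; rewrite !mxE; ring.
Qed.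

(** * Independence of the chart *)

Section SpecialManifold.
Context {R : realType} {n : nat} {N : atlas R n}.
Variables (J : N -> 'rV[R]_n -> 'rV[R]_n)
  (D : N -> 'rV[R]_n -> (N -> 'rV[R]_n) -> 'rV[R]_n).
Hypothesis sm : special_complex_manifold J D.
Implicit Types (a b c : chart N).

Let mN := special_manifold sm.
Let cD := special_connection sm.
Let cD' := conj_connection sm.
Let sJ := complex_endo (special_complex sm).

Local Notation TN := (tangent_bundle N).
Local Notation D' := (conj_conn J D).

Lemma special_chart_chris a :
  special_chart (cdom a setT) (chris D a) (chris D' a) (endo_chart J a).
Proof.
have bf E (cE : connection E) : bilinear_family (cdom a setT) (chris E a).
  split=> [x v /(cdomP mN) [ap _ <-]|x u /(cdomP mN) [ap _ <-]|u v].
  - exact: chris_linearl.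
  - exact: chris_linearr.
  - exact: chris_smooth.
split.
- exact: (@mopenT _ _ _ mN a).
- exact: bf.
- exact: bf.
- split=> [x /(cdomP mN) [ap _ <-]|u]; first exact: endo_chart_linear.
  exact: endo_chart_smooth.
- move=> x u v /(cdomP mN) [ap _ <-].
  exact: (chris_sym mN u v (special_torsion_free sm) ap).
- move=> x u v /(cdomP mN) [ap _ <-].
  exact: (chris_sym mN u v (conj_torsion_free sm) ap).
- move=> x u v w /(cdomP mN) [ap _ <-].
  exact: (chris_flat mN cD u v w (special_flat sm) ap).
- move=> x u v w /(cdomP mN) [ap _ <-].
  exact: (chris_flat mN cD' u v w (conj_flat sm) ap).
- move=> x u /(cdomP mN) [ap _ <-].
  move: (param N a x) ap => {x} p ap; have cp := mem_chart_at mN p.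
  have E w := esym (endo_chartE mN J w ap).
  (* J^2 = -1 is known in the preferred chart at [p], so [u] is first carried there. *)
  have [w uE] : exists w, u = change_chart (chart_at N p) a p w.
    exists (change_chart a (chart_at N p) p u).
    exact: (esym (change_inv mN u ap cp)).
  rewrite uE (E w) (E (J p w)) (complex_sq (special_complex sm)).
  exact: (linN (change_linear mN cp ap)).
- move=> x u v /(cdomP mN) [ap _ <-]; exact: (chris_endo sm u v ap).
- move=> x u v /(cdomP mN) [ap _ <-]; exact: (chris_conj_endo sm u v ap).
Qed.

Section ChangeOfChart.
Variables (a b : chart N) (q : TN).
Hypotheses (aq : dom N a q.1) (bq : dom N b q.1).

Local Notation ch := (change_chart a b q.1).
Local Notation chT := (pair_change a b q.1).
Local Notation za := (coord TN a q).
Local Notation zb := (coord TN b q).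
Local Notation ll := (@lsubmx_is_linear R n n).
Local Notation rl := (@rsubmx_is_linear R n n).

Lemma frame_change W :
  frame (chris D b) zb (change_chart (N := TN) a b q W) =
  chT (frame (chris D a) za W).
Proof.
have chl := change_linear mN aq bq.
have Er : rsubmx zb = ch (rsubmx za).
  apply: (etrans (coordT_r b q)).
  apply: (etrans (esym (change_comp mN q.2 (mem_chart_at mN q.1) aq bq))).
  exact: (congr1 ch (esym (coordT_r a q))).
have Eg : chris D b (lsubmx zb) (ch (lsubmx W)) (rsubmx zb) =
    ch (chris D a (lsubmx za) (lsubmx W) (rsubmx za))
    - 'D_(lsubmx W) ('D_(rsubmx za) (trans a b)) (coord N a q.1).
  apply: (etrans (congr2 (fun x v => chris D b x (ch (lsubmx W)) v) (coordT_l b q) Er)).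
  apply: (etrans (chris_change mN cD (lsubmx W) (rsubmx za) aq bq)).
  exact: (congr1 (fun x => ch (chris D a x (lsubmx W) (rsubmx za)) - _) (esym
    (coordT_l a q))).
apply: (etrans (congr1 (frame _ zb) (changeT mN W aq bq))).
rewrite /frame row_mxKl row_mxKr;
  apply: (etrans (congr1 (fun v => row_mx _ (_ + v)) Eg)).
rewrite /pair_change row_mxKl row_mxKr; apply: (congr1 (row_mx _)).
by rewrite (linD chl); exact: add_sub_cancel_aux.
Qed.

Lemma coframe_change s :
  change_chart (N := TN) a b q (coframe (chris D a) za s) =
  coframe (chris D b) zb (chT s).
Proof.
rewrite -[LHS](frameK (chris D b) zb); apply: (congr1 (coframe _ _)).
apply: (etrans (frame_change _)); apply: (congr1 chT); exact: coframeK.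
Qed.

(** The weights add up to 1, so the mean keeps the full Hessian; in [chartC_change] they add up to 0
    and it disappears. *)
Lemma chartM_change u v :
  chartM (chris D b) (chris D' b) (coord N b q.1) (ch u) (ch v) =
  ch (chartM (chris D a) (chris D' a) (coord N a q.1) u v)
  - 'D_u ('D_v (trans a b)) (coord N a q.1).
Proof.
have chl := change_linear mN aq bq.
have E := chris_change mN cD u v aq bq.
have E' := chris_change mN cD' u v aq bq.
apply: (etrans (congr2 (fun x y => 2^-1 *: x + 2^-1 *: y) E E')).
exact: half_sum_aux.
Qed.

Lemma chartC_change u v :
  chartC (chris D b) (chris D' b) (coord N b q.1) (ch u) (ch v) =
  ch (chartC (chris D a) (chris D' a) (coord N a q.1) u v).
Proof.
have chl := change_linear mN aq bq.
have E := chris_change mN cD' u v aq bq.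
have E' := chris_change mN cD u v aq bq.
apply: (etrans (congr2 (fun x y => 2^-1 *: x + (- 2^-1) *: y) E E')).
exact: half_diff_aux.
Qed.

Lemma conn_form_change xi s :
  conn_form (chris D b) (chris D' b) (coord N b q.1) (chT xi) (chT s) =
  chT (conn_form (chris D a) (chris D' a) (coord N a q.1) xi s)
  - row_mx ('D_(lsubmx xi) ('D_(lsubmx s) (trans a b)) (coord N a q.1))
           ('D_(lsubmx xi) ('D_(rsubmx s) (trans a b)) (coord N a q.1)).
Proof.
have chl := change_linear mN aq bq.
apply: (etrans (conn_form_row _ _ _ (ch (lsubmx xi)) (ch (rsubmx xi))
  (ch (lsubmx s)) (ch (rsubmx s)))).
have E : chT (conn_form (chris D a) (chris D' a) (coord N a q.1) xi s) =
  row_mx (ch _) (ch _) := congr2 row_mx (congr1 ch (row_mxKl _ _)) (congr1 ch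
    (row_mxKr _ _)).
apply: esym; apply: (etrans (congr1 (fun v => v - _) E)).
apply: (etrans (row_mx_sub _ _ _ _)); apply: esym; apply: (congr2 row_mx).
  apply: (etrans (congr2 (fun x y => x - y) (chartM_change _ _) (chartC_change _ _))).
  apply: (etrans (addrAC _ _ _)); apply: (congr1 (fun x => x - _)).
  exact: (esym (linB chl _ _)).
apply: (etrans (congr2 (fun x y => x + y) (chartM_change _ _) (chartC_change _ _))).
apply: (etrans (addrAC _ _ _)); apply: (congr1 (fun x => x - _)).
exact: (esym (linD chl _ _)).
Qed.

Lemma components_frame_change (Y : TN -> 'rV[R]_(n + n)) :
  frame (chris D b) zb (components (N := TN) b Y zb) =
  chT (frame (chris D a) za (components (N := TN) a Y za)).
Proof.
have mT := manifoldT mN; have qa : dom TN a q := aq; have qb : dom TN b q := bq.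
apply: (etrans (congr1 (frame _ zb) (components_change mT Y qa qb))).
exact: frame_change.
Qed.

Lemma pair_change_linear : linear chT.
Proof.
have chl := change_linear mN aq bq.
apply: linear_row_mx => k u v; first by rewrite ll chl.
by rewrite rl chl.
Qed.

End ChangeOfChart.

(** On the pullback bundle the transition is [pair_change], which varies with the base point. Its
    derivative contributes exactly the Hessians that [conn_form_change] subtracts. *)
Lemma chart_obata_change a b (q : TN) (Y : TN -> 'rV[R]_(n + n)) W :
  dom N a q.1 -> dom N b q.1 -> smooth_field_near q Y ->
  change_chart (N := TN) a b q (chart_obata (chris D a) (chris D' a)
    (components (N := TN) a Y) (coord TN a q) W) =
  chart_obata (chris D b) (chris D' b) (components (N := TN) b Y) (coord TN b q)
    (change_chart (N := TN) a b q W).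
Proof.
move=> aq bq sY; have mT := manifoldT mN.
have qa : dom TN a q := aq; have qb : dom TN b q := bq.
pose za := coord TN a q; pose zb := coord TN b q.
have ll := @lsubmx_is_linear R n n.
rewrite /chart_obata (coframe_change aq bq); apply: (congr1 (coframe (chris D b) zb)).
have Uza : cdom a setT (lsubmx za) by rewrite coordT_l; exact: cdom_coord.
have Uzb : cdom b setT (lsubmx zb) by rewrite coordT_l; exact: cdom_coord.
have Uab : cdom a (dom N b) (lsubmx za) by rewrite coordT_l; exact: cdom_coord.
have Uabo : open (cdom a (dom N b)) by exact: (mopen_dom mN b).
have sca := special_chart_chris a; have scb := special_chart_chris b.
have dYa := components_diff qa sY; have dYb := components_diff qb sY.
pose ta y := frame (chris D a) y (components (N := TN) a Y y).
pose tb y := frame (chris D b) y (components (N := TN) b Y y).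
have dta : differentiable ta za := (frame_derive sca Uza 0 dYa).1.
have dtb : differentiable tb zb := (frame_derive scb Uzb 0 dYb).1.
have tbE : \forall y \near za, tb (trans (N := TN) a b y) =
    row_mx ('D_(lsubmx (ta y)) (trans a b) (lsubmx y))
           ('D_(rsubmx (ta y)) (trans a b) (lsubmx y)).
  apply: filterS (cdom_near (mopen_dom mT b) qa qb) => _ [q' [aq' bq'] <-].
  rewrite (trans_coord mT b aq') (coordT_l a q').
  exact: (components_frame_change aq' bq' Y).
have dT : differentiable (trans (N := TN) a b) za := trans_diff mT qa qb.
have dl := differentiable_linear za ll; have Dl := derive_linear za W ll.
have tf := transT_family mN a b.
have [d1 D1] := linear_family_derive Uabo Uab dl W tf (differentiable_lsub dta).
have [d2 D2] := linear_family_derive Uabo Uab dl W tf (differentiable_rsub dta).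
have [_ D12] := row_mx_derive W d1 d2.
have Dtb : 'D_(change_chart (N := TN) a b q W) tb zb =
    row_mx ('D_(lsubmx W) ('D_(lsubmx (ta za)) (trans a b)) (coord N a q.1))
           ('D_(lsubmx W) ('D_(rsubmx (ta za)) (trans a b)) (coord N a q.1))
    + pair_change a b q.1 ('D_W ta za).
  apply: (etrans (esym (derive_comp_eq W (trans_coord mT b qa) dT dtb))).
  apply: (etrans (near_eq_derive W tbE)); apply: (etrans D12).
  rewrite Dl (coordT_l a q) in D1 D2.
  rewrite D1 D2 (derive_lsub W dta) (derive_rsub W dta).
  exact: (esym (add_row_mx _ _ _ _)).
have tbza : tb zb = pair_change a b q.1 (ta za) := components_frame_change aq bq Y.
have cfE : conn_form (chris D b) (chris D' b) (lsubmx zb)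
    (frame (chris D b) zb (change_chart (N := TN) a b q W)) (tb zb) =
    pair_change a b q.1 (conn_form (chris D a) (chris D' a) (lsubmx za)
      (frame (chris D a) za W) (ta za))
    - row_mx ('D_(lsubmx W) ('D_(lsubmx (ta za)) (trans a b)) (coord N a q.1))
           ('D_(lsubmx W) ('D_(rsubmx (ta za)) (trans a b)) (coord N a q.1)).
  apply: (etrans (congr2 (fun v w => conn_form _ _ (lsubmx zb) v w)
    (frame_change aq bq W) tbza)).
  apply: (etrans (congr1 (fun x => conn_form _ _ x _ _) (coordT_l b q))).
  apply: (etrans (conn_form_change aq bq _ _)).
  apply: (congr2 (fun v w => v - w)).
    exact: (congr1 (fun x => pair_change a b q.1 (conn_form _ _ x _ _)) (esym
      (coordT_l a q))).
  exact: (congr1 (fun w => row_mx ('D_w _ _) ('D_w _ _)) (frame_l (chris D a) za W)).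
apply: esym; apply: (etrans (congr2 +%R Dtb cfE)).
apply: (etrans (add_sub_cancel_aux _ _ _)).
exact: (esym (linD (pair_change_linear aq bq) _ _)).
Qed.

End SpecialManifold.

(** * The Obata connection *)

Section ParallelStructures.
Context {R : realType} {n : nat} {N : atlas R n}.
Hypothesis mN : manifold N.
Implicit Types (I : N -> 'rV[R]_n -> 'rV[R]_n) (X Y : N -> 'rV[R]_n).

(** Torsion-freeness turns the four brackets into covariant derivatives; moving I out of them makes
    the Nijenhuis expression cancel. *)
Lemma integrable_of_parallel E I : connection E -> torsion_free E ->
  smooth_endo I -> (forall p v, I p (I p v) = - v) -> parallel_endo E I ->
  integrable_complex_structure I.
Proof.
move=> cE tE sI II pI; split=> // p X Y sX sY.
have Il := endo_linear sI p.
have sIX := smooth_field_near_endo sI sX; have sIY := smooth_field_near_endo sI sY.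
have P v Z : smooth_field_near p Z -> E p v (fun q => I q (Z q)) = I p (E p v Z).
  by move=> sZ; apply/eqP; rewrite -subr_eq0; apply/eqP; exact: (pI p v Z sZ).
have B1 := tE p _ _ sIX sIY; have B2 := tE p _ _ sIX sY.
have B3 := tE p _ _ sX sIY; have B4 := tE p _ _ sX sY.
rewrite (P _ _ sX) (P _ _ sY) in B1; rewrite (P _ _ sX) in B2; rewrite (P _ _ sY) in B3.
rewrite /nijenhuis -B1 -B2 -B3 -B4 2!(linB Il) 2!II.
by apply/rowP => i; rewrite !mxE; ring.
Qed.

(** The difference S is symmetric and commutes with I1 and I2 in its second slot, hence in both.
    Inserting I1 in one slot and I2 in the other gives I1 I2 S = I2 I1 S, so I3 S is its own
    opposite. *)
Lemma hypercomplex_connection_unique I1 I2 I3 E E' :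
  smooth_endo I1 -> smooth_endo I2 ->
  (forall p v, I1 p (I1 p v) = - v) -> (forall p v, I2 p (I2 p v) = - v) ->
  (forall p v, I1 p (I2 p v) = I3 p v) -> (forall p v, - I2 p (I1 p v) = I3 p v) ->
  hypercomplex_connection I1 I2 I3 E -> hypercomplex_connection I1 I2 I3 E' ->
  forall p v Y, smooth_field_near p Y -> E' p v Y = E p v Y.
Proof.
move=> sI1 sI2 II1 II2 I12 I21 [cE [tE [p1 p2 _]]] [cE' [tE' [p1' p2' _]]] p v Y sY.
pose S w Z := E' p w Z - E p w Z.
(* [v] is extended to a field because the symmetry of S compares two fields. *)
pose X := coord_field (chart_at N p) v.
have sX : smooth_field_near p X := coord_field_near mN v (mem_chart_at mN p).
have Xp : X p = v := coord_field_at mN v p.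
have Ssym Z Z' : smooth_field_near p Z -> smooth_field_near p Z' ->
    S (Z p) Z' = S (Z' p) Z.
  by move=> sZ sZ'; apply: sub_eq_swap; rewrite (tE' p _ _ sZ sZ') (tE p _ _ sZ sZ').
have SI I w Z : smooth_endo I -> parallel_endo E I -> parallel_endo E' I ->
    smooth_field_near p Z -> S w (fun q => I q (Z q)) = I p (S w Z).
  move=> sI pI pI' sZ; rewrite /S (linB (endo_linear sI p)).
  by rewrite -(subr0_eq (pI p w Z sZ)) -(subr0_eq (pI' p w Z sZ)).
have sI1X := smooth_field_near_endo sI1 sX; have sI2Y := smooth_field_near_endo sI2 sY.
have A1 : S (I1 p (X p)) (fun q => I2 q (Y q)) = I2 p (I1 p (S (X p) Y)).
  rewrite (SI I2 _ Y sI2 p2 p2' sY) (Ssym _ _ sI1X sY) (SI I1 _ X sI1 p1 p1' sX).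
  by rewrite (Ssym _ _ sY sX).
have A2 : S (I1 p (X p)) (fun q => I2 q (Y q)) = I1 p (I2 p (S (X p) Y)).
  rewrite (Ssym _ _ sI1X sI2Y) (SI I1 _ X sI1 p1 p1' sX) -(Ssym _ _ sX sI2Y).
  by rewrite (SI I2 _ Y sI2 p2 p2' sY).
have S3 : I3 p (S (X p) Y) = 0.
  have H : I3 p (S (X p) Y) = - I3 p (S (X p) Y).
    by rewrite -{2}I21 opprK -A1 A2 I12.
  move: (I3 p _) H => w H; apply/rowP => i; have /rowP/(_ i) := H.
  by rewrite !mxE => ?; lra.
have S0 : S (X p) Y = 0.
  have H2 : I2 p (S (X p) Y) = 0.
    by apply: oppr_inj; rewrite oppr0 -(II1 p) I12 S3 (lin0 (endo_linear sI1 p)).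
  by apply: oppr_inj; rewrite oppr0 -(II2 p) H2 (lin0 (endo_linear sI2 p)).
by rewrite -Xp; exact: (subr0_eq S0).
Qed.

End ParallelStructures.


(** * The connection on the total space *)

Section ObataConnection.
Context {R : realType} {n : nat} {N : atlas R n}.
Variables (J : N -> 'rV[R]_n -> 'rV[R]_n)
  (D : N -> 'rV[R]_n -> (N -> 'rV[R]_n) -> 'rV[R]_n).
Hypothesis sm : special_complex_manifold J D.
Implicit Types (a b c : chart N).

Let mN := special_manifold sm.
Let sJ := complex_endo (special_complex sm).
Let mT := manifoldT mN.

Local Notation TN := (tangent_bundle N).
Local Notation D' := (conj_conn J D).
Local Notation Ga a := (chris D a).
Local Notation Ob a := (chart_obata (chris D a) (chris D' a)).
Local Notation cat q := (chart_at N q.1).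
Implicit Types (q : TN) (X Y Z : TN -> 'rV[R]_(n + n)) (V : set TN).

Let sca := special_chart_chris sm.

Let domT_sub a V z : cdom (N := TN) a V z -> cdom a setT (lsubmx z).
Proof. by case=> q [aq _] <-; rewrite coordT_l; exact: cdom_coord. Qed.

Let at_dom q : dom TN (cat q) q := mem_chart_at mN q.1.

(** Computed in the preferred chart, where tangent vectors at [q] are represented; by [obata_chartE]
    every other chart gives the same vector. *)
Definition obata q W Y : 'rV[R]_(n + n) :=
  Ob (cat q) (components (N := TN) (cat q) Y) (coord TN (cat q) q) W.

Lemma obata_chartE b q W Y : dom TN b q -> smooth_field_near q Y ->
  change_chart (N := TN) (cat q) b q (obata q W Y) =
  Ob b (components (N := TN) b Y) (coord TN b q) (change_chart (N := TN) (cat q) b q W).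
Proof. by move=> bq sY; exact: (chart_obata_change sm W (at_dom q) bq sY). Qed.

Let Uat q : cdom (cat q) setT (lsubmx (coord TN (cat q) q)).
Proof. by rewrite coordT_l; apply: cdom_coord; [exact: mem_chart_at | by []]. Qed.

Lemma components_obata b X Y q : dom TN b q -> smooth_field_near q Y ->
  components (N := TN) b (fun q => obata q (X q) Y) (coord TN b q) =
  Ob b (components (N := TN) b Y) (coord TN b q) (components (N := TN) b X (coord
    TN b q)).
Proof.
move=> bq sY; apply: (etrans (componentsE mT _ bq)).
apply: (etrans (obata_chartE (X q) bq sY)).
exact: (congr1 (Ob b _ _) (esym (componentsE mT X bq))).
Qed.

Lemma obata_connection_axioms : connection obata.
Proof.
split.
- move=> q Y sY; exact: (chart_obata_linear (sca (cat q)) (Uat q)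
  (components_diff (at_dom q) sY)).
- move=> q v Y Z sY sZ; have dY := components_diff (at_dom q) sY.
  have dZ := components_diff (at_dom q) sZ.
  rewrite /obata -(chart_obata_add (sca (cat q)) (Uat q) v dY dZ).
  have [V [oV Vq _]] := sY.
  apply: chart_obata_near.
  apply: filterS (cdom_near oV (at_dom q) Vq) => _ [q' [aq' _] <-].
  rewrite 3!(componentsE mT _ aq').
  exact: (linD (change_linear mT (mem_chart_at mT q') aq')).
- move=> q v f Y [V [oV Vq sf]] sY; have dY := components_diff (at_dom q) sY.
  have df : differentiable (f \o param TN (cat q)) (coord TN (cat q) q).
    by apply: (smooth_diff (sf (cat q))); exact: cdom_coord.
  have Yq := components_at mT Y q.
  have fq : f (param TN (cat q) (coord TN (cat q) q)) = f q by rewrite (coordK mT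
    (at_dom q)).
  have := chart_obata_scale (sca (cat q)) (Uat q) v df dY.
  rewrite /= in Yq fq *; rewrite Yq fq => E; apply: (etrans _ E).
  apply: chart_obata_near.
  apply: filterS (cdom_near oV (at_dom q) Vq) => _ [q' [aq' _] <-].
  rewrite 2!(componentsE mT _ aq').
  apply: (etrans (linZ (change_linear mT (mem_chart_at mT q') aq') _ _)).
  exact: (congr1 (fun k => k *: _) (congr1 f (esym (coordK mT aq')))).
- move=> q v Y Z V oV Vq sY YZ; apply: chart_obata_near.
  exact: (near_components mT oV Vq (at_dom q) YZ).
- move=> V X Y oV sX sY b; have oVb := oV b.
  (* The preferred chart may jump from point to point; in the fixed chart [b] a single smooth
     formula holds. *)
  have E z : cdom (N := TN) b V z -> Ob b (components (N := TN) b Y) z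
    (components (N := TN) b X z) =
      components (N := TN) b (fun q => obata q (X q) Y) z.
    move=> [q [bq Vq] <-]; apply: esym; apply: components_obata => //.
    by exists V.
  apply: (smooth_ext oVb E).
  exact: (chart_obata_smooth (sca b) oVb (@domT_sub b V) (sY b) (sX b)).
Qed.

Lemma obata_torsion_free : torsion_free obata.
Proof.
move=> q X Y sX sY; have dX := components_diff (at_dom q) sX.
have dY := components_diff (at_dom q) sY.
have := chart_obata_torsion (sca (cat q)) (Uat q) dX dY.
have EX := components_at mT X q; have EY := components_at mT Y q.
by rewrite /= in EX EY *; rewrite EX EY.
Qed.

(** * Endomorphisms of TM induced from the pullback bundle *)

Section AdaptedEndomorphism.
Variables (I : TN -> 'rV[R]_(n + n) -> 'rV[R]_(n + n))
  (B : chart N -> 'rV[R]_n -> 'rV[R]_(n + n) -> 'rV[R]_(n + n)).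
Hypothesis B_family : forall a, linear_family (cdom a setT) (B a).
Hypothesis B_change : forall a b p s, dom N a p -> dom N b p ->
  B b (coord N b p) (pair_change a b p s) = pair_change a b p (B a (coord N a p) s).
Hypothesis IB : forall q W, I q W =
  chart_endo (Ga (cat q)) (B (cat q)) (coord TN (cat q) q) W.
Hypothesis B_deriv : forall a z s W, cdom a setT (lsubmx z) -> differentiable s z ->
  frame_deriv (chris D a) (chris D' a) (fun y => B a (lsubmx y) (s y)) z W =
  B a (lsubmx z) (frame_deriv (chris D a) (chris D' a) s z W).

Lemma adapted_chartE b q W : dom TN b q ->
  change_chart (N := TN) (cat q) b q (I q W) =
  chart_endo (Ga b) (B b) (coord TN b q) (change_chart (N := TN) (cat q) b q W).
Proof.
move=> bq; have aq := mem_chart_at mN q.1; set a := cat q in aq *.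
apply: (etrans (congr1 (change_chart (N := TN) a b q) (IB q W))).
apply: (etrans (coframe_change sm aq bq _)); apply: (congr1 (coframe _ _)).
apply: (etrans (congr1 (fun x => pair_change a b q.1 (B a x _)) (coordT_l a q))).
apply: (etrans (esym (B_change _ aq bq))); apply: esym.
apply: (etrans (congr1 (fun x => B b x _) (coordT_l b q))).
exact: (congr1 (B b _) (frame_change sm aq bq W)).
Qed.

Lemma adapted_components b X q : dom TN b q ->
  components (N := TN) b (fun q => I q (X q)) (coord TN b q) =
  chart_endo (Ga b) (B b) (coord TN b q) (components (N := TN) b X (coord TN b q)).
Proof.
move=> bq; apply: (etrans (componentsE mT _ bq)).
apply: (etrans (adapted_chartE (X q) bq)).
exact: (congr1 (chart_endo _ _ _) (esym (componentsE mT X bq))).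
Qed.

Lemma adapted_smooth : smooth_endo (N := TN) I.
Proof.
split=> [q k W W'|V X oV sX b].
  have cl := coframe_linear (sca (cat q)) (Uat q).
  have fl := frame_linear (sca (cat q)) (Uat q).
  have Bl := lf_linear (B_family (cat q)) (Uat q).
  by rewrite 3!IB /chart_endo fl Bl cl.
have oVb := oV b.
have E z : cdom (N := TN) b V z ->
    chart_endo (Ga b) (B b) z (components (N := TN) b X z) =
    components (N := TN) b (fun q => I q (X q)) z.
  by move=> [q [bq Vq] <-]; apply: esym; exact: adapted_components.
apply: (smooth_ext oVb E).
exact: (chart_endo_smooth (sca b) oVb (@domT_sub b V) (B_family b) (sX b)).
Qed.

Lemma adapted_parallel : parallel_endo (N := TN) obata I.
Proof.
move=> q W Y sY; have [V [oV Vq _]] := sY; apply/eqP; rewrite subr_eq0; apply/eqP.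
set c := cat q; have dY := components_diff (at_dom q) sY.
rewrite IB; apply: (etrans _ (chart_obata_endo (sca c) (Uat q) W _ dY)); last first.
  by move=> s W' ds; exact: (B_deriv W' (Uat q) ds).
apply: chart_obata_near.
apply: filterS (cdom_near oV (at_dom q) Vq) => _ [q' [cq' _] <-].
exact: adapted_components.
Qed.

End AdaptedEndomorphism.

Lemma christoffelE q u : christoffel D q u = chris D (cat q) (coord N (cat q)
  q.1) u q.2.
Proof.
by rewrite /chris (components_at mN) (coord_field_at mN).
Qed.

Lemma frame_at q W : frame (Ga (cat q)) (coord TN (cat q) q) W =
  row_mx (hpart q W) (vpart D q W).
Proof.
rewrite /frame /hpart /vpart christoffelE (coordT_l (cat q) q) (coordT_r (cat q) q).
by rewrite (change_id mN _ (mem_chart_at mN q.1)).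
Qed.

Lemma coframe_at q u v : coframe (Ga (cat q)) (coord TN (cat q) q) (row_mx u v) =
  hlift D q u + vlift q v.
Proof.
rewrite /coframe row_mxKl row_mxKr /hlift /vlift add_row_mx addr0 christoffelE.
rewrite (coordT_l (cat q) q) (coordT_r (cat q) q).
by rewrite (change_id mN _ (mem_chart_at mN q.1)) [- _ + _]addrC.
Qed.

Lemma vliftN q u : vlift q (- u) = - vlift q u.
Proof. by rewrite /vlift opp_row_mx oppr0. Qed.

Lemma hliftN q u : hlift D q (- u) = - hlift D q u.
Proof.
have cl := conn_linear (special_connection sm)
  (coord_field_near mN q.2 (mem_chart_at mN q.1)).
by rewrite /hlift /christoffel (linN cl) opp_row_mx.
Qed.

Lemma I1_chart q W : I1 J D q W =
  chart_endo (Ga (cat q)) (block1 (endo_chart J (cat q))) (coord TN (cat q) q) W.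
Proof.
rewrite /chart_endo frame_at /block1 row_mxKl row_mxKr coframe_at.
by rewrite (coordT_l (cat q) q) 2!(endo_chart_at mN) vliftN.
Qed.

Lemma I2_chart q W : I2 D q W =
  chart_endo (Ga (cat q)) (@block2 R n) (coord TN (cat q) q) W.
Proof.
by rewrite /chart_endo frame_at /block2 row_mxKl row_mxKr coframe_at vliftN.
Qed.

End ObataConnection.

(** * The hypercomplex structure and the Ricci tensor *)

Section Hypercomplex.
Context {R : realType} {n : nat} {N : atlas R n}.
Variables (J : N -> 'rV[R]_n -> 'rV[R]_n)
  (D : N -> 'rV[R]_n -> (N -> 'rV[R]_n) -> 'rV[R]_n).
Hypothesis sm : special_complex_manifold J D.

Let mN := special_manifold sm.
Let sJ := complex_endo (special_complex sm).
Let JJ := complex_sq (special_complex sm).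
Let mT := manifoldT mN.

Local Notation TN := (tangent_bundle N).
Local Notation D' := (conj_conn J D).
Local Notation cat q := (chart_at N q.1).
Implicit Types (q : TN) (X Y Z : TN -> 'rV[R]_(n + n)).

Lemma block1_change a b p s : dom N a p -> dom N b p ->
  block1 (endo_chart J b) (coord N b p) (pair_change a b p s) =
  pair_change a b p (block1 (endo_chart J a) (coord N a p) s).
Proof.
move=> ap bp; have chl := change_linear mN ap bp.
rewrite /block1 /pair_change !row_mxKl !row_mxKr; apply: (congr2 row_mx).
  exact: endo_chart_change.
apply: (etrans (congr1 -%R (endo_chart_change mN J _ ap bp))).
exact: (esym (linN chl _)).
Qed.

Lemma block2_change a b p s : dom N a p -> dom N b p ->
  block2 (coord N b p) (pair_change a b p s) =
  pair_change a b p (block2 (coord N a p) s).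
Proof.
move=> ap bp; have chl := change_linear mN ap bp.
by rewrite /block2 /pair_change !row_mxKl !row_mxKr (linN chl).
Qed.

Lemma I1_smooth : smooth_endo (N := TN) (I1 J D).
Proof.
apply: (adapted_smooth (B := fun a => block1 (endo_chart J a)) sm _ block1_change
  (I1_chart sm)) => a.
exact: (block1_family (special_chart_chris sm a)).
Qed.

Lemma I2_smooth : smooth_endo (N := TN) (I2 D).
Proof.
apply: (adapted_smooth (B := fun _ => @block2 R n) sm _ block2_change (I2_chart
  sm)) => a.
exact: block2_family.
Qed.

Lemma I1_parallel : parallel_endo (N := TN) (obata J D) (I1 J D).
Proof.
have Bd a z s W : cdom a setT (lsubmx z) -> differentiable s z ->
    frame_deriv (chris D a) (chris D' a)
      (fun y => block1 (endo_chart J a) (lsubmx y) (s y)) z W =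
    block1 (endo_chart J a) (lsubmx z) (frame_deriv (chris D a) (chris D' a) s z W).
  by move=> Uz ds; exact: (frame_deriv_block1 (special_chart_chris sm a) Uz W ds).
exact: (adapted_parallel (B := fun a => block1 (endo_chart J a)) sm block1_change
  (I1_chart sm) Bd).
Qed.

Lemma I2_parallel : parallel_endo (N := TN) (obata J D) (I2 D).
Proof.
have Bd a z s W : cdom a setT (lsubmx z) -> differentiable s z ->
    frame_deriv (chris D a) (chris D' a) (fun y => block2 (lsubmx y) (s y)) z W =
    block2 (lsubmx z) (frame_deriv (chris D a) (chris D' a) s z W).
  by move=> Uz ds; exact: (frame_deriv_block2 (special_chart_chris sm a) Uz W ds).
exact: (adapted_parallel (B := fun _ => @block2 R n) sm block2_change (I2_chart sm) Bd).
Qed.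

Lemma I12 q W : I1 J D q (I2 D q W) = I3 J D q W.
Proof.
by rewrite /I2 -vliftN I1_lift /I3 (linN (endo_linear sJ q.1)) vliftN opprK.
Qed.

Lemma I21 q W : - I2 D q (I1 J D q W) = I3 J D q W.
Proof.
by rewrite /I1 -vliftN I2_lift /I3 (hliftN sm) opprD 2!opprK.
Qed.

Lemma I1_sq q W : I1 J D q (I1 J D q W) = - W.
Proof.
rewrite {2}/I1 -vliftN I1_lift JJ (linN (endo_linear sJ q.1)) JJ opprK.
by rewrite (hliftN sm) -opprD lift_decomposition.
Qed.

Lemma I2_sq q W : I2 D q (I2 D q W) = - W.
Proof.
by rewrite {2}/I2 -vliftN I2_lift (hliftN sm) -opprD lift_decomposition.
Qed.

Lemma I3_sq q W : I3 J D q (I3 J D q W) = - W.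
Proof.
rewrite -(I21 q W) -I12 (linN (endo_linear I2_smooth q)) I2_sq opprK.
exact: I1_sq.
Qed.

(** Smoothness and parallelism of I3 are inherited from the composite, without a block description
    of its own. *)
Lemma I3_comp : I3 J D = fun q W => I1 J D q (I2 D q W).
Proof. by apply/funext => q; apply/funext => W; rewrite I12. Qed.

Lemma I3_smooth : smooth_endo (N := TN) (I3 J D).
Proof.
rewrite I3_comp; split=> [q k v w|V X oV sX].
  by rewrite (endo_linear I2_smooth q) (endo_linear I1_smooth q).
exact: (endo_smooth I1_smooth oV (endo_smooth I2_smooth oV sX)).
Qed.

Lemma I3_parallel : parallel_endo (N := TN) (obata J D) (I3 J D).
Proof.
rewrite I3_comp => q v Y sY; apply/eqP; rewrite subr_eq0; apply/eqP.
have sY2 := smooth_field_near_endo I2_smooth sY.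
apply: (etrans (subr0_eq (I1_parallel v sY2))).
exact: (congr1 (I1 J D q) (subr0_eq (I2_parallel v sY))).
Qed.

Lemma hypercomplexT : hypercomplex_manifold (N := TN) (I1 J D) (I2 D) (I3 J D).
Proof.
have cO := obata_connection_axioms sm; have tO := obata_torsion_free sm.
split.
- exact: mT.
- exact: (integrable_of_parallel cO tO I1_smooth I1_sq I1_parallel).
- exact: (integrable_of_parallel cO tO I2_smooth I2_sq I2_parallel).
- exact: (integrable_of_parallel cO tO I3_smooth I3_sq I3_parallel).
- exact: I12.
- exact: I21.
Qed.

Lemma obata_is_obata :
  obata_connection (N := TN) (I1 J D) (I2 D) (I3 J D) (obata J D).
Proof.
have H : hypercomplex_connection (N := TN) (I1 J D) (I2 D) (I3 J D) (obata J D).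
  split; first exact: (obata_connection_axioms sm).
  split; first exact: (obata_torsion_free sm).
  by split; [exact: I1_parallel | exact: I2_parallel | exact: I3_parallel].
split; first exact: H.
move=> E HE; exact: (hypercomplex_connection_unique mT I1_smooth I2_smooth
  I1_sq I2_sq I12 I21 H HE).
Qed.

Lemma obata_curvature q (Y Z : TN -> 'rV[R]_(n + n)) x :
  smooth_field_near q Y -> smooth_field_near q Z ->
  let c := cat q in let z := coord TN c q in
  curvature (N := TN) (obata J D) (coord_field (N := TN) c x) Y Z q =
  coframe (chris D c) z (chart_curvature (chris D c) (chris D' c) (lsubmx z)
    (frame (chris D c) z x) (frame (chris D c) z (Y q)) (frame (chris D c) z (Z q))).
Proof.
move=> sY sZ c z; have cq : dom TN c q := mem_chart_at mN q.1.
have [V1 [oV1 V1q sY1]] := sY; have [V2 [oV2 V2q sZ2]] := sZ.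
(* On a common neighbourhood [Z] is smooth near every point, as [components_obata] requires before a
   second derivative is taken. *)
pose V := V1 `&` V2.
have oV : mopen V := mopenI mT oV1 oV2.
have Vq : V q by [].
have sYV : smooth_field V Y by apply: (smooth_field_sub _ sY1) => q' [].
have sZV : smooth_field V Z by apply: (smooth_field_sub _ sZ2) => q' [].
pose Yc := components (N := TN) c Y; pose Zc := components (N := TN) c Z.
pose O := chart_obata (chris D c) (chris D' c).
have Vz : cdom (N := TN) c V z by exact: cdom_coord.
have VU y : cdom (N := TN) c V y -> cdom c setT (lsubmx y).
  by case=> q' [cq' _] <-; rewrite coordT_l; apply: cdom_coord.
have oVc : open (cdom (N := TN) c V) := oV c.
have main := chart_obata_curvature (special_chart_chris sm c) x oVc VU Vz (sYV c)
  (sZV c).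
have Yq : Yc z = Y q := components_at mT Y q.
have Zq : Zc z = Z q := components_at mT Z q.
have near_V : \forall y \near z, cdom (N := TN) c V y := cdom_near oV cq Vq.
have near_x : \forall y \near z, components (N := TN) c (coord_field (N := TN) c
  x) y = x.
  apply: filterS near_V => _ [q' [cq' _] <-].
  apply: (etrans (components_coord_field mT x cq' cq')); exact: (change_id mT).
have T1 : obata J D q (coord_field (N := TN) c x q) (fun q' => obata J D q' (Y q') Z) =
    O (fun y => O Zc y (Yc y)) z x.
  rewrite (coord_field_at mT x q); apply: chart_obata_near.
  apply: filterS near_V => _ [q' [cq' Vq'] <-].
  have sZ' : smooth_field_near q' Z by exists V; split;
    [exact: oV | exact: Vq' | exact: sZV].
  exact: (components_obata sm Y cq' sZ').
have T2 : obata J D q (Y q) (fun q' => obata J D q' (coord_field (N := TN) c x q') Z) =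
    O (fun y => O Zc y x) z (Yc z).
  rewrite Yq; apply: chart_obata_near.
  apply: filterS (near_V) => y Vy.
  have Ex : components (N := TN) c (coord_field (N := TN) c x) y = x.
    case: Vy => q' [cq' _] <-.
    by apply: (etrans (components_coord_field mT x cq' cq')); exact: (change_id mT).
  case: Vy Ex => q' [cq' Vq'] <- Ex.
  have sZ' : smooth_field_near q' Z by exists V; split;
    [exact: oV | exact: Vq' | exact: sZV].
  have Co := components_obata sm (coord_field (N := TN) c x) cq' sZ'.
  exact: (etrans Co (congr1 (chart_obata (chris D c) (chris D' c) Zc (coord TN c
    q')) Ex)).
(* The other half of the bracket differentiates constant components. *)
have T3 : bracket (N := TN) (coord_field (N := TN) c x) Y q = 'D_x Yc z.
  rewrite /bracket (coord_field_at mT x q).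
  have E0 : 'D_(Y q) (components (N := TN) c (coord_field (N := TN) c x)) z = 0.
    apply: (etrans (near_eq_derive _ near_x)); exact: derive_cst.
  apply: (etrans (congr1 (fun v => _ - v) E0)); exact: subr0.
rewrite /curvature T1 T2 T3; apply: (etrans main).
exact: (congr2 (fun v w => coframe (chris D c) z (chart_curvature (chris D c)
  (chris D' c)
  (lsubmx z) (frame (chris D c) z x) (frame (chris D c) z v) (frame (chris D c) z
    w))) Yq Zq).
Qed.

(** The traced endomorphism is a conjugate by [frame] of the chart curvature. Cyclicity removes the
    conjugation, so no term with the fibre coordinate is left in the trace besides those inside the
    two fixed arguments. *)
Lemma obata_ricci_flat : ricci_flat (N := TN) (obata J D).
Proof.
move=> q Y Z sY sZ; pose c := cat q; pose z := coord TN c q.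
have sc := special_chart_chris sm c.
have Uz : cdom c setT (lsubmx z).
  by rewrite coordT_l; apply: cdom_coord; [exact: mem_chart_at | by []].
rewrite /ricci mxtrace_lin1.
pose k xi := chart_curvature (chris D c) (chris D' c) (lsubmx z) xi
    (frame (chris D c) z (Y q)) (frame (chris D c) z (Z q)).
transitivity (ltrace (fun x => coframe (chris D c) z (k (frame (chris D c) z x)))).
  apply: (congr1 (@ltrace R (n + n))); apply/funext => x;
    exact: (obata_curvature x sY sZ).
have kl : linear k := chart_curvature_linear sc _ _ Uz.
rewrite (ltraceC (coframe_linear sc Uz) (linear_comp_fun (frame_linear sc Uz) kl)).
transitivity (ltrace k); last exact: (ltrace_curvature sc _ _ Uz).
by apply: (congr1 (@ltrace R (n + n))); apply/funext => x;
  exact: (congr1 k (coframeK _ _ _)).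
Qed.

End Hypercomplex.

Theorem theorem6p5 (R : realType) (n : nat) (N : atlas R n)
    (J : N -> 'rV[R]_n -> 'rV[R]_n)
    (D : N -> 'rV[R]_n -> (N -> 'rV[R]_n) -> 'rV[R]_n) :
  special_complex_manifold J D ->
  hypercomplex_manifold (N := tangent_bundle N) (I1 J D) (I2 D) (I3 J D) /\
  exists Ob : tangent_bundle N -> 'rV[R]_(n + n) ->
      (tangent_bundle N -> 'rV[R]_(n + n)) -> 'rV[R]_(n + n),
    obata_connection (N := tangent_bundle N) (I1 J D) (I2 D) (I3 J D) Ob /\
    ricci_flat Ob.
Proof.
move=> sm; split; first exact: hypercomplexT.
by exists (obata J D); split; [exact: obata_is_obata | exact: obata_ricci_flat].
Qed.
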